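(* Let $(M,J,\theta)$ be a closed pseudohermitian $(2n+1)$-manifold with nonnegative pseudohermitian Ricci curvature and vanishing torsion. Then there exists a (large) constant $\delta_0=\delta_0(n)\gg 1$ such that the following holds. If $u(x,t)$ is a positive solution of $$\Big(\Delta_b-\frac{\partial}{\partial t}\Big)u(x,t)=0\quad\text{on } M\times[0,\infty),$$ and $f(x,t)=\ln u(x,t)$, then for every $\delta>\delta_0$, on $M\times(0,\infty)$, $$|\nabla_b f|^2-\delta f_t<\frac{C_1}{t},$$ where $$C_1=\frac12\max\left\{ n(n+1)\delta^2+\frac{8\sqrt3\,(n+1)^2\delta^2}{\delta-\delta_0},\ \frac{3n(n+1)\delta^2}{4(\delta-\delta_0)^2}\left[\frac{16(n+1)}{n}\right]^2\right\}.$$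
   Context: A pseudohermitian $(2n+1)$-manifold $(M,J,\theta)$ is a strictly pseudoconvex CR manifold: a $(2n+1)$-dimensional orientable manifold with contact form $\theta$, contact bundle $\xi=\ker\theta$, and an integrable complex structure $J$ on $\xi$ with positive definite Levi form. $\mathbf{T}$ is the characteristic (Reeb) vector field, and $T_{1,0}M$, $T_{0,1}M$ are the $\pm i$-eigenspaces of $J$ on $\mathbb{C}\otimes\xi$. For a local frame $Z_\alpha$ of $T_{1,0}M$, $Z_{\bar\alpha}=\overline{Z_\alpha}$, with dual coframe $\{\theta,\theta^\alpha,\theta^{\bar\alpha}\}$, one has $d\theta=i h_{\alpha\bar\beta}\theta^\alpha\wedge\theta^{\bar\beta}$ with $(h_{\alpha\bar\beta})$ positive definite Hermitian; components below are taken in frames with $h_{\alpha\bar\beta}=\delta_{\alpha\beta}$. The Tanaka–Webster (pseudohermitian) connection $\nabla$ is given by $\nabla Z_\alpha=\omega_\alpha{}^\beta\otimes Z_\beta$, $\nabla Z_{\bar\alpha}=\omega_{\bar\alpha}{}^{\bar\beta}\otimes Z_{\bar\beta}$, $\nabla \mathbf{T}=0$, where $d\theta^\beta=\theta^\alpha\wedge\omega_\alpha{}^\beta+\theta\wedge\tau^\beta$, $\tau_\alpha\wedge\theta^\alpha=0$, $\omega_\alpha{}^\beta+\omega_{\bar\beta}{}^{\bar\alpha}=0$. The torsion is $A_{\alpha\gamma}=A_{\gamma\alpha}$ with $\tau_\alpha=A_{\alpha\gamma}\theta^\gamma$; vanishing torsion means $A_{\alpha\gamma}=0$. The curvature form has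 the structure $d\omega_\beta{}^\alpha-\omega_\beta{}^\gamma\wedge\omega_\gamma{}^\alpha=R_\beta{}^\alpha{}_{\rho\bar\sigma}\theta^\rho\wedge\theta^{\bar\sigma}+W_\beta{}^\alpha{}_\rho\theta^\rho\wedge\theta-W^\alpha{}_{\beta\bar\rho}\theta^{\bar\rho}\wedge\theta+i\theta_\beta\wedge\tau^\alpha-i\tau_\beta\wedge\theta^\alpha$. The pseudohermitian Ricci tensor is $R_{\alpha\bar\beta}=R_\gamma{}^\gamma{}_{\alpha\bar\beta}$; it is nonnegative if $R_{\alpha\bar\beta}Z^\alpha Z^{\bar\beta}\ge0$ for all $Z=Z^\alpha Z_\alpha\in T_{1,0}M$. For a function $u$: $u_\alpha=Z_\alpha u$, $u_{\alpha\bar\beta}=Z_{\bar\beta}Z_\alpha u-\omega_\alpha{}^\gamma(Z_{\bar\beta})Z_\gamma u$, $|\nabla_b u|^2=2\sum_\alpha u_\alpha u_{\bar\alpha}$, and the sub-Laplacian is $\Delta_b u=\sum_\alpha(u_{\alpha\bar\alpha}+u_{\bar\alpha\alpha})$. $f_t=\partial f/\partial t$. *)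

(* Defs.v *)
(* MathComp-Analysis, over an arbitrary R : realType; complex numbers are R[i]. *)
From HB Require Import structures.
From mathcomp Require Import all_boot all_order all_algebra.
From mathcomp Require Import complex.
From mathcomp Require Import all_classical all_reals all_analysis.

Set Implicit Arguments.
Unset Strict Implicit.
Unset Printing Implicit Defensive.

Import Order.TTheory GRing.Theory Num.Theory.
Import numFieldNormedType.Exports.

Local Open Scope classical_set_scope.
Local Open Scope ring_scope.

(** * Smooth functions and smooth manifolds *)

(* C^k on the open set U: all iterated directional derivatives of order at most
   k exist and are continuous on U.  E is only ever R^m or R^m x R, where this
   is the usual notion. *)
Fixpoint Ck (R : realType) (E F : normedModType R) (k : nat) (U : set E)
    (f : E -> F) : Prop :=
  (forall x, U x -> {for x, continuous f}) /\
  (if k is k'.+1 then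
     forall v : E, (forall x, U x -> derivable f x v) /\ Ck k' U ('D_v f)
   else True).

Definition Cinfty (R : realType) (E F : normedModType R) (U : set E)
    (f : E -> F) : Prop :=
  forall k, Ck k U f.

Record chart (R : realType) (m : nat) (M : topologicalType) := Chart {
  cdom : set M;
  cimg : set 'rV[R]_m;
  cmap : M -> 'rV[R]_m;
  cinv : 'rV[R]_m -> M;
  cdom_open : open cdom;
  cimg_open : open cimg;
  cmap_img : forall p, cdom p -> cimg (cmap p);
  cinv_dom : forall x, cimg x -> cdom (cinv x);
  cmapK : forall p, cdom p -> cinv (cmap p) = p;
  cinvK : forall x, cimg x -> cmap (cinv x) = x;
  cmap_cont : forall p, cdom p -> {for p, continuous cmap};
  cinv_cont : forall x, cimg x -> {for x, continuous cinv} }.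

(* Smooth manifolds of dimension m, without boundary. *)
Record manifold (R : realType) (m : nat) := Manifold {
  mcarrier :> topologicalType;
  mhausdorff : hausdorff_space mcarrier;
  mcountable : @second_countable mcarrier;
  atlas : set (chart R m mcarrier);
  atlas_cover : forall p, exists c, atlas c /\ cdom c p;
  atlas_compat : forall c c', atlas c -> atlas c' ->
    Cinfty (cimg c `&` cinv c @^-1` cdom c') (fun x => cmap c' (cinv c x)) }.

Definition rsmooth_on (R : realType) (m : nat) (M : manifold R m) (U : set M)
    (f : M -> R) : Prop :=
  forall c, atlas c ->
    Cinfty (cimg c `&` cinv c @^-1` U) (fun x => f (cinv c x)).

Definition smooth_on (R : realType) (m : nat) (M : manifold R m) (U : set M)
    (f : M -> R[i]) : Prop :=
  rsmooth_on U (fun x => complex.Re (f x)) /\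
  rsmooth_on U (fun x => complex.Im (f x)).

Definition smooth_at (R : realType) (m : nat) (M : manifold R m) (p : M)
    (f : M -> R[i]) : Prop :=
  exists U : set M, [/\ open U, U p & smooth_on U f].

Definition smooth_spacetime (R : realType) (m : nat) (M : manifold R m)
    (v : M -> R -> R) : Prop :=
  forall c : chart R m M, atlas c ->
    Cinfty (cimg c `*` [set: R])
      (fun z : 'rV[R]_m * R => v (cinv c z.1) z.2).

(** * Tangent vectors, vector fields, differential forms (all complexified) *)

(* C (x) T_pM is the space of C-linear derivations at p of the germs at p of
   smooth complex functions.  A [tvec] is a representative: only its values on
   the functions smooth at p matter, and [tveq p] is the resulting equality. *)
Definition tvec (R : realType) (m : nat) (M : manifold R m) :=
  (M -> R[i]) -> R[i].

Definition tveq (R : realType) (m : nat) (M : manifold R m) (p : M)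
    (v w : tvec M) : Prop :=
  forall f, smooth_at p f -> v f = w f.

Definition tzero (R : realType) (m : nat) (M : manifold R m) : tvec M :=
  fun=> 0.

Definition tlin (R : realType) (m : nat) (M : manifold R m) (a : R[i])
    (v w : tvec M) : tvec M :=
  fun f => a * v f + w f.

Definition tconj (R : realType) (m : nat) (M : manifold R m) (v : tvec M) :
    tvec M :=
  fun f => (v (fun x => (f x)^*))^*.

Record tangent (R : realType) (m : nat) (M : manifold R m) (p : M)
    (v : tvec M) : Prop := Tangent {
  tangent_linear : forall (a : R[i]) f g, smooth_at p f -> smooth_at p g ->
    v (fun x => a * f x + g x) = a * v f + v g;
  tangent_leibniz : forall f g, smooth_at p f -> smooth_at p g ->
    v (fun x => f x * g x) = v f * g p + f p * v g }.

Definition vfield (R : realType) (m : nat) (M : manifold R m) := M -> tvec M.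

Definition fconj (R : realType) (m : nat) (M : manifold R m) (X : vfield M) :
    vfield M :=
  fun p => tconj (X p).

Definition vfield_on (R : realType) (m : nat) (M : manifold R m) (U : set M)
    (X : vfield M) : Prop :=
  (forall p, U p -> tangent p (X p)) /\
  (forall (V : set M) f, open V -> V `<=` U -> smooth_on V f ->
     smooth_on V (fun q => X q f)).

Definition bracket (R : realType) (m : nat) (M : manifold R m)
    (X Y : vfield M) : vfield M :=
  fun p f => X p (fun q => Y q f) - Y p (fun q => X q f).

Definition oneform (R : realType) (m : nat) (M : manifold R m) :=
  M -> tvec M -> R[i].

(* C-linearity of eta p on C (x) T_pM, including compatibility with [tveq]. *)
Definition form_on (R : realType) (m : nat) (M : manifold R m) (U : set M)
    (eta : oneform M) : Prop :=
  (forall p (a : R[i]) u v w, U p -> tangent p u -> tangent p v ->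
     tangent p w -> tveq p u (tlin a v w) ->
     eta p u = a * eta p v + eta p w) /\
  (forall (V : set M) X, open V -> V `<=` U -> vfield_on V X ->
     smooth_on V (fun q => eta q (X q))).

Definition form_conj (R : realType) (m : nat) (M : manifold R m)
    (eta : oneform M) : oneform M :=
  fun p v => (eta p (tconj v))^*.

(* The value (d eta)(X, Y) at p. *)
Definition dform (R : realType) (m : nat) (M : manifold R m) (eta : oneform M)
    (X Y : vfield M) (p : M) : R[i] :=
  X p (fun q => eta q (Y q)) - Y p (fun q => eta q (X q))
  - eta p (bracket X Y p).

Definition form_wedge (R : realType) (m : nat) (M : manifold R m)
    (eta zeta : oneform M) (p : M) (v w : tvec M) : R[i] :=
  eta p v * zeta p w - eta p w * zeta p v.

(** * Pseudohermitian manifolds *)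

Definition contact_vec (R : realType) (m : nat) (M : manifold R m)
    (theta : oneform M) (p : M) (v : tvec M) : Prop :=
  tangent p v /\ theta p v = 0.

Definition contact_field (R : realType) (m : nat) (M : manifold R m)
    (theta : oneform M) (U : set M) (X : vfield M) : Prop :=
  vfield_on U X /\ forall p, U p -> theta p (X p) = 0.

(* T_{1,0}M, the i-eigenspace of J on C (x) xi, and its local sections. *)
Definition T10_vec (R : realType) (m : nat) (M : manifold R m)
    (theta : oneform M) (J : M -> tvec M -> tvec M) (p : M) (v : tvec M) : Prop :=
  contact_vec theta p v /\ tveq p (J p v) (tlin 'i v (@tzero R m M)).

Definition T10_field (R : realType) (m : nat) (M : manifold R m)
    (theta : oneform M) (J : M -> tvec M -> tvec M) (U : set M) (X : vfield M) :
    Prop :=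
  vfield_on U X /\ forall p, U p -> T10_vec theta J p (X p).

(* theta and J are given by their C-linear extensions; that they are real is
   the commutation with conjugation.  J is only meaningful on C (x) xi. *)
Record pseudohermitian (R : realType) (n : nat) := Pseudohermitian {
  ph_manifold :> manifold R (n.*2.+1);
  theta : oneform ph_manifold;
  Jop : ph_manifold -> tvec ph_manifold -> tvec ph_manifold;
  reeb : vfield ph_manifold;
  (* theta is a contact form with contact bundle xi = ker theta *)
  theta_form : form_on setT theta;
  theta_real : forall p v, tangent p v -> theta p (tconj v) = (theta p v)^*;
  theta_neq0 : forall p, exists2 v, tangent p v & theta p v != 0;
  theta_contact : forall (U : set ph_manifold) X p, open U -> U p ->
    contact_field theta U X -> ~ tveq p (X p) (@tzero R _ ph_manifold) ->
    exists (V : set ph_manifold) (Y : vfield ph_manifold),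
      [/\ open V, V p, contact_field theta V Y & dform theta X Y p != 0];
  (* the Reeb field *)
  reeb_field : vfield_on setT reeb;
  reeb_real : forall p, tveq p (tconj (reeb p)) (reeb p);
  theta_reeb : forall p, theta p (reeb p) = 1;
  dtheta_reeb : forall (U : set ph_manifold) X p, open U -> U p ->
    vfield_on U X -> dform theta reeb X p = 0;
  (* J is a smooth bundle endomorphism of xi with J^2 = -1 *)
  J_contact : forall p v, contact_vec theta p v ->
    contact_vec theta p (Jop p v);
  J_linear : forall p (a : R[i]) u v w, contact_vec theta p u ->
    contact_vec theta p v -> contact_vec theta p w ->
    tveq p u (tlin a v w) -> tveq p (Jop p u) (tlin a (Jop p v) (Jop p w));
  J_smooth : forall (U : set ph_manifold) X, open U ->
    contact_field theta U X -> vfield_on U (fun q => Jop q (X q));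
  J_real : forall p v, contact_vec theta p v ->
    tveq p (Jop p (tconj v)) (tconj (Jop p v));
  J_sqr : forall p v, contact_vec theta p v ->
    tveq p (Jop p (Jop p v)) (tlin (-1) v (@tzero R _ ph_manifold));
  (* [T_{1,0}, T_{1,0}] is contained in T_{1,0} *)
  J_integrable : forall (U : set ph_manifold) X Y, open U ->
    T10_field theta Jop U X -> T10_field theta Jop U Y ->
    T10_field theta Jop U (bracket X Y);
  (* positive Levi form: d theta = i h_{a b} theta^a /\ theta^{\bar b} *)
  levi_pos : forall (U : set ph_manifold) Z p, open U -> U p ->
    T10_field theta Jop U Z -> ~ tveq p (Z p) (@tzero R _ ph_manifold) ->
    0 < - 'i * dform theta Z (fconj Z) p }.

(* A local frame Z_a of T_{1,0}M on the open set U with h_{a \bar b} = delta,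
   and the forms theta^a of the coframe dual to {T, Z_a, Z_{\bar a}}. *)
Record unitary_frame (R : realType) (n : nat) (M : pseudohermitian R n)
    (U : set M) (Z : 'I_n -> vfield M) (th : 'I_n -> oneform M) : Prop :=
  UnitaryFrame {
  uf_open : open U;
  uf_T10 : forall a, T10_field (@theta R n M) (@Jop R n M) U (Z a);
  uf_unitary : forall a b p, U p ->
    dform (@theta R n M) (Z a) (fconj (Z b)) p = 'i * (a == b)%:R;
  uf_form : forall a, form_on U (th a);
  uf_dual : forall a b p, U p -> th b p (Z a p) = (a == b)%:R;
  uf_dualC : forall a b p, U p -> th b p (fconj (Z a) p) = 0;
  uf_dualT : forall b p, U p -> th b p (reeb p) = 0 }.

(** * The Tanaka-Webster connection *)

(* [nabla p v Y] is the covariant derivative at p of the local field Y along v. *)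
Definition covder (R : realType) (m : nat) (M : manifold R m) :=
  M -> tvec M -> vfield M -> tvec M.

(* omega_a^b, read off from nabla Z_a = omega_a^b (x) Z_b. *)
Definition conn_form (R : realType) (m n : nat) (M : manifold R m)
    (nabla : covder M) (Z : 'I_n -> vfield M) (th : 'I_n -> oneform M)
    (a b : 'I_n) : oneform M :=
  fun p v => th b p (nabla p v (Z a)).

(* tau_a = A_{a c} theta^c; since h = delta, tau^a is the conjugate of tau_a. *)
Definition tau_form (R : realType) (m n : nat) (M : manifold R m)
    (th : 'I_n -> oneform M) (A : 'I_n -> 'I_n -> M -> R[i]) (a : 'I_n) : oneform M :=
  fun p v => \sum_(c < n) A a c p * th c p v.

(* A is symmetric, and
   d theta^b = theta^a /\ omega_a^b + theta /\ tau^b on U. *)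
Definition torsion_coeff (R : realType) (n : nat) (M : pseudohermitian R n)
    (nabla : covder M) (U : set M) (Z : 'I_n -> vfield M) (th : 'I_n -> oneform M)
    (A : 'I_n -> 'I_n -> M -> R[i]) : Prop :=
  (forall a c p, U p -> A a c p = A c a p) /\
  (forall b (V : set M) X Y p, open V -> V `<=` U -> V p ->
     vfield_on V X -> vfield_on V Y ->
     dform (th b) X Y p =
       \sum_(a < n) form_wedge (th a) (conn_form nabla Z th a b) p (X p) (Y p)
       + form_wedge (@theta R n M) (form_conj (tau_form th A b)) p (X p) (Y p)).

Record tanaka_webster (R : realType) (n : nat) (M : pseudohermitian R n) :=
  TanakaWebster {
  nabla :> covder M;
  (* nabla is a connection on C (x) TM commuting with conjugation *)
  nabla_linear : forall (U : set M) Y p (a : R[i]) u v w, open U -> U p ->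
    vfield_on U Y -> tangent p u -> tangent p v -> tangent p w ->
    tveq p u (tlin a v w) ->
    tveq p (nabla p u Y) (tlin a (nabla p v Y) (nabla p w Y));
  nabla_smooth : forall (U : set M) X Y, open U -> vfield_on U X ->
    vfield_on U Y -> vfield_on U (fun q => nabla q (X q) Y);
  nabla_leibniz : forall (U : set M) f X Y Y' p v, open U -> U p ->
    smooth_on U f -> vfield_on U X -> vfield_on U Y -> vfield_on U Y' ->
    tangent p v ->
    (forall q, U q -> tveq q (X q) (tlin (f q) (Y q) (Y' q))) ->
    tveq p (nabla p v X)
      (tlin (v f) (Y p) (tlin (f p) (nabla p v Y) (nabla p v Y')));
  nabla_conj : forall (U : set M) Y p v, open U -> U p -> vfield_on U Y ->
    tangent p v -> tveq p (nabla p (tconj v) (fconj Y)) (tconj (nabla p v Y));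
  (* nabla T = 0 and nabla Z_a = omega_a^b (x) Z_b, with
     omega_a^b + omega_{\bar b}^{\bar a} = 0 and the first structure equation *)
  nabla_reeb : forall p v, tangent p v ->
    tveq p (nabla p v (@reeb R n M)) (@tzero R _ M);
  nabla_T10 : forall (U : set M) Z th a p v, unitary_frame U Z th -> U p ->
    tangent p v ->
    tveq p (nabla p v (Z a))
      (fun f => \sum_(b < n) conn_form nabla Z th a b p v * Z b p f);
  nabla_skew : forall (U : set M) Z th a b p v, unitary_frame U Z th -> U p ->
    tangent p v ->
    conn_form nabla Z th a b p v
      + form_conj (conn_form nabla Z th b a) p v = 0;
  nabla_torsion : forall (U : set M) Z th, unitary_frame U Z th ->
    exists A, torsion_coeff nabla U Z th A }.

Definition vanishing_torsion (R : realType) (n : nat) (M : pseudohermitian R n)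
    (nabla : tanaka_webster M) : Prop :=
  forall (U : set M) Z th A, unitary_frame U Z th ->
    torsion_coeff nabla U Z th A -> forall a c p, U p -> A a c p = 0.

(* R_b^a_{r \bar s}: the coefficient of theta^r /\ theta^{\bar s} in
   d omega_b^a - omega_b^c /\ omega_c^a, i.e. the value of this 2-form on
   (Z_r, Z_{\bar s}); the other terms of the structure equation are of type
   (2,0), (0,2) or contain theta, and vanish there. *)
Definition curvature (R : realType) (m n : nat) (M : manifold R m)
    (nabla : covder M) (Z : 'I_n -> vfield M) (th : 'I_n -> oneform M)
    (b a r s : 'I_n) (p : M) : R[i] :=
  let omega := conn_form nabla Z th in
  dform (omega b a) (Z r) (fconj (Z s)) p
  - \sum_(c < n) form_wedge (omega b c) (omega c a) p (Z r p) (fconj (Z s) p).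

Definition ricci (R : realType) (m n : nat) (M : manifold R m)
    (nabla : covder M) (Z : 'I_n -> vfield M) (th : 'I_n -> oneform M)
    (a b : 'I_n) (p : M) : R[i] :=
  \sum_(c < n) curvature nabla Z th c c a b p.

Definition nonneg_ricci (R : realType) (n : nat) (M : pseudohermitian R n)
    (nabla : tanaka_webster M) : Prop :=
  forall (U : set M) Z th p (z : 'I_n -> R[i]), unitary_frame U Z th -> U p ->
    0 <= \sum_(a < n) \sum_(b < n) ricci nabla Z th a b p * z a * (z b)^*.

(** * Sub-Laplacian, subgradient and the heat equation *)

Definition cfun (R : realType) (m : nat) (M : manifold R m) (u : M -> R) :
    M -> R[i] :=
  fun x => (u x)%:C%C.

(* u_{a \bar b} = Z_{\bar b} Z_a u - omega_a^c(Z_{\bar b}) Z_c u *)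
Definition hess_abar (R : realType) (m n : nat) (M : manifold R m)
    (nabla : covder M) (Z : 'I_n -> vfield M) (th : 'I_n -> oneform M)
    (u : M -> R[i]) (a b : 'I_n) (p : M) : R[i] :=
  fconj (Z b) p (fun q => Z a q u)
  - \sum_(c < n) conn_form nabla Z th a c p (fconj (Z b) p) * Z c p u.

(* u_{\bar a b} = Z_b Z_{\bar a} u - omega_{\bar a}^{\bar c}(Z_b) Z_{\bar c} u *)
Definition hess_bara (R : realType) (m n : nat) (M : manifold R m)
    (nabla : covder M) (Z : 'I_n -> vfield M) (th : 'I_n -> oneform M)
    (u : M -> R[i]) (a b : 'I_n) (p : M) : R[i] :=
  Z b p (fun q => fconj (Z a) q u)
  - \sum_(c < n)
      form_conj (conn_form nabla Z th a c) p (Z b p) * fconj (Z c) p u.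

Definition sublaplacian (R : realType) (m n : nat) (M : manifold R m)
    (nabla : covder M) (Z : 'I_n -> vfield M) (th : 'I_n -> oneform M)
    (u : M -> R[i]) (p : M) : R[i] :=
  \sum_(a < n) (hess_abar nabla Z th u a a p + hess_bara nabla Z th u a a p).

Definition subgrad_sq (R : realType) (m n : nat) (M : manifold R m)
    (Z : 'I_n -> vfield M) (u : M -> R[i]) (p : M) : R[i] :=
  2 * \sum_(a < n) Z a p u * fconj (Z a) p u.

(* Solutions on M x [0, oo), smooth up to t = 0: u is the restriction of a
   smooth function v on M x R (the values of u at t < 0 are irrelevant), so
   that the time derivative of v at t = 0 is the one-sided one of u.  The
   sub-Laplacian does not depend on the unitary frame; the equation is written
   in every frame. *)
Definition heat_solution (R : realType) (n : nat) (M : pseudohermitian R n)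
    (nabla : tanaka_webster M) (u : M -> R -> R) : Prop :=
  exists v : M -> R -> R,
    [/\ smooth_spacetime v,
        forall x t, 0 <= t -> u x t = v x t &
        forall x t, 0 <= t -> forall (U : set M) Z th,
          unitary_frame U Z th -> U x ->
          sublaplacian nabla Z th (cfun (fun y => v y t)) x
            - (derive1 (v x) t)%:C%C = 0].

Definition C1 (R : realType) (n : nat) (delta delta0 : R) : R :=
  2^-1 * Num.max
    (n%:R * (n%:R + 1) * delta ^+ 2
       + 8 * Num.sqrt 3 * (n%:R + 1) ^+ 2 * delta ^+ 2 / (delta - delta0))
    (3 * n%:R * (n%:R + 1) * delta ^+ 2 / (4 * (delta - delta0) ^+ 2)
       * (16 * (n%:R + 1) / n%:R) ^+ 2).

(* Main.v *)
(* With f = ln u, the heat equation reads f_t = Delta_b f + |grad_b f|^2. For eps > 0 let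
     Phi = (t - eps) (|grad_b f|^2 - delta f_t) + (n/3) (t - eps)^2 (T f)^2,   T the Reeb field,
   on the compact space M x [eps, t0]. As the torsion vanishes, T commutes with Delta_b, so that
   f_t and T f are annihilated by the linearized operator H = Delta_b + 2 <grad_b f, grad_b . > - d/dt,
   and H((T f)^2) = 2 |grad_b T f|^2. The Bochner formula and Ric >= 0 give
     H(|grad_b f|^2) >= (Delta_b f)^2 / n + n (T f)^2 + (a multiple of <J grad_b f, grad_b T f>),
   where the term in T f comes from the antisymmetric part of the Hessian, and the cross term is
   absorbed by the last summand of Phi. At a maximum of Phi with t > eps one has H(Phi) <= 0, which
   for delta > 7 yields Phi <= n delta^2; then let eps tend to 0 and note n delta^2 < C1.

   The identities are derived in an abstract commutative ring with derivations satisfying the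
   bracket relations of a unitary frame, the curvature symmetries being consequences of the Jacobi
   identity; the smooth functions on V x (0, oo), V a chart domain carrying a unitary frame, form
   such a ring. *)

(* Write c for the weight n/3 of (T f)^2. Completing the square absorbs the cross term at the cost
   (2/c) |grad_b f|^2, so c should be large; but the multiples of (t - eps)^2 (T f)^2 add up to n -
   3c, which must not be negative. With c = n/3 the remaining condition is 2 (delta - 1) >= 6/n, and
   delta > 7 ensures it for every n. The shift by eps makes Phi vanish at the initial time while M x
   [eps, t0] stays inside t > 0, where ln u has two-sided time derivatives. Two obstacles come from
   the definitions. Tangent vectors are derivations of germs: that the coordinates of a chart
   determine them is Hadamard's lemma, hence the parameter integrals. Unitary frames exist only
   locally: they are built by Gram-Schmidt from projected coordinate fields, and Phi is a function
   on M because |grad_b f|^2 does not depend on the frame. The abstract ring carries no conjugation;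
   exchanging Z_a with Z_{\bar a} replaces it and turns each identity into its conjugate. *)
Require Import Defs.
From HB Require Import structures.
From mathcomp Require Import all_boot all_order all_algebra.
From mathcomp Require Import complex ring lra.
From mathcomp Require Import all_classical all_reals all_analysis.
Import Order.TTheory GRing.Theory Num.Theory.
Import numFieldNormedType.Exports.
Local Open Scope classical_set_scope.
Local Open Scope ring_scope.

Set Implicit Arguments.
Unset Strict Implicit.
Unset Printing Implicit Defensive.

(** * Calculus of C^k functions *)

Section CkCalculus.
Variables (R : realType) (E : normedModType R).
Implicit Types (U V : set E) (f g : E -> R).

(** The two difference quotients coincide as functions of the increment, so one-variable results
    such as the chain rule and the mean value theorem apply to directional derivatives. *)
Lemma is_derive_slice (F : normedModType R) (f : E -> F) (x v : E) (s : R) (df : F) :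
  is_derive (x + s *: v) v f df <-> is_derive s 1 (fun r : R => f (x + r *: v)) df.
Proof.
have e : (fun h : R => h^-1 *: (f (h *: v + (x + s *: v)) - f (x + s *: v))) =
  (fun h : R => h^-1 *: (f (x + (h *: (1:R) + s) *: v) - f (x + s *: v))).
  apply/funext => h; congr (_ *: (f _ - _)).
  by rewrite addrCA scalerDl -[h *: 1]/(h * 1) mulr1.
split=> -[d e1]; constructor; move: d e1; rewrite /derivable /derive /= ?e -?e //.
Qed.

Lemma is_derive_slice0 (F : normedModType R) (f : E -> F) (x v : E) (df : F) :
  is_derive x v f df <-> is_derive (0 : R) 1 (fun r : R => f (x + r *: v)) df.
Proof. by rewrite -is_derive_slice scale0r addr0. Qed.

Lemma is_derive_comp1 (f : E -> R) (g : R -> R) (x v : E) (a b : R) :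
  is_derive x v f a -> is_derive (f x) 1 g b -> is_derive x v (fun y => g (f y)) (b * a).
Proof.
move=> /is_derive_slice0 h1 h2; apply/is_derive_slice0.
apply: (is_derive1_comp (f := g) (g := fun r => f (x + r *: v))).
by rewrite scale0r addr0.
Qed.

Lemma Ck_cont k U (F : normedModType R) (f : E -> F) x : Ck k U f -> U x -> {for x, continuous f}.
Proof. by case: k => [|k] [h _]; apply: h. Qed.

Lemma Ck_pred k U (F : normedModType R) (f : E -> F) : Ck k.+1 U f -> Ck k U f.
Proof.
elim: k f => [|k IH] f [c h]; split=> // v; have [d e] := h v; split=> //.
exact: IH.
Qed.

Lemma CkS_derive k U (F : normedModType R) (f : E -> F) v : Ck k.+1 U f -> Ck k U ('D_v f).
Proof. by move=> [_ /(_ v)[]]. Qed.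

Lemma CkS_is_derive k U (F : normedModType R) (f : E -> F) x v :
  Ck k.+1 U f -> U x -> is_derive x v f ('D_v f x).
Proof. by move=> [_ /(_ v)[d _]] Ux; apply: DeriveDef => //; apply: d. Qed.

Lemma sub_Ck k U V (F : normedModType R) (f : E -> F) : V `<=` U -> Ck k U f -> Ck k V f.
Proof.
move=> VU; elim: k f => [|k IH] f [c h]; split=> //; first by move=> x /VU; apply: c.
  by move=> x /VU; apply: c.
by move=> v; have [d e] := h v; split; [move=> x /VU; apply: d | apply: IH].
Qed.

Lemma eq_Ck k U (F : normedModType R) (f g : E -> F) : open U -> (forall x, U x -> f x = g x) ->
  Ck k U f -> Ck k U g.
Proof.
move=> oU; elim: k f g => [|k IH] f g fg [c h].
  split=> // x Ux; rewrite /prop_for /continuous_at -(fg x) //.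
  apply: cvg_trans (c x Ux); apply: near_eq_cvg; near=> y.
  by rewrite fg //; near: y; apply: open_nbhs_nbhs.
have nfg x : U x -> \near x, f x = g x.
  by move=> Ux; near=> y; apply: fg; near: y; apply: open_nbhs_nbhs.
split=> [x Ux|v].
  rewrite /prop_for /continuous_at -(fg x) //.
  by apply: cvg_trans (c x Ux); apply: near_eq_cvg; move: (nfg x Ux); apply: filterS => y ->.
have [d e] := h v; split.
  by move=> x Ux; apply: near_eq_derivable (d x Ux); apply: nfg.
by apply: IH e => x Ux; apply: near_eq_derive; apply: nfg.
Unshelve. all: by end_near. Qed.

(** [Ck] speaks of the total function ['D_v f]; as [U] is open, a formula for the derivative valid
    on [U] alone may replace it. Most closure properties below are inductions through this lemma. *)
Lemma CkS_intro k U (F : normedModType R) (f : E -> F) : open U ->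
  (forall x, U x -> {for x, continuous f}) ->
  (forall v, exists2 df, Ck k U df & forall x, U x -> is_derive x v f (df x)) ->
  Ck k.+1 U f.
Proof.
move=> oU c h; split=> // v; have [df ck d] := h v; split.
  by move=> x Ux; apply: (@ex_derive _ _ _ _ _ _ _ (d x Ux)).
by apply: eq_Ck ck => // x Ux; rewrite (@derive_val _ _ _ _ _ _ _ (d x Ux)).
Qed.

Lemma Ck_cst k U (F : normedModType R) (a : F) : Ck k U (fun=> a : F).
Proof.
elim: k a => [|k IH] a; split=> //; try by move=> x _; apply: cvg_cst.
move=> v; split=> [x _|]; first exact: derivable_cst.
have -> : 'D_v (fun=> a : F) = (fun=> 0) :> (E -> F) by apply/funext => x; rewrite derive_cst.
exact: IH.
Qed.

Lemma CkD k U (F : normedModType R) (f g : E -> F) : open U -> Ck k U f -> Ck k U g ->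
  Ck k U (fun x => f x + g x).
Proof.
move=> oU; elim: k f g => [|k IH] f g hf hg.
  by split=> // x Ux; apply: cvgD; [apply: Ck_cont hf _ | apply: Ck_cont hg _].
apply: CkS_intro => //.
  by move=> x Ux; apply: cvgD; [apply: Ck_cont hf _ | apply: Ck_cont hg _].
move=> v; exists (fun x => 'D_v f x + 'D_v g x).
  by apply: IH; apply: CkS_derive.
by move=> x Ux; apply: is_deriveD; [exact: (CkS_is_derive _ hf Ux) | exact: (CkS_is_derive _ hg Ux)].
Qed.

Lemma CkM k U f g : open U -> Ck k U f -> Ck k U g -> Ck k U (fun x => f x * g x).
Proof.
move=> oU; elim: k f g => [|k IH] f g hf hg.
  by split=> // x Ux; apply: cvgM; [apply: Ck_cont hf _ | apply: Ck_cont hg _].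
apply: CkS_intro => //.
  by move=> x Ux; apply: cvgM; [apply: Ck_cont hf _ | apply: Ck_cont hg _].
move=> v; exists (fun x => f x * 'D_v g x + g x * 'D_v f x).
  by apply: CkD => //; apply: IH; (exact: Ck_pred || exact: CkS_derive).
by move=> x Ux; apply: is_deriveM; [exact: (CkS_is_derive _ hf Ux) | exact: (CkS_is_derive _ hg Ux)].
Qed.

Lemma Ck_expR k U f : open U -> Ck k U f -> Ck k U (fun x => expR (f x)).
Proof.
move=> oU; have cont j g x : Ck j U g -> U x -> {for x, continuous (fun y => expR (g y))}.
  by move=> hg Ux; apply: continuous_comp (Ck_cont hg Ux) _; apply: continuous_expR.
elim: k f => [|k IH] f hf; first by split=> // x; apply: cont hf.
apply: CkS_intro => //; first by move=> x; apply: cont hf.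
move=> v; exists (fun x => expR (f x) * 'D_v f x).
  by apply: CkM => //; [apply: IH; apply: Ck_pred | apply: CkS_derive].
move=> x Ux; apply: is_derive_comp1 (is_derive_expR _).
exact: (CkS_is_derive _ hf Ux).
Qed.

Lemma Ck_ln k U f : open U -> (forall x, U x -> 0 < f x) -> Ck k U f ->
  Ck k U (fun x => ln (f x)).
Proof.
move=> oU pos; have cont j g x : Ck j U g -> U x -> 0 < g x ->
    {for x, continuous (fun y => ln (g y))}.
  by move=> hg Ux gx; apply: continuous_comp (Ck_cont hg Ux) _; apply: continuous_ln.
elim: k => [|k IH] hf; first by split=> // x Ux; apply: (cont _ _ _ hf Ux (pos _ Ux)).
apply: CkS_intro => //; first by move=> x Ux; apply: (cont _ _ _ hf Ux (pos _ Ux)).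
(* The factor 1/f is written as exp(-ln f), so that the induction hypothesis on ln f also covers
   it. *)
move=> v; exists (fun x => expR (- 1 * ln (f x)) * 'D_v f x).
  apply: CkM => //; last exact: CkS_derive.
  apply: Ck_expR => //; apply: CkM => //; first exact: Ck_cst.
  by apply: IH; apply: Ck_pred.
move=> x Ux; rewrite mulN1r expRN lnK ?posrE ?pos //.
apply: is_derive_comp1 (is_derive1_ln (pos x Ux)).
exact: (CkS_is_derive _ hf Ux).
Qed.

Lemma Ck_sum k U (I : Type) (r : seq I) (F : normedModType R) (f : I -> E -> F) : open U ->
  (forall i, Ck k U (f i)) -> Ck k U (fun x => \sum_(i <- r) f i x).
Proof.
move=> oU h; elim: r => [|i r IH].
  by apply: eq_Ck (Ck_cst k U 0) => // x; rewrite big_nil.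
by apply: eq_Ck (CkD oU (h i) IH) => // x _; rewrite big_cons.
Qed.

Lemma Ck_linear k U (F : normedModType R) (l : E -> F) : continuous l ->
  (forall (a : R) x y, l (a *: x + y) = a *: l x + l y) -> open U -> Ck k U l.
Proof.
move=> cl lin oU; case: k => [|k]; first by split=> // x _; apply: cl.
apply: CkS_intro => [//|x _|v]; first exact: cl.
exists (fun=> l v); first exact: Ck_cst.
move=> x _; have hc : (fun h : R => h^-1 *: (l (h *: v + x) - l x)) @ 0^' --> l v.
  apply: cvg_near_cst; near=> h; rewrite lin addrK scalerA mulVf ?scale1r //.
  by near: h; apply: nbhs_dnbhs_neq.
apply: DeriveDef; first by apply/cvg_ex; exists (l v).
exact: (cvg_lim (@norm_hausdorff _ _) hc).
Unshelve. all: by end_near. Qed.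

End CkCalculus.

(** * Mean value theorem along segments and derivative tests at a maximum *)

Section MeanValue.
Variables (R : realType) (E : normedModType R).
Implicit Types (U V : set E) (f g : E -> R) (u v w x y : E).

Lemma is_deriveZdir (f : E -> R) x v (a d : R) : is_derive x v f d -> is_derive x (a *: v) f (a * d).
Proof.
move=> /is_derive_slice0 h; apply/is_derive_slice0.
have -> : (fun r : R => f (x + r *: (a *: v))) = (fun r => f (x + r *: v)) \o (fun r => r * a).
  by apply/funext => r /=; rewrite scalerA.
rewrite mulrC; apply: is_derive1_comp; first by rewrite mul0r.
have -> : (fun r : R => r * a) = (fun r => a *: r) by apply/funext => r; rewrite mulrC.
have := is_deriveZ a (is_derive_id (0 : R) 1).
by rewrite -[a *: (1 : R)]/(a * 1) mulr1.
Qed.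

Lemma Ck_deriveZ U f k x v (a : R) : Ck k.+1 U f -> U x -> 'D_(a *: v) f x = a * 'D_v f x.
Proof.
by move=> hf Ux; have [_ ->] := is_deriveZdir a (CkS_is_derive v hf Ux).
Qed.

Lemma mvt_dir U f k x v : Ck k.+1 U f -> (forall s : R, 0 <= s <= 1 -> U (x + s *: v)) ->
  exists2 s : R, 0 < s < 1 & f (x + v) - f x = 'D_v f (x + s *: v).
Proof.
move=> hf seg; pose F := fun s : R => f (x + s *: v).
have dF (s : R) : 0 <= s <= 1 -> is_derive s 1 F ('D_v f (x + s *: v)).
  by move=> hs; exact: (proj1 (is_derive_slice f x v s _) (CkS_is_derive v hf (seg _ hs))).
have [] := @MVT R F (fun s => 'D_v f (x + s *: v)) 0 1 ltr01.
- by move=> s; rewrite in_itv /= => /andP[a b]; apply: dF; rewrite !ltW.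
- apply: derivable_within_continuous => s; rewrite in_itv /= => hs.
  exact: (@ex_derive _ _ _ _ _ _ _ (dF s hs)).
move=> s; rewrite in_itv /= => hs; rewrite /F scale1r scale0r addr0 subr0 mulr1 => e.
by exists s.
Qed.

Lemma near_seg x v (A : set E) : nbhs x A ->
  exists2 h : R, 0 < h & forall s : R, 0 <= s <= h -> A (x + s *: v).
Proof.
move=> xA; have c : {for (0 : R), continuous (fun s : R => x + s *: v)}.
  by apply: cvgD; [apply: cvg_cst | apply: cvgZr_tmp; apply: cvg_id].
have : nbhs (0 : R) ((fun s : R => x + s *: v) @^-1` A).
  by apply: c; rewrite scale0r addr0.
move=> /nbhs_ballP[e /= e0 he]; exists (e / 2); first by rewrite divr_gt0.
move=> s /andP[s0 s1]; apply: he; rewrite /ball /= sub0r normrN ger0_norm //.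
by apply: le_lt_trans s1 _; rewrite ltr_pdivrMr // ltr_pMr // ltr1n.
Qed.

(** Only forward increments are compared, which yields a sign and not a critical point: this is what
    is available in the time direction at a maximum over earlier times. *)
Lemma dir_max_le0 f x v (d h : R) : is_derive x v f d -> 0 < h ->
  (forall s : R, 0 < s < h -> f (x + s *: v) <= f x) -> d <= 0.
Proof.
move=> [df <-] h0 hm; rewrite leNgt; apply/negP => d0.
have /cvgrPdist_lt/(_ _ d0) : (fun r : R => r^-1 *: (f (r *: v + x) - f x)) @ 0^' --> 'D_v f x.
  by [].
rewrite near_withinE => /nbhs_ballP[e /= e0 he].
pose r := Num.min h e / 2.
have m0 : 0 < Num.min h e by rewrite lt_min h0 e0.
have r0 : 0 < r by rewrite divr_gt0.
have rm : r < Num.min h e by rewrite ltr_pdivrMr // ltr_pMr // ltr1n.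
have /andP[rh re] : (r < h) && (r < e) by rewrite -lt_min.
have /he : ball (0 : R) e r by rewrite /ball /= sub0r normrN gtr0_norm.
move=> /(_ (lt0r_neq0 r0)); apply/negP; rewrite -leNgt.
have q0 : r^-1 *: (f (r *: v + x) - f x) <= 0.
  by rewrite -[X in X <= _]/(r^-1 * _) pmulr_rle0 ?invr_gt0 // subr_le0 addrC hm // r0.
by rewrite ger0_norm ?subr_ge0 ?(le_trans q0 (ltW d0)) // lerDl oppr_ge0.
Qed.

Lemma Ck_max_first k U f x v : Ck k.+1 U f -> U x -> nbhs x [set y | f y <= f x] -> 'D_v f x = 0.
Proof.
move=> hf Ux hm; have d := CkS_is_derive v hf Ux.
have le0 (w : E) (e : R) : is_derive x w f e -> e <= 0.
  move=> de; have [h h0 hs] := near_seg w hm.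
  by apply: dir_max_le0 de h0 _ => s /andP[a b]; apply: hs; rewrite !ltW.
apply/eqP; rewrite eq_le (le0 _ _ d) /= -oppr_le0 -mulN1r.
by apply: (le0 (-1 *: v)); apply: is_deriveZdir.
Qed.

(** If the second derivative were positive near [x], the mean value theorem applied to [f] and then
    to ['D_v f], which vanishes at [x], would give f(x + h v) > f(x) for some small h > 0. *)
Lemma Ck_max_second k U f x v : open U -> Ck k.+2 U f -> U x -> nbhs x [set y | f y <= f x] ->
  'D_v ('D_v f) x <= 0.
Proof.
move=> oU hf Ux hm; rewrite leNgt; apply/negP => d0.
have hDf := CkS_derive v hf; have hDDf := CkS_derive v hDf.
have D0 := Ck_max_first v hf Ux hm.
have np : nbhs x [set y | 0 < 'D_v ('D_v f) y].
  exact: (cvgr_gt _ (Ck_cont hDDf Ux) _ d0).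
have [h h0 hs] := near_seg v (filterI (filterI np hm) (open_nbhs_nbhs (conj oU Ux))).
have seg (r : R) : 0 <= r <= h -> forall s : R, 0 <= s <= 1 -> 0 <= s * r <= h.
  by move=> /andP[r0 rh] s /andP[s0 s1]; rewrite mulr_ge0 //= (le_trans _ rh) // ler_piMl.
have hh : 0 <= h <= h by rewrite lexx ltW.
have [|s s01 e1] := @mvt_dir U f k.+1 x (h *: v) hf.
  by move=> s s01; rewrite scalerA; have [_] := hs _ (seg _ hh _ s01).
have s01' : 0 <= s <= 1 by case/andP: s01 => a b; rewrite !ltW.
have sh := seg _ hh _ s01'.
have sh0 : 0 < s * h by case/andP: s01 => a b; rewrite mulr_gt0.
have Us : U (x + (s * h) *: v) by have [_] := hs _ sh.
have [|r r01 e2] := @mvt_dir U ('D_v f) k x ((s * h) *: v) hDf.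
  by move=> r r01; rewrite scalerA; have [_] := hs _ (seg _ sh _ r01).
have r01' : 0 <= r <= 1 by case/andP: r01 => a b; rewrite !ltW.
have rs := seg _ sh _ r01'.
have Ur : U (x + (r * (s * h)) *: v) by have [_] := hs _ rs.
have [[/= pr _] _] := hs _ rs.
have [[_ /= mx] _] := hs _ hh.
move: e2; rewrite D0 subr0 scalerA.
rewrite (Ck_deriveZ v _ hDf Ur) => e2.
move: e1; rewrite scalerA (Ck_deriveZ v _ hf Us) e2.
move=> e1; have : 0 < f (x + h *: v) - f x by rewrite e1 mulr_gt0 // mulr_gt0.
by rewrite subr_gt0 ltNge mx.
Qed.

(** Both the base point [p h] and the increment [w h] move. Choosing the intermediate points as a
    function [xi] tending to [x] lets the continuity of directional derivatives do the work of
    Frechet differentiability. *)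
Lemma mvt_near k U f x (p w : R -> E) : open U -> Ck k.+1 U f -> U x ->
  p h @[h --> 0^'] --> x -> w h @[h --> 0^'] --> (0 : E) ->
  exists2 xi : R -> E, xi h @[h --> 0^'] --> x &
    \forall h \near 0^', U (xi h) /\ f (p h + w h) - f (p h) = 'D_(w h) f (xi h).
Proof.
move=> oU hf Ux px w0.
have /nbhs_ballP[e /= e0 eU] : nbhs x U by apply: open_nbhs_nbhs.
have e20 : 0 < e / 2 by rewrite divr_gt0.
have ex h : exists y, (exists2 s : R, 0 <= s <= 1 & y = p h + s *: w h) /\
   (`|x - p h| < e / 2 /\ `|w h| < e / 2 -> f (p h + w h) - f (p h) = 'D_(w h) f y).
  have [[a b]|n] := pselect (`|x - p h| < e / 2 /\ `|w h| < e / 2); last first.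
    (* Increments that are not yet small receive a default point; the mean value equation is claimed
       only for small ones. *)
    by exists (p h); split=> //; exists 0; rewrite ?lexx ?ler01 // scale0r addr0.
  have [|s s01 es] := @mvt_dir U f k (p h) (w h) hf.
    move=> s /andP[s0 s1]; apply: eU; rewrite -ball_normE /= opprD addrA.
    rewrite (le_lt_trans (ler_normB _ _)) // [e]splitr ltrD // normrZ ger0_norm //.
    by apply: le_lt_trans b; rewrite ler_piMl.
  by exists (p h + s *: w h); split=> //; exists s => //; case/andP: s01 => c d; rewrite !ltW.
have [xi hxi] := choice ex.
have cxi : xi h @[h --> 0^'] --> x.
  have pw : `|x - p h| + `|w h| @[h --> 0^'] --> (0 : R).
    rewrite -[X in _ --> X]addr0; apply: cvgD.
      have : `|x - p h| @[h --> 0^'] --> `|x - x|.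
        by apply: cvg_norm; exact: (cvgB (cvg_cst _) px).
      by rewrite subrr normr0.
    have : `|w h| @[h --> 0^'] --> `|0 : E| by apply: cvg_norm.
    by rewrite normr0.
  apply/cvgrPdist_lt => r r0; move/cvgrPdist_lt: pw => /(_ r r0); apply: filterS => h.
  rewrite sub0r normrN ger0_norm ?addr_ge0 // => lt.
  have [[s /andP[s0 s1] ->] _] := hxi h; apply: le_lt_trans lt.
  rewrite opprD addrA (le_trans (ler_normB _ _)) // lerD2l normrZ ger0_norm //.
  by rewrite ler_piMl.
exists xi => //; near=> h; split.
  by near: h; apply: cxi; apply: open_nbhs_nbhs.
have [_] := hxi h; apply; split; near: h.
  by move/cvgrPdist_lt: px; apply.
by move/cvgrPdist_lt: w0 => /(_ _ e20); apply: filterS => h; rewrite sub0r normrN.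
Unshelve. all: by end_near. Qed.

Lemma cvg_scale0 v : (h *: v : E) @[h --> (0 : R)^'] --> (0 : E).
Proof.
rewrite -[X in _ --> X](scale0r v); apply: cvgZr_tmp.
by apply: cvg_trans (cvg_id (F := nbhs (0 : R))); apply: cvg_app; apply: cvg_within.
Qed.

(** The increment along h(u + v) is split at x + h u; the quotient of the second piece is ['D_v f]
    at an intermediate point tending to [x]. *)
Lemma is_derive_dirD k U f x u v : open U -> Ck k.+1 U f -> U x ->
  is_derive x (u + v) f ('D_u f x + 'D_v f x).
Proof.
move=> oU hf Ux.
have cp : x + h *: u @[h --> (0:R)^'] --> x.
  by rewrite -[X in _ --> X]addr0; apply: cvgD; [apply: cvg_cst | apply: cvg_scale0].
have [xi cxi hxi] := mvt_near oU hf Ux cp (cvg_scale0 v).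
have c1 : 'D_v f (xi h) @[h --> (0:R)^'] --> 'D_v f x.
  exact: (continuous_cvg _ (Ck_cont (CkS_derive v hf) Ux) cxi).
have [du _] := CkS_is_derive u hf Ux.
have c2 : (fun h : R => h^-1 *: (f (h *: u + x) - f x)) @ 0^' --> 'D_u f x by [].
have hc : (fun h : R => h^-1 *: (f (h *: (u + v) + x) - f x)) @ 0^' --> 'D_u f x + 'D_v f x.
  apply: cvg_trans (cvgD c2 c1); apply: near_eq_cvg; near=> h.
  have [Ui e] : U (xi h) /\ f (x + h *: u + h *: v) - f (x + h *: u) = 'D_(h *: v) f (xi h).
    by near: h.
  have h0 : h != 0 by near: h; apply: nbhs_dnbhs_neq.
  have e3 : 'D_v f (xi h) = h^-1 *: (f (x + h *: u + h *: v) - f (x + h *: u)).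
    rewrite e (Ck_deriveZ v _ hf Ui).
    by rewrite -[RHS]/(h^-1 * _) mulKf.
  transitivity (h^-1 *: (f (h *: u + x) - f x) + 'D_v f (xi h)) => //.
  rewrite e3 -scalerDr; congr (_ *: _).
  have -> : h *: (u + v) + x = x + h *: u + h *: v by rewrite scalerDr addrC addrA.
  by rewrite [h *: u + x]addrC; ring.
apply: DeriveDef; first by apply/cvg_ex; eexists; exact: hc.
exact: (cvg_lim (@norm_hausdorff _ _) hc).
Unshelve. all: by end_near. Qed.

End MeanValue.

(** * Symmetry of second derivatives *)

Section Schwarz.
Variables (R : realType) (E : normedModType R).
Implicit Types (U : set E) (f : E -> R) (u v x : E).

Lemma dist_le_half (a b c d e : R) : c = d -> `|a - c| < e / 2 -> `|b - d| < e / 2 -> `|a - b| <= e.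
Proof.
move=> -> ac bd; have -> : a - b = (a - d) - (b - d) by ring.
by rewrite (le_trans (ler_normB _ _)) // [e]splitr lerD // ltW.
Qed.

Lemma subrrACA (a b c d : R) : a - b - (c - d) = a - c - (b - d).
Proof. by ring. Qed.

(** The mean value theorem is applied first in the direction [v], to the difference [G] of two
    parallel slices, then in the direction [u]. *)
Lemma mvt2 U f k u v x (h : R) : Ck k.+2 U f -> 0 < h ->
  (forall s r : R, 0 <= s <= h -> 0 <= r <= h -> U (x + s *: u + r *: v)) ->
  exists s r : R, [/\ 0 <= s <= h, 0 <= r <= h &
    f (x + h *: u + h *: v) - f (x + h *: u) - (f (x + h *: v) - f x) =
      h * h * 'D_u ('D_v f) (x + s *: u + r *: v)].
Proof.
move=> hf h0 seg; have hh : 0 <= h <= h by rewrite lexx ltW.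
have zh : (0 : R) <= 0 <= h by rewrite lexx ltW.
pose G := fun r : R => f (x + h *: u + r *: v) - f (x + r *: v).
have dG (r : R) : 0 <= r <= h ->
    is_derive r 1 G ('D_v f (x + h *: u + r *: v) - 'D_v f (x + r *: v)).
  move=> hr; apply: is_deriveB.
    exact: (proj1 (is_derive_slice f _ v r _) (CkS_is_derive v hf (seg _ _ hh hr))).
  apply: (proj1 (is_derive_slice f _ v r _) (CkS_is_derive v hf _)).
  by have := seg _ _ zh hr; rewrite scale0r addr0.
have [] := @MVT R G (fun r => 'D_v f (x + h *: u + r *: v) - 'D_v f (x + r *: v)) 0 h h0.
- by move=> r; rewrite in_itv /= => /andP[a b]; apply: dG; rewrite !ltW.
- apply: derivable_within_continuous => r; rewrite in_itv /= => hr.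
  exact: (@ex_derive _ _ _ _ _ _ _ (dG r hr)).
move=> r; rewrite in_itv /= => /andP[r0 rh]; have hr : 0 <= r <= h by rewrite !ltW.
rewrite /G !scale0r !addr0 subr0 => e1; have hDf := CkS_derive v hf.
have scale_itv (t s : R) : 0 <= s <= 1 -> 0 <= s * h <= h.
  by move=> /andP[s0 s1]; rewrite mulr_ge0 ?(ltW h0) //= ler_piMl // ltW.
have [|s s01 e2] := @mvt_dir R E U ('D_v f) k (x + r *: v) (h *: u) hDf.
  by move=> s s01; rewrite scalerA addrAC; apply: seg => //; apply: scale_itv.
have s01' : 0 <= s <= 1 by case/andP: s01 => a b; rewrite !ltW.
exists (s * h), r; split=> //; first exact: scale_itv.
rewrite subrrACA e1; move: e2; rewrite -addrA [r *: v + _]addrC addrA => ->.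
have Us : U (x + r *: v + s *: (h *: u)).
  by rewrite scalerA addrAC; apply: seg => //; apply: scale_itv.
by rewrite (Ck_deriveZ u _ hDf Us) scalerA [x + r *: v + _]addrAC; ring.
Qed.

Lemma near_seg2 x u v (A : set E) : nbhs x A -> exists2 h : R, 0 < h &
  forall s r : R, 0 <= s <= h -> 0 <= r <= h -> A (x + s *: u + r *: v).
Proof.
move=> /nbhs_ballP[e /= e0 he]; have n0 : 0 < `|u| + `|v| + 1 by rewrite ltr_wpDl // addr_ge0.
exists (e / (`|u| + `|v| + 1)); first by rewrite divr_gt0.
move=> s r /andP[s0 s1] /andP[r0 r1]; apply: he; rewrite -ball_normE /=.
rewrite -addrA opprD addrA subrr sub0r normrN (le_lt_trans (ler_normD _ _)) //.
rewrite !normrZ !ger0_norm //.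
apply: (@le_lt_trans _ _ (e / (`|u| + `|v| + 1) * (`|u| + `|v|))).
  by rewrite mulrDr lerD // ler_wpM2r.
by rewrite mulrAC ltr_pdivrMr // ltr_pM2l // ltrDl.
Qed.

(** The second difference is symmetric in [u] and [v], so by [mvt2] the two mixed derivatives agree
    at a pair of points arbitrarily close to [x]; continuity concludes. *)
Lemma Ck_schwarz U f k u v x : open U -> Ck k.+2 U f -> U x ->
  'D_u ('D_v f) x = 'D_v ('D_u f) x.
Proof.
move=> oU hf Ux; set A := 'D_u ('D_v f); set B := 'D_v ('D_u f).
have cA : {for x, continuous A} by apply: Ck_cont (CkS_derive u (CkS_derive v hf)) Ux.
have cB : {for x, continuous B} by apply: Ck_cont (CkS_derive v (CkS_derive u hf)) Ux.
apply/eqP; rewrite -subr_eq0 -normr_le0; apply/ler_addgt0Pr => e e0; rewrite add0r.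
have e2 : 0 < e / 2 by rewrite divr_gt0.
have N : nbhs x (U `&` [set y | `|A x - A y| < e / 2] `&` [set y | `|B x - B y| < e / 2]).
  apply: filterI; first apply: filterI; first exact: open_nbhs_nbhs.
    by move/cvgrPdist_lt: cA; apply.
  by move/cvgrPdist_lt: cB; apply.
have [h h0 hN] := near_seg2 u v N.
have [s1 [r1 [hs1 hr1 e1]]] : exists s r : R, [/\ 0 <= s <= h, 0 <= r <= h &
    f (x + h *: u + h *: v) - f (x + h *: u) - (f (x + h *: v) - f x) =
      h * h * A (x + s *: u + r *: v)].
  by apply: mvt2 hf h0 _ => s r hs hr; have [[]] := hN s r hs hr.
have [s2 [r2 [hs2 hr2 e3]]] : exists s r : R, [/\ 0 <= s <= h, 0 <= r <= h &
    f (x + h *: v + h *: u) - f (x + h *: v) - (f (x + h *: u) - f x) =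
      h * h * B (x + s *: v + r *: u)].
  by apply: mvt2 hf h0 _ => s r hs hr; rewrite addrAC; have [[]] := hN r s hr hs.
have AB : A (x + s1 *: u + r1 *: v) = B (x + s2 *: v + r2 *: u).
  have hh : h * h != 0 by rewrite mulf_neq0 // gt_eqF.
  by apply: (mulfI hh); rewrite -e1 -e3 [x + h *: v + _]addrAC subrrACA.
have [[_ a]] := hN _ _ hs1 hr1; have [[_ _]] := hN _ _ hr2 hs2.
rewrite [x + r2 *: u + _]addrAC => b _; exact: (dist_le_half AB a b).
Qed.

Lemma Ck_derive_sum U f k (I : Type) (r : seq I) (w : I -> E) x : open U -> Ck k.+1 U f -> U x ->
  'D_(\sum_(i <- r) w i) f x = \sum_(i <- r) 'D_(w i) f x.
Proof.
move=> oU hf Ux; elim: r => [|i r IH].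
  by rewrite !big_nil -[X in 'D_X _ _](scale0r (0 : E)) (Ck_deriveZ _ _ hf Ux) mul0r.
by rewrite !big_cons -IH; have [_ ->] := is_derive_dirD (w i) (\sum_(j <- r) w j) oU hf Ux.
Qed.

End Schwarz.

(** * Chain rule for maps into row vectors *)

Section ChainRule.
Variables (R : realType) (E : normedModType R) (m : nat).
Implicit Types (U : set E) (W : set 'rV[R]_m).

Definition bvec (i : 'I_m) : 'rV[R]_m := delta_mx 0 i.

Lemma Ck_derive_row W (h : 'rV[R]_m -> R) k (w x : 'rV[R]_m) : open W -> Ck k.+1 W h -> W x ->
  'D_w h x = \sum_i w 0 i * 'D_(bvec i) h x.
Proof.
move=> oW hh Wx; rewrite [in LHS](row_sum_delta w) (Ck_derive_sum _ _ oW hh Wx).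
by apply: eq_bigr => i _; rewrite (Ck_deriveZ _ _ hh Wx).
Qed.

Lemma is_derive_coord (phi : E -> 'rV[R]_m) x v (d : 'rV[R]_m) i :
  is_derive x v phi d -> is_derive x v (fun y => phi y 0 i) (d 0 i).
Proof.
move=> [df <-].
have hc : (fun h : R => h^-1 *: (phi (h *: v + x) 0 i - phi x 0 i)) @ 0^' --> ('D_v phi x) 0 i.
  have -> : (fun h : R => h^-1 *: (phi (h *: v + x) 0 i - phi x 0 i)) =
    (fun A : 'rV[R]_m => A 0 i) \o (fun h : R => h^-1 *: (phi (h *: v + x) - phi x)).
    by apply/funext => h /=; rewrite !mxE.
  exact: (cvg_comp _ _ df (@coord_continuous _ _ _ 0 i _)).
apply: DeriveDef; first by apply/cvg_ex; eexists; exact: hc.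
exact: (cvg_lim (@norm_hausdorff _ _) hc).
Qed.

Lemma Ck_coord k U (phi : E -> 'rV[R]_m) i : open U -> Ck k U phi -> Ck k U (fun x => phi x 0 i).
Proof.
move=> oU; have cc x : {for x, continuous phi} -> {for x, continuous (fun x => phi x 0 i)}.
  by move=> c; exact: (cvg_comp _ _ c (@coord_continuous _ _ _ 0 i _)).
elim: k phi cc => [|k IH] phi cc hphi.
  by split=> // x Ux; apply: cc; apply: Ck_cont hphi Ux.
apply: CkS_intro => //; first by move=> x Ux; apply: cc; apply: Ck_cont hphi Ux.
move=> v; exists (fun x => ('D_v phi x) 0 i).
  apply: IH; last exact: CkS_derive.
  by move=> x c; exact: (cvg_comp _ _ c (@coord_continuous _ _ _ 0 i _)).
by move=> x Ux; apply: is_derive_coord; apply: (CkS_is_derive _ hphi Ux).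
Qed.

(** The increment of [h] is its derivative in the direction of the increment [w s] of [phi], at an
    intermediate point. It is linear in [w s], and the quotient of [w s] by [s] tends to the
    derivative of [phi]. *)
Lemma is_derive_chain W k (h : 'rV[R]_m -> R) (phi : E -> 'rV[R]_m) x v (d : 'rV[R]_m) :
  open W -> Ck k.+1 W h -> W (phi x) -> is_derive x v phi d ->
  is_derive x v (fun y => h (phi y)) (\sum_i 'D_(bvec i) h (phi x) * d 0 i).
Proof.
move=> oW hh Wx [df <-]; pose w (s : R) := phi (s *: v + x) - phi x.
have qc : (s^-1 *: w s) @[s --> 0^'] --> 'D_v phi x by [].
have id0 : (s : R) @[s --> (0 : R)^'] --> (0 : R).
  by apply: cvg_trans (cvg_id (F := nbhs (0 : R))); apply: cvg_app; apply: cvg_within.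
have w0 : w s @[s --> 0^'] --> (0 : 'rV[R]_m).
  rewrite -[X in _ --> X](scale0r ('D_v phi x)).
  apply: cvg_trans (cvgZ id0 qc); apply: near_eq_cvg; near=> s.
  have s0 : s != 0 by near: s; apply: nbhs_dnbhs_neq.
  by transitivity (s *: (s^-1 *: w s)); rewrite // scalerA mulfV // scale1r.
have [xi cxi hxi] := mvt_near oW hh Wx (cvg_cst (phi x)) w0.
have hc : (fun s : R => s^-1 *: (h (phi (s *: v + x)) - h (phi x))) @ 0^' -->
    \sum_i 'D_(bvec i) h (phi x) * ('D_v phi x) 0 i.
  have c1 : (\sum_i 'D_(bvec i) h (xi s) * (s^-1 *: w s) 0 i) @[s --> 0^'] -->
      \sum_i 'D_(bvec i) h (phi x) * ('D_v phi x) 0 i.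
    apply: cvg_big => [|i _]; first exact: add_continuous.
    apply: cvgM.
      exact: (continuous_cvg _ (Ck_cont (CkS_derive (bvec i) hh) Wx) cxi).
    exact: (cvg_comp _ _ qc (@coord_continuous _ _ _ 0 i _)).
  apply: cvg_trans c1; apply: near_eq_cvg; near=> s.
  have [Wi e] : W (xi s) /\ h (phi x + w s) - h (phi x) = 'D_(w s) h (xi s) by near: s.
  have -> : phi (s *: v + x) = phi x + w s by rewrite /w addrCA subrr addr0.
  rewrite e (Ck_derive_row _ oW hh Wi) -[RHS]/(_ * _) mulr_sumr; apply: eq_bigr => i _.
  have -> : (s^-1 *: w s) 0 i = s^-1 * w s 0 i by rewrite mxE.
  by rewrite mulrCA; congr (_ * _); apply: mulrC.
apply: DeriveDef; first by apply/cvg_ex; eexists; exact: hc.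
exact: (cvg_lim (@norm_hausdorff _ _) hc).
Unshelve. all: by end_near. Qed.

Lemma Ck_comp k U W (h : 'rV[R]_m -> R) (phi : E -> 'rV[R]_m) : open U -> open W ->
  (forall x, U x -> W (phi x)) -> Ck k U phi -> Ck k W h -> Ck k U (fun x => h (phi x)).
Proof.
move=> oU oW UW; elim: k h => [|k IH] h hphi hh.
  split=> // x Ux; apply: (continuous_cvg _ _ (Ck_cont hphi Ux)).
  exact: (Ck_cont hh (UW _ Ux)).
apply: CkS_intro => //.
  move=> x Ux; apply: (continuous_cvg _ _ (Ck_cont hphi Ux)).
  exact: (Ck_cont hh (UW _ Ux)).
move=> v; exists (fun x => \sum_i 'D_(bvec i) h (phi x) * ('D_v phi x) 0 i).
  apply: Ck_sum => // i; apply: CkM => //.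
    exact: (IH _ (Ck_pred hphi) (CkS_derive _ hh)).
  by apply: Ck_coord => //; apply: CkS_derive.
move=> x Ux; apply: (is_derive_chain oW hh (UW _ Ux)).
exact: (CkS_is_derive _ hphi Ux).
Qed.

End ChainRule.

(** * Slices of functions on a product with the time line *)

Section Slices.
Variables (R : realType) (E : normedModType R).
Implicit Types (W : set (E * R)) (w : E * R -> R).

Lemma is_derive_sliceE w x (t : R) (v : E) d :
  is_derive (x, t) (v, 0) w d -> is_derive x v (fun y => w (y, t)) d.
Proof.
move=> /is_derive_slice0 h; apply/is_derive_slice0; move: h.
by under eq_fun do rewrite -[_ *: (v, 0)]/(_, _) -[(x, t) + _]/(_, _) scaler0 addr0.
Qed.

Lemma is_derive_sliceR w x (t : R) d :
  is_derive (x, t) (0, 1) w d -> is_derive t 1 (fun s => w (x, s)) d.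
Proof.
move=> /is_derive_slice0 h; apply/is_derive_slice0; move: h.
by under eq_fun do rewrite -[_ *: (0, 1)]/(_, _) -[(x, t) + _]/(_, _) scaler0 addr0.
Qed.

Lemma Ck_slice k W w (U : set E) (t : R) : open U -> (forall x, U x -> W (x, t)) -> Ck k W w ->
  Ck k U (fun x => w (x, t)).
Proof.
move=> oU UW; have cs w' j x : Ck j W w' -> U x -> {for x, continuous (fun x => w' (x, t))}.
  move=> hw Ux; apply: (@continuous_comp _ _ _ (fun y => (y, t)) w').
    exact: (cvg_pair cvg_id (cvg_cst _)).
  exact: (Ck_cont hw (UW _ Ux)).
elim: k w => [|k IH] w hw; first by split=> // x; apply: cs hw.
apply: CkS_intro => //; first by move=> x; apply: cs hw.
move=> v; exists (fun x => 'D_(v, 0) w (x, t)).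
  exact: (IH _ (CkS_derive _ hw)).
move=> x Ux; apply: is_derive_sliceE; exact: (CkS_is_derive _ hw (UW _ Ux)).
Qed.

Lemma Ck_fst k (U : set E) W (f : E -> R) : open W -> (forall z, W z -> U z.1) -> Ck k U f ->
  Ck k W (fun z => f z.1).
Proof.
move=> oW WU; have cs f' j z : Ck j U f' -> W z -> {for z, continuous (fun z => f' z.1)}.
  move=> hf Wz; apply: (@continuous_comp _ _ _ fst f'); first exact: cvg_fst.
  exact: (Ck_cont hf (WU _ Wz)).
elim: k f => [|k IH] f hf; first by split=> // x; apply: cs hf.
apply: CkS_intro => //; first by move=> x; apply: cs hf.
move=> [v s]; exists (fun z => 'D_v f z.1); first exact: (IH _ (CkS_derive _ hf)).
move=> z Wz; apply/is_derive_slice0.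
exact: (proj1 (is_derive_slice0 _ _ _ _) (CkS_is_derive v hf (WU _ Wz))).
Qed.

End Slices.

(** * Integrals over the unit interval *)

Section UnitIntegral.
Variable R : realType.
Implicit Types (phi psi : R -> R) (t : R).

Definition int01 phi : R := \int[lebesgue_measure]_(t in `[0, 1]) phi t.

Definition cont01 phi := forall t, 0 <= t <= 1 -> {for t, continuous phi}.

Lemma cont01_integrable phi : cont01 phi ->
  lebesgue_measure.-integrable `[0 : R, 1] (EFin \o phi).
Proof.
move=> h; apply: continuous_compact_integrable; first exact: segment_compact.
by apply: continuous_in_subspaceT => t; rewrite inE /= in_itv /=; apply: h.
Qed.

Lemma cont01B phi psi : cont01 phi -> cont01 psi -> cont01 (fun t => phi t - psi t).
Proof. by move=> h1 h2 t ht; apply: cvgB; [apply: h1 | apply: h2]. Qed.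

Lemma cont01M phi psi : cont01 phi -> cont01 psi -> cont01 (fun t => phi t * psi t).
Proof. by move=> h1 h2 t ht; apply: cvgM; [apply: h1 | apply: h2]. Qed.

Lemma lebesgue_measure01 : lebesgue_measure `[0 : R, 1] = 1%E.
Proof. by rewrite lebesgue_measure_itv /= lte_fin ltr01 -EFinB subr0. Qed.

Lemma int01_dist phi psi (e : R) : cont01 phi -> cont01 psi ->
  (forall t, 0 <= t <= 1 -> `|phi t - psi t| <= e) -> `|int01 phi - int01 psi| <= e.
Proof.
move=> h1 h2 he; have m01 : measurable (`[0 : R, 1] : set (measurableTypeR R)) by [].
rewrite /int01 -RintegralB //; [|exact: cont01_integrable|exact: cont01_integrable].
have c12 := cont01B h1 h2.
apply: le_trans (le_normr_Rintegral _ (cont01_integrable c12)) _ => //.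
have -> : e = \int[lebesgue_measure]_(t in `[0 : R, 1]) e.
  rewrite Rintegral_cst // [X in fine X](_ : _ = 1%E) /= ?mulr1 //.
  exact: lebesgue_measure01.
apply: le_Rintegral => //.
- by apply: cont01_integrable => t ht; apply: cvg_norm; apply: c12.
- by apply: (@cont01_integrable (fun=> e)) => t ht; apply: cvg_cst.
Qed.

Lemma int01Z (r : R) phi : cont01 phi -> int01 (fun t => r * phi t) = r * int01 phi.
Proof. by move=> h; apply: RintegralZl => //; apply: cont01_integrable. Qed.

Lemma cont01_sum (I : Type) (r : seq I) (phi : I -> R -> R) : (forall i, cont01 (phi i)) ->
  cont01 (fun t => \sum_(i <- r) phi i t).
Proof.
move=> h t ht; rewrite /prop_for /continuous_at; apply: cvg_big => [|i _]; first exact: add_continuous.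
exact: h.
Qed.

Lemma int01_sum (I : Type) (r : seq I) (phi : I -> R -> R) : (forall i, cont01 (phi i)) ->
  int01 (fun t => \sum_(i <- r) phi i t) = \sum_(i <- r) int01 (phi i).
Proof.
move=> h; elim: r => [|i r IH].
  rewrite big_nil (_ : (fun t => _) = fun=> 0); last by apply/funext => t; rewrite big_nil.
  by rewrite /int01 Rintegral_cst // mul0r.
rewrite big_cons -IH (_ : (fun t => _) = fun t => phi i t + \sum_(j <- r) phi j t); last first.
  by apply/funext => t; rewrite big_cons.
rewrite /int01 RintegralD //; first exact: cont01_integrable.
by apply: cont01_integrable; apply: cont01_sum.
Qed.

Lemma int01_FTC (F f : R -> R) : cont01 f -> (forall t, 0 <= t <= 1 -> is_derive t 1 F (f t)) ->
  int01 f = F 1 - F 0.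
Proof.
move=> cf dF; have dr t : 0 <= t <= 1 -> derivable F t 1 by move=> /dF [].
rewrite /int01 /Rintegral (@continuous_FTC2 R f F 0 1) //.
- by apply: continuous_in_subspaceT => t; rewrite inE /= in_itv /=; apply: cf.
- split.
  + by move=> t; rewrite in_itv /= => /andP[a b]; apply: dr; rewrite !ltW.
  + apply: cvg_at_right_filter; apply: differentiable_continuous.
    by apply/derivable1_diffP; apply: dr; rewrite lexx ler01.
  + apply: cvg_at_left_filter; apply: differentiable_continuous.
    by apply/derivable1_diffP; apply: dr; rewrite lexx ler01.
- move=> t; rewrite in_itv /= => /andP[a b]; rewrite derive1E.
  by apply: derive_val; apply: dF; rewrite !ltW.
Qed.

(** Compactness of [0, 1] makes the continuity in [y] uniform in [t]; together with [int01_dist]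
    this moves limits under the integral sign. *)
Lemma near_cont01 (Y : topologicalType) (y0 : Y) (F : R * Y -> R) (e : R) : 0 < e ->
  (forall t, 0 <= t <= 1 -> {for (t, y0), continuous F}) ->
  \forall y \near y0, forall t, 0 <= t <= 1 -> `|F (t, y) - F (t, y0)| <= e.
Proof.
move=> e0 cF; have e2 : 0 < e / 2 by rewrite divr_gt0.
have := proj1 (compact_near_coveringP _) (@segment_compact R 0 1).
move=> /(_ Y (nbhs y0) (fun y t => `|F (t, y) - F (t, y0)| <= e)) H.
have : \forall y \near y0, `[0 : R, 1] `<=` (fun t => `|F (t, y) - F (t, y0)| <= e).
  apply: H => t; rewrite /= in_itv /= => ht; have /cvgrPdist_lt/(_ _ e2) c := cF t ht.
  have c2 : \forall s \near t, `|F (t, y0) - F (s, y0)| < e / 2.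
    have : (s, y0) @[s --> t] --> (t, y0) by exact: (cvg_pair cvg_id (cvg_cst _)).
    by move=> /(_ _ c).
  have c1 : \forall s \near t & y \near y0, `|F (t, y0) - F (s, y)| < e / 2.
    by move: c; apply: filterS => -[].
  have c2' : filter_prod (nbhs t) (nbhs y0) [set z | `|F (t, y0) - F (z.1, y0)| < e / 2].
    exists ([set s | `|F (t, y0) - F (s, y0)| < e / 2], setT); last by move=> z [].
    by split=> //; apply: filterT.
  apply: filterS2 c1 c2' => -[s y] /= l1 l2.
  have -> : F (s, y) - F (s, y0) = (F (t, y0) - F (s, y0)) - (F (t, y0) - F (s, y)) by ring.
  by rewrite (le_trans (ler_normB _ _)) // [e]splitr lerD // ltW.
by apply: filterS => y h t ht; apply: h; rewrite /= in_itv.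
Qed.

End UnitIntegral.

(** * Parameter integrals and Hadamard's lemma *)

Section Hadamard.
Variables (R : realType) (E : normedModType R) (a : E) (e : R).
Let B := ball a e.
Implicit Types (h : E -> R) (x v : E).

Lemma ball_path x (t : R) : B x -> 0 <= t <= 1 -> B (a + t *: (x - a)).
Proof.
rewrite /B -ball_normE /= => hx /andP[t0 t1].
rewrite opprD addrA subrr sub0r normrN normrZ ger0_norm // distrC.
by apply: le_lt_trans hx; rewrite distrC ler_piMl.
Qed.

Lemma nbhs_ball_center x : B x -> nbhs x B.
Proof. by move=> Bx; apply: open_nbhs_nbhs; split=> //; apply: ball_open. Qed.

(** Each derivative in [x] brings out one more factor [t]; carrying the power of [t] makes the
    family closed under differentiation, and smoothness follows by induction. *)
Definition radial (j : nat) h x : R := int01 (fun t => t ^+ j * h (a + t *: (x - a))).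

Lemma continuous_path2 (x : E) (t : R) :
  {for (t, x), continuous (fun z : R * E => a + z.1 *: (z.2 - a))}.
Proof.
apply: cvgD; first exact: cvg_cst.
by apply: cvgZ; [exact: cvg_fst | apply: cvgB; [exact: cvg_snd | exact: cvg_cst]].
Qed.

Lemma continuous_radial2 k j h x (t : R) : Ck k B h -> B x -> 0 <= t <= 1 ->
  {for (t, x), continuous (fun z : R * E => z.1 ^+ j * h (a + z.1 *: (z.2 - a)))}.
Proof.
move=> hh Bx ht; apply: cvgM.
  apply: (@continuous_cvg _ _ _ _ _ fst (fun s : R => s ^+ j)); last exact: cvg_fst.
  exact: exprn_continuous.
apply: (continuous_cvg _ _ (@continuous_path2 x t)).
exact: (Ck_cont hh (ball_path Bx ht)).
Qed.

Lemma cont01_radial k j h x : Ck k B h -> B x -> cont01 (fun t => t ^+ j * h (a + t *: (x - a))).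
Proof.
move=> hh Bx t ht; have := continuous_radial2 (j := j) hh Bx ht; rewrite /prop_for /continuous_at.
have c : (s, x) @[s --> t] --> (t, x) by exact: (cvg_pair cvg_id (cvg_cst _)).
by move=> /(cvg_comp _ _ c).
Qed.

Lemma radial_continuous k j h x : Ck k B h -> B x -> {for x, continuous (radial j h)}.
Proof.
move=> hh Bx; apply/cvgrPdist_le => r r0.
have N := near_cont01 r0 (fun t => continuous_radial2 (j := j) hh Bx (t := t)).
near=> y; rewrite distrC; apply: int01_dist.
- by apply: cont01_radial hh _; near: y; apply: nbhs_ball_center.
- exact: cont01_radial hh Bx.
- by near: y.
Unshelve. all: by end_near. Qed.

(** Differentiation under the integral: by the mean value theorem the quotient is [t ^+ j.+1] times
    ['D_v h] at a point displaced by (q t s) v with 0 < q < 1, and [near_cont01] makes the error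
    uniform in [t]. *)
Lemma near_radial_quotient k j h x v (r : R) : Ck k.+1 B h -> B x -> 0 < r ->
  \forall s \near (0 : R)^', B (s *: v + x) /\ forall t, 0 <= t <= 1 ->
   `|s^-1 * (t ^+ j * h (a + t *: (s *: v + x - a)) - t ^+ j * h (a + t *: (x - a)))
     - t ^+ j.+1 * 'D_v h (a + t *: (x - a))| <= r.
Proof.
move=> hh Bx r0; have hD := CkS_derive v hh.
pose F (z : R * R) := 'D_v h (a + z.1 *: (x - a) + z.2 *: v).
have cF t : 0 <= t <= 1 -> {for (t, 0), continuous F}.
  move=> ht; have c : {for (t, 0 : R), continuous (fun z : R * R => a + z.1 *: (x - a) + z.2 *: v)}.
    apply: cvgD; last by apply: cvgZr_tmp; exact: cvg_snd.
    by apply: cvgD; [exact: cvg_cst | apply: cvgZr_tmp; exact: cvg_fst].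
  apply: (@continuous_comp _ _ _ (fun z : R * R => a + z.1 *: (x - a) + z.2 *: v) ('D_v h)).
    exact: c.
  by apply: (Ck_cont hD); rewrite /= scale0r addr0; apply: ball_path.
have /nbhs_ballP[d /= d0 hd] := near_cont01 r0 cF.
have /nbhs_ballP[c /= c0 hc] := nbhs_ball_center Bx.
have vp : 0 < `|v| + 1 by rewrite ltr_wpDl.
rewrite near_withinE; apply/nbhs_ballP; exists (Num.min d (c / (`|v| + 1))).
  by rewrite /= lt_min d0 divr_gt0.
move=> s; rewrite /ball /= sub0r normrN lt_min => /andP[sd sc] s0.
have sv (q : R) : 0 <= q <= 1 -> `|(q * s) *: v| < c.
  move=> /andP[q0 q1]; rewrite normrZ normrM ger0_norm //.
  apply: (@le_lt_trans _ _ (`|s| * `|v|)); first by rewrite ler_wpM2r // ler_piMl.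
  apply: (@le_lt_trans _ _ (`|s| * (`|v| + 1))); first by rewrite ler_wpM2l // lerDl.
  by rewrite -ltr_pdivlMr.
have Bsx (q : R) : 0 <= q <= 1 -> B (x + (q * s) *: v).
  move=> hq; apply: hc; rewrite -ball_normE /= opprD addrA subrr sub0r normrN; exact: sv.
have b1 : B (s *: v + x) by rewrite addrC -[s]mul1r; apply: Bsx; rewrite ler01 lexx.
split=> // t ht; have /andP[t0 t1] := ht.
have epath (q : R) : a + t *: (x - a) + (q * t * s) *: v = a + t *: (x + (q * s) *: v - a).
  have -> : q * t * s = t * (q * s) by ring.
  by rewrite -scalerA -addrA -scalerDr [x - a + _]addrAC.
have [|q /andP[q0 q1] eq] := @mvt_dir R E B h k (a + t *: (x - a)) ((t * s) *: v) hh.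
  move=> q hq; rewrite scalerA mulrA epath; apply: ball_path => //; exact: Bsx.
have hq : 0 <= q <= 1 by rewrite !ltW.
have Bq : B (a + t *: (x - a) + (q * t * s) *: v).
  by rewrite epath; apply: ball_path => //; apply: Bsx.
move: eq; rewrite scalerA mulrA (Ck_deriveZ v _ hh Bq) => eq.
have -> : a + t *: (s *: v + x - a) = a + t *: (x - a) + (t * s) *: v.
  by have := epath 1; rewrite !mul1r => ->; rewrite [s *: v + x]addrC.
have -> : s^-1 * (t ^+ j * h (a + t *: (x - a) + (t * s) *: v) - t ^+ j * h (a + t *: (x - a)))
   - t ^+ j.+1 * 'D_v h (a + t *: (x - a)) =
   t ^+ j.+1 * ('D_v h (a + t *: (x - a) + (q * t * s) *: v) - 'D_v h (a + t *: (x - a))).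
  by rewrite -mulrBr eq exprSr; field.
have qts : ball (0 : R) d (q * t * s).
  rewrite /ball /= sub0r normrN !normrM (ger0_norm (ltW q0)) (ger0_norm t0).
  apply: le_lt_trans sd; rewrite ler_piMl //.
  by apply: le_trans t1; rewrite ler_piMl // ltW.
have := hd _ qts t ht; rewrite /F /= scale0r addr0 => le.
rewrite normrM ger0_norm ?exprn_ge0 //; apply: le_trans le.
by rewrite ler_piMl // exprn_ile1.
Qed.

Lemma is_derive_radial k j h x v : Ck k.+1 B h -> B x ->
  is_derive x v (radial j h) (radial j.+1 ('D_v h) x).
Proof.
move=> hh Bx; have hD := CkS_derive v hh.
have hc : (fun s : R => s^-1 *: (radial j h (s *: v + x) - radial j h x)) @ 0^' -->
    radial j.+1 ('D_v h) x.
  apply/cvgrPdist_le => r r0; have N := near_radial_quotient j v hh Bx r0.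
  near=> s; have [Bs hs] : B (s *: v + x) /\ forall t, 0 <= t <= 1 ->
   `|s^-1 * (t ^+ j * h (a + t *: (s *: v + x - a)) - t ^+ j * h (a + t *: (x - a)))
     - t ^+ j.+1 * 'D_v h (a + t *: (x - a))| <= r by near: s.
  have c1 := cont01_radial (j := j) hh Bs; have c2 := cont01_radial (j := j) hh Bx.
  have c3 := cont01_radial (j := j.+1) hD Bx.
  rewrite distrC.
  have -> : s^-1 *: (radial j h (s *: v + x) - radial j h x) =
    int01 (fun t => s^-1 * (t ^+ j * h (a + t *: (s *: v + x - a)) - t ^+ j * h (a + t *: (x - a)))).
    rewrite int01Z; last exact: cont01B.
    rewrite -[LHS]/(s^-1 * _); congr (_ * _).
    by rewrite /int01 RintegralB //; apply: cont01_integrable.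
  apply: int01_dist => //; apply: cont01M; last exact: cont01B.
  by move=> t _; apply: cvg_cst.
apply: DeriveDef; first by apply/cvg_ex; eexists; exact: hc.
exact: (cvg_lim (@norm_hausdorff _ _) hc).
Unshelve. all: by end_near. Qed.

Lemma Ck_radial k j h : Cinfty B h -> Ck k B (radial j h).
Proof.
elim: k j h => [|k IH] j h hh.
  by split=> // x Bx; apply: radial_continuous (hh 0%N) Bx.
apply: CkS_intro; first exact: ball_open.
  by move=> x Bx; apply: radial_continuous (hh 0%N) Bx.
move=> v; exists (radial j.+1 ('D_v h)).
  by apply: IH => i; apply: CkS_derive.
by move=> x Bx; apply: is_derive_radial (hh 1%N) Bx.
Qed.

End Hadamard.

(** Fundamental theorem of calculus on the segment from [a] to [x]. The coefficients are smooth by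
    [Ck_radial], so a derivation can be applied to each product. *)
Lemma hadamard (R : realType) (m : nat) (a : 'rV[R]_m) (e : R) (f : 'rV[R]_m -> R) x :
  0 < e -> Cinfty (ball a e) f -> ball a e x ->
  f x = f a + \sum_i (x - a) 0 i * radial a 0 ('D_(bvec R i) f) x.
Proof.
move=> e0 hf Bx; have oB : open (ball a e) by apply: ball_open.
pose df i (t : R) := t ^+ 0 * 'D_(bvec R i) f (a + t *: (x - a)).
have cdf i : cont01 (df i) by apply: cont01_radial (CkS_derive _ (hf 1%N)) Bx.
have cxdf i : cont01 (fun t => (x - a) 0 i * df i t).
  by apply: cont01M (cdf i) => t _; apply: cvg_cst.
have d (t : R) : 0 <= t <= 1 -> is_derive t 1 (fun s : R => f (a + s *: (x - a)))
    (\sum_i (x - a) 0 i * df i t).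
  move=> ht; have Bt := ball_path Bx ht.
  have := proj1 (is_derive_slice f a (x - a) t _) (CkS_is_derive (x - a) (hf 1%N) Bt).
  rewrite (Ck_derive_row _ oB (hf 1%N) Bt).
  by under eq_bigr do rewrite -[X in _ * X]mul1r -(expr0 t).
have := int01_FTC (cont01_sum (r := index_enum _) cxdf) d.
rewrite scale1r scale0r addr0 addrCA subrr addr0 (int01_sum _ cxdf).
under eq_bigr do rewrite (int01Z _ (cdf _)).
by rewrite /radial /df => ->; rewrite addrC subrK.
Qed.

(** * Smooth functions and tangent vectors on a manifold *)

Section ComplexParts.
Variable R : realType.
Implicit Types x y : R[i].

Lemma ReM x y : complex.Re (x * y) = complex.Re x * complex.Re y - complex.Im x * complex.Im y.
Proof. by case: x; case: y. Qed.

Lemma ImM x y : complex.Im (x * y) = complex.Re x * complex.Im y + complex.Im x * complex.Re y.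
Proof. by case: x => a b; case: y => c d. Qed.

Lemma ReD x y : complex.Re (x + y) = complex.Re x + complex.Re y.
Proof. by case: x; case: y. Qed.

Lemma ImD x y : complex.Im (x + y) = complex.Im x + complex.Im y.
Proof. by case: x; case: y. Qed.

Lemma ReJ x : complex.Re x^* = complex.Re x.
Proof. by case: x. Qed.

Lemma ImJ x : complex.Im x^* = - complex.Im x.
Proof. by case: x. Qed.

Lemma complex_ext x y : complex.Re x = complex.Re y -> complex.Im x = complex.Im y -> x = y.
Proof. by case: x => a b; case: y => c d /= -> ->. Qed.

Lemma cjD x y : (x + y)^* = x^* + y^*.
Proof. exact: rmorphD. Qed.

Lemma cjM x y : (x * y)^* = x^* * y^*.
Proof. exact: rmorphM. Qed.

Lemma cjK x : x^*^* = x.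
Proof. exact: conjCK. Qed.

End ComplexParts.

Section SmoothFunctions.
Variables (R : realType) (m : nat) (M : manifold R m).
Implicit Types (U V : set M) (f g : M -> R[i]) (r s : M -> R).

Definition cdomain (c : chart R m M) U : set 'rV[R]_m := cimg c `&` cinv c @^-1` U.

Lemma cdomain_open c U : open U -> open (cdomain c U).
Proof.
move=> oU; rewrite openE => x [ix Ux]; apply: filterI.
  by apply: open_nbhs_nbhs; split=> //; apply: cimg_open.
by apply: (cinv_cont ix); apply: open_nbhs_nbhs.
Qed.

Lemma eq_rsm U r s : open U -> (forall p, U p -> r p = s p) -> rsmooth_on U r -> rsmooth_on U s.
Proof.
by move=> oU e h c ac k; apply: eq_Ck (h c ac k) => [|x []]; [exact: cdomain_open | move=> _ /e].
Qed.

Lemma rsm_cst U (a : R) : rsmooth_on U (fun=> a).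
Proof. by move=> c ac k; apply: Ck_cst. Qed.

Lemma rsmD U r s : open U -> rsmooth_on U r -> rsmooth_on U s -> rsmooth_on U (fun p => r p + s p).
Proof. by move=> oU h1 h2 c ac k; apply: CkD; [exact: cdomain_open | exact: h1 | exact: h2]. Qed.

Lemma rsmM U r s : open U -> rsmooth_on U r -> rsmooth_on U s -> rsmooth_on U (fun p => r p * s p).
Proof. by move=> oU h1 h2 c ac k; apply: CkM; [exact: cdomain_open | exact: h1 | exact: h2]. Qed.

Lemma rsmN U r : open U -> rsmooth_on U r -> rsmooth_on U (fun p => - r p).
Proof.
move=> oU h; apply: eq_rsm (rsmM oU (rsm_cst U (-1)) h) => // p _; exact: mulN1r.
Qed.

Lemma rsm_expR U r : open U -> rsmooth_on U r -> rsmooth_on U (fun p => expR (r p)).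
Proof. by move=> oU h c ac k; apply: Ck_expR; [exact: cdomain_open | exact: h]. Qed.

Lemma rsm_ln U r : open U -> (forall p, U p -> 0 < r p) -> rsmooth_on U r ->
  rsmooth_on U (fun p => ln (r p)).
Proof.
move=> oU pos h c ac k; apply: Ck_ln; [exact: cdomain_open | by move=> x [_ /pos] | exact: h].
Qed.

Lemma sub_sm U V f : V `<=` U -> smooth_on U f -> smooth_on V f.
Proof.
move=> VU [h1 h2]; split=> c ac k; [apply: sub_Ck (h1 c ac k) | apply: sub_Ck (h2 c ac k)];
  by move=> x [a b]; split=> //; apply: VU.
Qed.

Lemma eq_sm U f g : open U -> (forall p, U p -> f p = g p) -> smooth_on U f -> smooth_on U g.
Proof.
by move=> oU e [h1 h2]; split; [apply: eq_rsm h1|apply: eq_rsm h2] => // p /e ->.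
Qed.

Lemma sm_cst U (a : R[i]) : smooth_on U (fun=> a).
Proof. by split; apply: rsm_cst. Qed.

Lemma smD U f g : open U -> smooth_on U f -> smooth_on U g -> smooth_on U (fun p => f p + g p).
Proof.
move=> oU [a b] [c d]; split.
  by apply: eq_rsm (rsmD oU a c) => // p _; rewrite ReD.
by apply: eq_rsm (rsmD oU b d) => // p _; rewrite ImD.
Qed.

Lemma smM U f g : open U -> smooth_on U f -> smooth_on U g -> smooth_on U (fun p => f p * g p).
Proof.
move=> oU [a b] [c d]; split.
  by apply: eq_rsm (rsmD oU (rsmM oU a c) (rsmN oU (rsmM oU b d))) => // p _; rewrite ReM.
by apply: eq_rsm (rsmD oU (rsmM oU a d) (rsmM oU b c)) => // p _; rewrite ImM.
Qed.

Lemma smJ U f : open U -> smooth_on U f -> smooth_on U (fun p => (f p)^*).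
Proof.
move=> oU [a b]; split; first by apply: eq_rsm a => // p _; rewrite ReJ.
by apply: eq_rsm (rsmN oU b) => // p _; rewrite ImJ.
Qed.

Lemma smN U f : open U -> smooth_on U f -> smooth_on U (fun p => - f p).
Proof. by move=> oU h; apply: eq_sm (smM oU (sm_cst U (-1)) h) => // p _; rewrite mulN1r. Qed.

Lemma smB U f g : open U -> smooth_on U f -> smooth_on U g -> smooth_on U (fun p => f p - g p).
Proof. by move=> oU h1 h2; apply: smD => //; apply: smN. Qed.

Lemma sm_sum U (I : Type) (l : seq I) (f : I -> M -> R[i]) : open U ->
  (forall i, smooth_on U (f i)) -> smooth_on U (fun p => \sum_(i <- l) f i p).
Proof.
move=> oU h; elim: l => [|i l IH].
  by apply: eq_sm (sm_cst U 0) => // p _; rewrite big_nil.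
by apply: eq_sm (smD oU (h i) IH) => // p _; rewrite big_cons.
Qed.

Lemma sm_real U r : rsmooth_on U r -> smooth_on U (fun p => (r p)%:C%C).
Proof. by move=> h; split=> //; apply: rsm_cst. Qed.

Lemma smooth_at_on U f p : open U -> U p -> smooth_on U f -> smooth_at p f.
Proof. by move=> oU Up h; exists U. Qed.

Lemma smooth_atD p f g : smooth_at p f -> smooth_at p g -> smooth_at p (fun x => f x + g x).
Proof.
move=> [U [oU Up hf]] [V [oV Vp hg]]; exists (U `&` V); split=> //; first exact: openI.
by apply: smD; [exact: openI | apply: sub_sm hf => x [] | apply: sub_sm hg => x []].
Qed.

Lemma smooth_atM p f g : smooth_at p f -> smooth_at p g -> smooth_at p (fun x => f x * g x).
Proof.
move=> [U [oU Up hf]] [V [oV Vp hg]]; exists (U `&` V); split=> //; first exact: openI.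
by apply: smM; [exact: openI | apply: sub_sm hf => x [] | apply: sub_sm hg => x []].
Qed.

Lemma smooth_at_cst (p : M) (a : R[i]) : smooth_at p (fun=> a).
Proof. by exists setT; split; [exact: openT | | exact: sm_cst]. Qed.

Lemma smooth_atJ p f : smooth_at p f -> smooth_at p (fun x => (f x)^*).
Proof. by move=> [U [oU Up hf]]; exists U; split=> //; apply: smJ. Qed.

(** Smoothness is demanded in every chart of the atlas; the transition maps reduce it to the single
    chart [c]. *)
Lemma chart_rsm c U (W : set 'rV[R]_m) (g : 'rV[R]_m -> R) r : atlas c -> open U -> open W ->
  U `<=` cdom c -> (forall p, U p -> W (cmap c p)) -> Cinfty W g ->
  (forall p, U p -> r p = g (cmap c p)) -> rsmooth_on U r.
Proof.
move=> ac oU oW Uc UW hg e c' ac' k; have oD := @cdomain_open c' U oU.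
apply: (@eq_Ck R _ k _ _ (fun x => g (cmap c (cinv c' x)))) => //.
  by move=> x [_ Ux]; rewrite e.
apply: (Ck_comp oD oW _ _ (hg k)); first by move=> x [_ /UW].
by apply: sub_Ck (atlas_compat ac' ac k) => x [a /Uc b].
Qed.

End SmoothFunctions.

Section Tangent.
Variables (R : realType) (m : nat) (M : manifold R m).
Implicit Types (U V : set M) (f g : M -> R[i]) (p : M) (v w : tvec M).

Lemma tangent0 p v : tangent p v -> v (fun=> 0) = 0.
Proof.
move=> tv; have := tangent_linear tv (-1) (smooth_at_cst p 0) (smooth_at_cst p 0).
have -> : (fun=> -1 * 0 + 0) = (fun=> 0 : R[i]) :> (M -> R[i]) by apply/funext => x; rewrite mulr0 addr0.
by move=> ->; rewrite mulN1r addNr.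
Qed.

Lemma tangentZ p v (a : R[i]) f : tangent p v -> smooth_at p f -> v (fun x => a * f x) = a * v f.
Proof.
move=> tv hf; have := tangent_linear tv a hf (smooth_at_cst p 0).
rewrite (tangent0 tv) addr0 => <-; congr v; by apply/funext => x; rewrite addr0.
Qed.

Lemma tangentD p v f g : tangent p v -> smooth_at p f -> smooth_at p g ->
  v (fun x => f x + g x) = v f + v g.
Proof.
move=> tv hf hg; have := tangent_linear tv 1 hf hg; rewrite mul1r => <-.
by congr v; apply/funext => x; rewrite mul1r.
Qed.

(** The indicator [chi] of [U] is smooth at [p], being constant near [p], and takes the place of a
    bump function: chi f = chi g everywhere, and the Leibniz rule then compares [v f] with [v g]. *)
Lemma tangent_local p v U f g : tangent p v -> open U -> U p -> smooth_at p f ->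
  (forall x, U x -> f x = g x) -> v f = v g.
Proof.
move=> tv oU Up hf e.
pose chi x : R[i] := if `[< U x >] then 1 else 0.
have hchi : smooth_at p chi.
  exists U; split=> //; apply: eq_sm (sm_cst U 1) => // x Ux.
  by rewrite /chi; case: asboolP.
have chip : chi p = 1 by rewrite /chi; case: asboolP.
have hg : smooth_at p g.
  case: hf => V [oV Vp hV]; exists (U `&` V); split=> //; first exact: openI.
  by apply: eq_sm (sub_sm _ hV) => [|x [/e]|x []] //; apply: openI.
have := tangent_leibniz tv hchi hf; have := tangent_leibniz tv hchi hg.
have -> : (fun x => chi x * g x) = (fun x => chi x * f x).
  by apply/funext => x; rewrite /chi; case: asboolP => [/e ->|_]; rewrite ?mul0r.
by rewrite chip !mul1r (e p Up) => -> /addrI ->.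
Qed.

Lemma tangent_cst p v (a : R[i]) : tangent p v -> v (fun=> a) = 0.
Proof.
move=> tv; have h1 : v (fun=> 1) = 0.
  have := tangent_leibniz tv (smooth_at_cst p 1) (smooth_at_cst p 1).
  have -> : (fun=> 1 * 1) = (fun=> 1 : R[i]) :> (M -> R[i]) by apply/funext => x; rewrite mul1r.
  by rewrite mulr1 mul1r => e; apply: (addrI (v (fun=> 1))); rewrite addr0 -{1}e.
have := tangentZ a tv (smooth_at_cst p 1); rewrite h1 mulr0 => <-.
by congr v; apply/funext => x; rewrite mulr1.
Qed.

Lemma tangent_tlin p (a : R[i]) v w : tangent p v -> tangent p w -> tangent p (tlin a v w).
Proof.
move=> tv tw; split=> [b f g hf hg|f g hf hg]; rewrite /tlin.
  by rewrite (tangent_linear tv) // (tangent_linear tw) //; ring.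
by rewrite (tangent_leibniz tv) // (tangent_leibniz tw) //; ring.
Qed.

Lemma tangent_tzero p : tangent p (@tzero R m M).
Proof. by split=> *; rewrite /tzero; ring. Qed.

Lemma tangent_tconj p v : tangent p v -> tangent p (tconj v).
Proof.
move=> tv; split=> [b f g hf hg|f g hf hg]; rewrite /tconj.
  rewrite (_ : (fun x => _) = (fun x => b^* * (f x)^* + (g x)^*)).
    by rewrite (tangent_linear tv _ (smooth_atJ hf) (smooth_atJ hg)) cjD cjM cjK.
  by apply/funext => x; rewrite cjD cjM.
rewrite (_ : (fun x => _) = (fun x => (f x)^* * (g x)^*)).
  by rewrite (tangent_leibniz tv (smooth_atJ hf) (smooth_atJ hg)) cjD !cjM !cjK.
by apply/funext => x; rewrite cjM.
Qed.

Definition tsum (I : Type) (l : seq I) (a : I -> R[i]) (v : I -> tvec M) : tvec M :=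
  fun f => \sum_(i <- l) a i * v i f.

Lemma tsum_cons I i l a (v : I -> tvec M) : tsum (i :: l) a v = tlin (a i) (v i) (tsum l a v).
Proof. by apply/funext => f; rewrite /tsum big_cons. Qed.

Lemma tsum_nil I a (v : I -> tvec M) : tsum [::] a v = @tzero R m M.
Proof. by apply/funext => f; rewrite /tsum big_nil. Qed.

Lemma tangent_tsum I (l : seq I) a (v : I -> tvec M) p : (forall i, tangent p (v i)) ->
  tangent p (tsum l a v).
Proof.
move=> tv; elim: l => [|i l IH]; first by rewrite tsum_nil; apply: tangent_tzero.
by rewrite tsum_cons; apply: tangent_tlin.
Qed.

Lemma tangent_sum I (l : seq I) (f : I -> M -> R[i]) p v : tangent p v ->
  (forall i, smooth_at p (f i)) -> v (fun x => \sum_(i <- l) f i x) = \sum_(i <- l) v (f i).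
Proof.
move=> tv hf; have [e _] : v (fun x => \sum_(i <- l) f i x) = \sum_(i <- l) v (f i) /\
    smooth_at p (fun x => \sum_(i <- l) f i x); last exact: e.
elim: l => [|i l [IH sm]].
  rewrite (_ : (fun x => _) = fun=> 0); last by apply/funext => x; rewrite big_nil.
  by rewrite big_nil (tangent0 tv); split=> //; apply: smooth_at_cst.
rewrite (_ : (fun x => _) = fun x => f i x + \sum_(j <- l) f j x).
  by rewrite big_cons (tangentD tv) // IH; split=> //; apply: smooth_atD.
by apply/funext => x; rewrite big_cons.
Qed.

Lemma vfield_sub U V (X : vfield M) : V `<=` U -> vfield_on U X -> vfield_on V X.
Proof.
move=> VU [t s]; split=> [p /VU|W f oW WV]; first exact: t.
by apply: s => // x /WV /VU.
Qed.

Lemma vfield_app U (X : vfield M) f : open U -> vfield_on U X -> smooth_on U f ->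
  smooth_on U (fun q => X q f).
Proof. by move=> oU [_ s] hf; apply: s. Qed.

Lemma vfield_tlin U (a : M -> R[i]) (X Y : vfield M) : open U -> smooth_on U a -> vfield_on U X ->
  vfield_on U Y -> vfield_on U (fun q => tlin (a q) (X q) (Y q)).
Proof.
move=> oU ha [tX sX] [tY sY]; split=> [p Up|V f oV VU hf].
  by apply: tangent_tlin; [apply: tX | apply: tY].
by apply: smD; [|apply: smM; [|apply: sub_sm ha|apply: sX]|apply: sY].
Qed.

Lemma vfield_zero U : vfield_on U (fun=> @tzero R m M).
Proof. by split=> [p _|V f oV VU hf]; [apply: tangent_tzero | apply: sm_cst]. Qed.

Lemma vfield_tsum U I (l : seq I) (a : I -> M -> R[i]) (X : I -> vfield M) : open U ->
  (forall i, smooth_on U (a i)) -> (forall i, vfield_on U (X i)) ->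
  vfield_on U (fun q => tsum l (fun i => a i q) (fun i => X i q)).
Proof.
move=> oU ha hX; elim: l => [|i l IH].
  rewrite (_ : (fun q => _) = fun=> @tzero R m M); first exact: vfield_zero.
  by apply/funext => q; rewrite tsum_nil.
rewrite (_ : (fun q => _) = fun q => tlin (a i q) (X i q) (tsum l (fun i => a i q) (fun i => X i q))).
  exact: vfield_tlin.
by apply/funext => q; rewrite tsum_cons.
Qed.

Lemma vfield_fconj U (X : vfield M) : open U -> vfield_on U X -> vfield_on U (fconj X).
Proof.
move=> oU [tX sX]; split=> [p Up|V f oV VU hf]; first by apply: tangent_tconj; apply: tX.
by rewrite /fconj /tconj; apply: smJ => //; apply: sX => //; apply: smJ.
Qed.

Lemma vfield_bracket U (X Y : vfield M) : open U -> vfield_on U X -> vfield_on U Y ->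
  vfield_on U (bracket X Y).
Proof.
move=> oU hX hY; have [tX sX] := hX; have [tY sY] := hY.
split=> [p Up|V f oV VU hf]; last first.
  by apply: smB => //; [apply: (sX) => //; apply: sY | apply: (sY) => //; apply: sX].
have on_at (W : vfield M) f q : vfield_on U W -> U q -> smooth_at q f -> smooth_at q (fun x => W x f).
  move=> [_ sW] Uq [V [oV Vq hV]]; exists (V `&` U); split=> //; first exact: openI.
  by apply: sW => [|x []|] //; [exact: openI | apply: sub_sm hV => x []].
have lin (W W' : vfield M) (a : R[i]) f g : vfield_on U W -> vfield_on U W' ->
    smooth_at p f -> smooth_at p g ->
    W p (fun q => W' q (fun x => a * f x + g x)) = a * W p (fun q => W' q f) + W p (fun q => W' q g).
  move=> hW hW' hf hg; have hf' := on_at _ _ _ hW' Up hf; have hg' := on_at _ _ _ hW' Up hg.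
  have [tW _] := hW; have [tW' _] := hW'.
  rewrite -(tangent_linear (tW p Up)) //.
  case: hf => V1 [oV1 V1p h1]; case: hg => V2 [oV2 V2p h2].
  symmetry; apply: (@tangent_local p _ (U `&` V1 `&` V2)) => //; first exact: tW.
  - by apply: openI => //; apply: openI.
  - by apply: smooth_atD => //; apply: smooth_atM => //; apply: smooth_at_cst.
  - move=> q [[Uq V1q] V2q]; rewrite (tangent_linear (tW' q Uq)) //.
      exact: smooth_at_on h1.
    exact: smooth_at_on h2.
have leib (W W' : vfield M) f g : vfield_on U W -> vfield_on U W' ->
    smooth_at p f -> smooth_at p g ->
    W p (fun q => W' q (fun x => f x * g x)) =
    W p (fun q => W' q f) * g p + W' p f * W p g + (W p f * W' p g + f p * W p (fun q => W' q g)).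
  move=> hW hW' hf hg; have hf' := on_at _ _ _ hW' Up hf; have hg' := on_at _ _ _ hW' Up hg.
  have [tW _] := hW; have [tW' _] := hW'.
  rewrite -(tangent_leibniz (tW p Up) hf' hg) -(tangent_leibniz (tW p Up) hf hg').
  rewrite -(tangentD (tW p Up)); [|by apply: smooth_atM|by apply: smooth_atM].
  case: hf => V1 [oV1 V1p h1]; case: hg => V2 [oV2 V2p h2].
  have sf : smooth_at p f by exists V1. have sg : smooth_at p g by exists V2.
  symmetry; apply: (@tangent_local p _ (U `&` V1 `&` V2)) => //; first exact: tW.
  - by apply: openI => //; apply: openI.
  - by apply: smooth_atD; apply: smooth_atM.
  - move=> q [[Uq V1q] V2q]; rewrite (tangent_leibniz (tW' q Uq)) //.
      exact: smooth_at_on h1.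
    exact: smooth_at_on h2.
split=> [a f g hf hg|f g hf hg]; rewrite /bracket.
  by rewrite !lin //; ring.
by rewrite !leib //; ring.
Qed.

End Tangent.

(** * Tangent vectors in the coordinates of a chart *)

Section ChartCoordinates.
Variables (R : realType) (m : nat) (M : manifold R m) (c : chart R m M).
Hypothesis ac : atlas c.
Implicit Types (U V : set M) (f g : M -> R[i]) (r s : M -> R) (p q : M) (v w : tvec M).

Definition crd (i : 'I_m) : M -> R := fun q => cmap c q 0 i.

Definition cpart (i : 'I_m) r : M -> R :=
  fun q => 'D_(bvec R i) (fun x => r (cinv c x)) (cmap c q).

Definition cdir (i : 'I_m) : vfield M := fun q f =>
  (cpart i (fun x => complex.Re (f x)) q +i* cpart i (fun x => complex.Im (f x)) q)%C.

Lemma cmap_preim_open (W : set 'rV[R]_m) : open W -> open (cdom c `&` cmap c @^-1` W).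
Proof.
move=> oW; rewrite openE => q [cq Wq]; apply: filterI.
  by apply: open_nbhs_nbhs; split=> //; apply: cdom_open.
by apply: (cmap_cont cq); apply: open_nbhs_nbhs.
Qed.

Lemma cdomain_cmap U q : cdom c q -> U q -> cdomain c U (cmap c q).
Proof. by move=> cq Uq; split; [apply: cmap_img | rewrite /= cmapK]. Qed.

Lemma rsm_crd i : rsmooth_on (cdom c) (crd i).
Proof.
move=> c' ac' k; apply: Ck_coord; first exact: (@cdomain_open _ _ _ c' _ (cdom_open c)).
exact: atlas_compat ac' ac k.
Qed.

Lemma rsm_cpart U i r : open U -> U `<=` cdom c -> rsmooth_on U r -> rsmooth_on U (cpart i r).
Proof.
move=> oU Uc hr; have oD := @cdomain_open _ _ _ c _ oU.
apply: (chart_rsm ac oU oD Uc (g := 'D_(bvec R i) (fun x => r (cinv c x)))) => //.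
  by move=> p Up; apply: cdomain_cmap => //; apply: Uc.
by move=> k; apply: CkS_derive; apply: hr.
Qed.

Lemma cpart_is_derive U i r q : open U -> U q -> cdom c q -> rsmooth_on U r ->
  is_derive (cmap c q) (bvec R i) (fun x => r (cinv c x)) (cpart i r q).
Proof.
move=> oU Uq cq hr; have Wq := cdomain_cmap cq Uq.
by have := CkS_is_derive (bvec R i) (hr c ac 1%N) Wq.
Qed.

Lemma cpartE i r q (d : R) : is_derive (cmap c q) (bvec R i) (fun x => r (cinv c x)) d ->
  cpart i r q = d.
Proof. by move=> [_ <-]. Qed.

Lemma tangent_cdir i q : cdom c q -> tangent q (cdir i q).
Proof.
move=> cq; split=> [a f g [U [oU Uq [f1 f2]]] [V [oV Vq [g1 g2]]]
                   |f g [U [oU Uq [f1 f2]]] [V [oV Vq [g1 g2]]]].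
  have df1 := cpart_is_derive i oU Uq cq f1; have df2 := cpart_is_derive i oU Uq cq f2.
  have dg1 := cpart_is_derive i oV Vq cq g1; have dg2 := cpart_is_derive i oV Vq cq g2.
  apply: complex_ext; rewrite ?ReD ?ImD ?ReM ?ImM /=; apply: cpartE.
    under eq_fun do rewrite ReD ReM.
    by apply: is_deriveD; apply: is_deriveB; apply: is_deriveZ.
  under eq_fun do rewrite ImD ImM.
  by apply: is_deriveD; apply: is_deriveD; apply: is_deriveZ.
have df1 := cpart_is_derive i oU Uq cq f1; have df2 := cpart_is_derive i oU Uq cq f2.
have dg1 := cpart_is_derive i oV Vq cq g1; have dg2 := cpart_is_derive i oV Vq cq g2.
apply: complex_ext; rewrite ?ReD ?ImD ?ReM ?ImM /=; apply: cpartE.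
  under eq_fun do rewrite ReM.
  have := is_deriveB (is_deriveM df1 dg1) (is_deriveM df2 dg2).
  rewrite !cmapK // => h; apply: is_derive_eq h _.
  by rewrite -![_ *: _]/(_ * _); ring.
under eq_fun do rewrite ImM.
have := is_deriveD (is_deriveM df1 dg2) (is_deriveM df2 dg1).
rewrite !cmapK // => h; apply: is_derive_eq h _.
by rewrite -![_ *: _]/(_ * _); ring.
Qed.

Lemma vfield_cdir i : vfield_on (cdom c) (cdir i).
Proof.
split=> [q|V f oV Vc [h1 h2]]; first exact: tangent_cdir.
by split; apply: rsm_cpart.
Qed.

Definition crdC i : M -> R[i] := fun q => (crd i q)%:C%C.

Lemma sm_crdC i : smooth_on (cdom c) (crdC i).
Proof. by apply: sm_real; apply: rsm_crd. Qed.

Lemma smooth_at_crdC i p : cdom c p -> smooth_at p (crdC i).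
Proof. by move=> cp; exists (cdom c); split=> //; [apply: cdom_open | apply: sm_crdC]. Qed.

Lemma radial_center (h : 'rV[R]_m -> R) (a : 'rV[R]_m) : radial a 0 h a = h a.
Proof.
rewrite /radial subrr; under eq_fun do rewrite scaler0 addr0 expr0 mul1r.
rewrite /int01 Rintegral_cst // [X in fine X](_ : _ = 1%E) /= ?mulr1 //.
exact: lebesgue_measure01.
Qed.

(** Hadamard's lemma writes [r] near [p] as a constant plus products of x_i - x_i(p) with smooth
    g_i. A derivation kills the constant, the first factors vanish at [p], and g_i(p) is the i-th
    partial derivative by [radial_center]. *)
Lemma tangent_real_coord U p v r : tangent p v -> open U -> U p -> cdom c p -> rsmooth_on U r ->
  v (fun q => (r q)%:C%C) = \sum_i v (crdC i) * (cpart i r p)%:C%C.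
Proof.
move=> tv oU Up cp hr; pose F x := r (cinv c x); pose a := cmap c p.
have oD := @cdomain_open _ _ _ c _ oU.
have /nbhs_ballP[e /= e0 eD] : nbhs a (cdomain c U).
  by apply: open_nbhs_nbhs; split=> //; apply: cdomain_cmap.
have hF : Cinfty (ball a e) F by move=> k; apply: sub_Ck (hr c ac k).
have oB : open (ball a e) by apply: ball_open.
pose V := cdom c `&` cmap c @^-1` ball a e.
have oV : open V by apply: cmap_preim_open.
have Vp : V p by split=> //; apply: ballxx.
pose g i q : R := radial a 0 ('D_(bvec R i) F) (cmap c q).
have hg i : smooth_on V (fun q => (g i q)%:C%C).
  apply: sm_real; apply: (chart_rsm ac oV oB (g := radial a 0 ('D_(bvec R i) F))) => //.
  - by move=> q [].
  - by move=> q [].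
  - by move=> k; apply: Ck_radial => j; apply: CkS_derive.
have hx i : smooth_on V (fun q => crdC i q + (- crdC i p)).
  by apply: smD => //; [apply: sub_sm (sm_crdC i) => q [] | apply: sm_cst].
have ex q : V q -> (r q)%:C%C = (r p)%:C%C + \sum_i (crdC i q + (- crdC i p)) * (g i q)%:C%C.
  move=> [cq Bq]; have := hadamard e0 hF Bq; rewrite {1 2}/F !cmapK // => ->.
  rewrite rmorphD rmorph_sum; congr (_ + _); apply: eq_bigr => i _.
  by rewrite rmorphM /crdC /crd !mxE rmorphB.
have sr : smooth_at p (fun q => (r q)%:C%C) by exists U; split=> //; apply: sm_real.
rewrite (tangent_local tv oV Vp sr ex) (tangentD tv); first last.
- by exists V; split=> //; apply: sm_sum => // i; apply: smM.
- exact: smooth_at_cst.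
rewrite (tangent_cst _ tv) add0r (tangent_sum _ tv); last first.
  by move=> i; exists V; split=> //; apply: smM.
apply: eq_bigr => i _; rewrite (tangent_leibniz tv); [|by exists V|by exists V].
rewrite subrr mul0r addr0 (tangentD tv); [|exact: smooth_at_crdC|exact: smooth_at_cst].
by rewrite (tangent_cst _ tv) addr0 /g -/a radial_center.
Qed.

Lemma complex_decomp (z : R[i]) : z = (complex.Re z)%:C%C + 'i%C * (complex.Im z)%:C%C.
Proof. exact: complexE. Qed.

Lemma tangent_coord p v f : tangent p v -> cdom c p -> smooth_at p f ->
  v f = \sum_i v (crdC i) * cdir i p f.
Proof.
move=> tv cp [U [oU Up [h1 h2]]].
have s1 : smooth_at p (fun q => (complex.Re (f q))%:C%C) by exists U; split=> //; apply: sm_real.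
have s2 : smooth_at p (fun q => (complex.Im (f q))%:C%C) by exists U; split=> //; apply: sm_real.
have -> : v f = v (fun q => 'i%C * (complex.Im (f q))%:C%C + (complex.Re (f q))%:C%C).
  by congr v; apply/funext => q; rewrite addrC -complex_decomp.
rewrite (tangent_linear tv) // !(tangent_real_coord tv oU Up cp) // mulr_sumr -big_split.
apply: eq_bigr => i _ /=.
by rewrite [cdir i p f]complex_decomp /= mulrDr addrC mulrCA.
Qed.

(** A chain rule for abstract derivations; in coordinates it reduces to the one for partial
    derivatives. *)
Lemma tangent_ln U p v r : tangent p v -> open U -> U p -> cdom c p -> rsmooth_on U r ->
  (forall q, U q -> 0 < r q) ->
  v (fun q => (r q)%:C%C) = (r p)%:C%C * v (fun q => (ln (r q))%:C%C).
Proof.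
move=> tv oU Up cp hr pos; have rp := pos p Up.
rewrite (tangent_real_coord tv oU Up cp hr) (tangent_real_coord tv oU Up cp (rsm_ln oU pos hr)).
rewrite mulr_sumr; apply: eq_bigr => i _; rewrite mulrCA; congr (_ * _).
rewrite -rmorphM; congr (_%:C%C).
have e : cpart i (fun q => ln (r q)) p = (r p)^-1 * cpart i r p.
  apply: cpartE; have := is_derive_comp1 (cpart_is_derive i oU Up cp hr).
  by rewrite cmapK // => h; apply: h; apply: is_derive1_ln.
by rewrite e mulrA mulfV ?mul1r // gt_eqF.
Qed.

Lemma cpart_max U p r i : open U -> U p -> cdom c p -> rsmooth_on U r ->
  (forall q, U q -> r q <= r p) -> cpart i r p = 0.
Proof.
move=> oU Up cp hr mx; have Wp := cdomain_cmap cp Up.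
apply: (Ck_max_first _ (hr c ac 1%N) Wp).
have oD := @cdomain_open _ _ _ c _ oU.
apply: filterS (open_nbhs_nbhs (conj oD Wp)) => x [_ Ux] /=.
by rewrite cmapK //; apply: mx.
Qed.

Lemma cpart_cpart U p r i j : open U -> U p -> U `<=` cdom c -> rsmooth_on U r ->
  cpart j (cpart i r) p = 'D_(bvec R j) ('D_(bvec R i) (fun x => r (cinv c x))) (cmap c p).
Proof.
move=> oU Up Uc hr; apply: near_eq_derive.
have Wp := cdomain_cmap (Uc _ Up) Up; have oD := @cdomain_open _ _ _ c _ oU.
apply: filterS (open_nbhs_nbhs (conj oD Wp)) => x [ix _].
by rewrite /cpart cinvK.
Qed.

(** The double sum is the second derivative along the single direction with components [xi], so
    [Ck_max_second] applies. *)
Lemma hessian_max U p r (xi : 'I_m -> R) : open U -> U p -> U `<=` cdom c -> rsmooth_on U r ->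
  (forall q, U q -> r q <= r p) ->
  \sum_i \sum_j xi i * xi j * cpart j (cpart i r) p <= 0.
Proof.
move=> oU Up Uc hr mx; pose F x := r (cinv c x); pose a := cmap c p.
have cp := Uc _ Up; have Wp := cdomain_cmap cp Up; have oD := @cdomain_open _ _ _ c _ oU.
pose w : 'rV[R]_m := \row_i xi i.
have hF k : Ck k (cdomain c U) F by apply: hr.
have : 'D_w ('D_w F) a <= 0.
  apply: (Ck_max_second _ oD (hF 2%N) Wp).
  apply: filterS (open_nbhs_nbhs (conj oD Wp)) => x [_ Ux] /=.
  by rewrite /F cmapK //; apply: mx.
have -> : 'D_w ('D_w F) a = 'D_w (fun x => \sum_i xi i * 'D_(bvec R i) F x) a.
  apply: near_eq_derive; apply: filterS (open_nbhs_nbhs (conj oD Wp)) => x Wx.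
  by rewrite (Ck_derive_row _ oD (hF 1%N) Wx); apply: eq_bigr => i _; rewrite mxE.
have hS : Ck 1 (cdomain c U) (fun x => \sum_i xi i * 'D_(bvec R i) F x).
  by apply: Ck_sum => // i; apply: CkM => //; [apply: Ck_cst | apply: CkS_derive].
rewrite (Ck_derive_row _ oD hS Wp) => le; apply: le_trans le; rewrite le_eqVlt; apply/orP; left.
rewrite exchange_big /=; apply/eqP; apply: eq_bigr => j _; rewrite mxE.
have -> : 'D_(bvec R j) (fun x => \sum_i xi i * 'D_(bvec R i) F x) a =
    \sum_i xi i * 'D_(bvec R j) ('D_(bvec R i) F) a.
  have d i : is_derive a (bvec R j) (fun x => xi i * 'D_(bvec R i) F x)
      (xi i * 'D_(bvec R j) ('D_(bvec R i) F) a).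
    by apply: is_deriveZ; apply: (CkS_is_derive _ (CkS_derive _ (hF 2%N)) Wp).
  have [_ <-] : is_derive a (bvec R j) (\sum_i (fun x => xi i * 'D_(bvec R i) F x))
    (\sum_i xi i * 'D_(bvec R j) ('D_(bvec R i) F) a) by apply: is_derive_sum.
  by congr derive; apply/funext => x; rewrite fct_sumE.
rewrite mulr_sumr; apply: eq_bigr => i _.
by rewrite (cpart_cpart i j oU Up Uc hr) mulrA [xi j * _]mulrC.
Qed.

End ChartCoordinates.

(** * First and second derivatives along complex vector fields at a maximum *)

Section MaximumPrinciple.
Variables (R : realType) (m : nat) (M : manifold R m).
Implicit Types (U : set M) (X : vfield M) (r : M -> R) (p : M).

Lemma tangent_max U p v r : tangent p v -> open U -> U p -> rsmooth_on U r ->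
  (forall q, U q -> r q <= r p) -> v (fun q => (r q)%:C%C) = 0.
Proof.
move=> tv oU Up hr mx; have [c [ac cp]] := atlas_cover p.
rewrite (tangent_real_coord ac tv oU Up cp hr) big1 // => i _.
by rewrite (cpart_max ac i oU Up cp hr mx) mulr0.
Qed.

Lemma tconj_crdC (c : chart R m M) (v : tvec M) i : (tconj v) (crdC c i) = (v (crdC c i))^*.
Proof.
rewrite /tconj; congr (_^*); congr v; apply/funext => q.
by apply: complex_ext; rewrite ?ReJ ?ImJ //= oppr0.
Qed.

(** If x + i y are the coordinates of X at [p], the two terms together are twice the Hessian on x
    plus twice the Hessian on y, since the imaginary parts cancel. In [R[i]] the inequality includes
    that the left side is real. *)
Lemma vfield_max U X p r : open U -> U p -> vfield_on U X -> rsmooth_on U r ->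
  (forall q, U q -> r q <= r p) ->
  X p (fun q => fconj X q (fun x => (r x)%:C%C)) +
  fconj X p (fun q => X q (fun x => (r x)%:C%C)) <= 0.
Proof.
move=> oU0 Up0 hX0 hr0 mx0; have [c [ac cp]] := atlas_cover p.
pose U' := U `&` cdom c.
have oU : open U' by apply: openI => //; apply: cdom_open.
have Up : U' p by [].
have UU : U' `<=` U by move=> q [].
have Uc : U' `<=` cdom c by move=> q [].
have hX := vfield_sub UU hX0; have mx q : U' q -> r q <= r p by move=> /UU; apply: mx0.
have hr : rsmooth_on U' r.
  by move=> d ad k; apply: sub_Ck (hr0 d ad k) => x [a /UU b].
have hXc := vfield_fconj oU hX.
have second (Y W : vfield M) : vfield_on U' Y -> vfield_on U' W ->
    Y p (fun q => W q (fun x => (r x)%:C%C)) =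
    \sum_i \sum_j W p (crdC c i) * Y p (crdC c j) * (cpart c j (cpart c i r) p)%:C%C.
  move=> hY hW; have [tY _] := hY; have [tW _] := hW.
  have srC : smooth_on U' (fun x => (r x)%:C%C) by apply: sm_real.
  have sW i : smooth_on U' (fun q => W q (crdC c i)).
    by apply: vfield_app => //; apply: sub_sm (sm_crdC ac i).
  have scp i : rsmooth_on U' (cpart c i r) by apply: rsm_cpart.
  have at_ f : smooth_on U' f -> smooth_at p f by move=> ?; exists U'.
  rewrite (tangent_local (tY p Up) oU Up (at_ _ (vfield_app oU hW srC))
    (g := fun q => \sum_i W q (crdC c i) * (cpart c i r q)%:C%C)); last first.
    by move=> q Uq; apply: (tangent_real_coord ac (tW q Uq) oU Uq (Uc _ Uq) hr).
  rewrite (tangent_sum _ (tY p Up)); last first.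
    by move=> i; apply: at_; apply: smM => //; apply: sm_real.
  apply: eq_bigr => i _; rewrite (tangent_leibniz (tY p Up)); [|exact: at_|by apply: at_; apply: sm_real].
  (* Derivatives of the coefficients of [W] multiply first partial derivatives of [r], which vanish
     at the maximum. *)
  rewrite (cpart_max ac i oU Up cp hr mx) mulr0 add0r.
  rewrite (tangent_real_coord ac (tY p Up) oU Up cp (scp i)) mulr_sumr.
  by apply: eq_bigr => j _; rewrite mulrA.
rewrite !second // -big_split /=.
pose x i := complex.Re (X p (crdC c i)); pose y i := complex.Im (X p (crdC c i)).
have -> : \sum_i (\sum_j fconj X p (crdC c i) * X p (crdC c j) * (cpart c j (cpart c i r) p)%:C%C +
    \sum_j X p (crdC c i) * fconj X p (crdC c j) * (cpart c j (cpart c i r) p)%:C%C) =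
  (2 * (\sum_i \sum_j x i * x j * cpart c j (cpart c i r) p +
     \sum_i \sum_j y i * y j * cpart c j (cpart c i r) p))%:C%C.
  rewrite -big_split rmorphM rmorph_sum mulr_sumr; apply: eq_bigr => i _ /=.
  rewrite -!big_split rmorph_sum mulr_sumr; apply: eq_bigr => j _ /=.
  rewrite /fconj !tconj_crdC /x /y; move: (X p (crdC c i)) (X p (crdC c j)) => [a b] [a' b'].
  by apply: complex_ext; rewrite ?(ReD, ImD, ReM, ImM, ReJ, ImJ) /=; ring.
have le0 : 2 * (\sum_i \sum_j x i * x j * cpart c j (cpart c i r) p +
    \sum_i \sum_j y i * y j * cpart c j (cpart c i r) p) <= 0.
  rewrite pmulr_rle0 ?ltr0n // -oppr_ge0 opprD addr_ge0 // oppr_ge0.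
    exact: (hessian_max ac _ oU Up Uc hr mx).
  exact: (hessian_max ac _ oU Up Uc hr mx).
by move: le0; rewrite -lecR.
Qed.

End MaximumPrinciple.

(** * The Bochner formula in a unitary frame *)

(** The indices of Z_a, Z_{\bar a} and T, built by [iZ], [iW] and [iT]; the involution [isw] is
    complex conjugation of the frame. *)
Definition frame_index (n : nat) : finType := ('I_n + 'I_n + unit)%type.
Definition iZ n (a : 'I_n) : frame_index n := inl (inl a).
Definition iW n (a : 'I_n) : frame_index n := inl (inr a).
Definition iT n : frame_index n := inr tt.

Definition isw n (i : frame_index n) : frame_index n :=
  match i with inl (inl a) => iW a | inl (inr a) => iZ a | inr _ => iT n end.

Lemma iswK n : involutive (@isw n). Proof. by case=> [[a|a]|[]]. Qed.

Lemma sum_frame_index n (A : nmodType) (F : frame_index n -> A) :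
  \sum_k F k = \sum_a F (iZ a) + \sum_a F (iW a) + F (iT n).
Proof.
by rewrite big_sumType big_sumType; congr (_ + _); rewrite (bigD1 tt) //= big1 ?addr0 // => -[].
Qed.

(* Structure constants of a unitary frame, torsion-free case: [w i a b] is
   omega_a^b on the frame field with index i, and the T-component of
   [Z_a, Z_{\bar b}] is -i delta_ab. *)
Definition frame_bracket n (A : comPzRingType) (w : frame_index n -> 'I_n -> 'I_n -> A) (im : A)
    (i j k : frame_index n) : A :=
  match i, j, k with
  | inl (inl a), inl (inl d), inl (inl b) => w (iZ a) d b - w (iZ d) a b
  | inl (inr a), inl (inr d), inl (inr b) => w (iW d) b a - w (iW a) b d
  | inl (inl a), inl (inr d), inl (inl b) => - w (iW d) a b
  | inl (inl a), inl (inr d), inl (inr b) => - w (iZ a) b d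
  | inl (inl a), inl (inr d), inr _ => - (im *+ (a == d))
  | inl (inr d), inl (inl a), inl (inl b) => w (iW d) a b
  | inl (inr d), inl (inl a), inl (inr b) => w (iZ a) b d
  | inl (inr d), inl (inl a), inr _ => im *+ (a == d)
  | inr _, inl (inl a), inl (inl b) => w (iT n) a b
  | inl (inl a), inr _, inl (inl b) => - w (iT n) a b
  | inr _, inl (inr a), inl (inr b) => - w (iT n) b a
  | inl (inr a), inr _, inl (inr b) => w (iT n) b a
  | _, _, _ => 0
  end.

(* [fe i] are the frame fields, acting on functions of space and time; [fD] is
   the time derivative. *)
Record crframe (n : nat) (A : comPzRingType) := CRFrame {
  fe : frame_index n -> A -> A;
  fw : frame_index n -> 'I_n -> 'I_n -> A;
  im : A;
  fD : A -> A;
  feD : forall i x y, fe i (x + y) = fe i x + fe i y;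
  feM : forall i x y, fe i (x * y) = fe i x * y + x * fe i y;
  fDD : forall x y, fD (x + y) = fD x + fD y;
  fDM : forall x y, fD (x * y) = fD x * y + x * fD y;
  fe_im : forall i, fe i im = 0;
  fD_im : fD im = 0;
  fD_w : forall i a b, fD (fw i a b) = 0;
  fD_fe : forall i x, fD (fe i x) = fe i (fD x);
  fe_bracket : forall i j x,
    fe i (fe j x) - fe j (fe i x) = \sum_k frame_bracket fw im i j k * fe k x;
  fe_indep : forall y : frame_index n -> A, (forall x, \sum_k y k * fe k x = 0) ->
    forall k, y k = 0 }.

Section Derivations.
Variables (A : comPzRingType) (d : A -> A).
Hypotheses (dD : forall x y, d (x + y) = d x + d y).

Lemma der0 : d 0 = 0.
Proof. by apply: (addrI (d 0)); rewrite -dD !addr0. Qed.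

Lemma derN x : d (- x) = - d x.
Proof. by apply/eqP; rewrite -addr_eq0 -dD addNr der0. Qed.

Lemma derB x y : d (x - y) = d x - d y.
Proof. by rewrite dD derN. Qed.

Lemma der_sum (I : Type) (l : seq I) (F : I -> A) : d (\sum_(i <- l) F i) = \sum_(i <- l) d (F i).
Proof. exact: (big_morph d dD der0). Qed.

Lemma derMn x k : d (x *+ k) = d x *+ k.
Proof. by elim: k => [|k IH]; rewrite ?mulr0n ?der0 // !mulrS dD IH. Qed.

End Derivations.

Section SwapFrame.
Variables (n : nat) (A : comPzRingType) (F : crframe n A).

Lemma frame_bracket_swap i j k :
  frame_bracket (fun i a b => - fw F (isw i) b a) (- im F) i j k =
  frame_bracket (fw F) (im F) (isw i) (isw j) (isw k).
Proof.
by case: i j k => [[a|a]|[]] [[d|d]|[]] [[b|b]|[]] //=; rewrite ?opprK ?mulNrn ?opprK // 1?addrC //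
  eq_sym.
Qed.

(** The conjugate frame, formed without a conjugation on [A]: exchanging Z_a and Z_{\bar a} turns
    omega_a^b into omega_{\bar a}^{\bar b} = - omega_b^a and i into -i. The conjugate of an identity
    about [F] is its instance at [swap F]. *)
Definition swap : crframe n A.
Proof.
refine (@CRFrame n A (fun i => fe F (isw i)) (fun i a b => - fw F (isw i) b a) (- im F) (fD F)
  (fun i => @feD _ _ F _) (fun i => @feM _ _ F _) (@fDD _ _ F) (@fDM _ _ F) _ _ _ _ _ _).
- by move=> i; rewrite (derN (@feD _ _ F _)) fe_im oppr0.
- by rewrite (derN (@fDD _ _ F)) fD_im oppr0.
- by move=> i a b; rewrite (derN (@fDD _ _ F)) fD_w oppr0.
- by move=> i x; rewrite fD_fe.
- move=> i j x; rewrite fe_bracket (reindex_inj (inv_inj (@iswK n))) /=.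
  by apply: eq_bigr => k _; rewrite frame_bracket_swap.
- move=> y h k; rewrite -(iswK k); apply: (fe_indep (c := F) (y := fun k => y (isw k))) => x.
  by rewrite -[RHS](h x) [RHS](reindex_inj (inv_inj (@iswK n))) /=; apply: eq_bigr => l _; rewrite iswK.
Defined.

End SwapFrame.

(** * Curvature and commutation of covariant derivatives *)

Section FrameCurvature.
Variables (n : nat) (A : comPzRingType) (F : crframe n A).
Local Notation e := (fe F).
Local Notation w := (fw F).
Local Notation c := (frame_bracket (fw F) (im F)).
Implicit Types (i j k l : frame_index n) (a b d : 'I_n) (s : 'I_n -> A).

Let eN i := derN (@feD _ _ F i).
Let eB i := derB (@feD _ _ F i).
Let e_sum i := @der_sum _ _ (@feD _ _ F i).

(** The coefficient of e_l in the double bracket [e_i, [e_j, e_k]]. *)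
Definition jac i j k l := e i (c j k l) + \sum_p c j k p * c i p l.

Lemma jac_sum i j k x :
  e i (e j (e k x)) - e i (e k (e j x)) - (e j (e k (e i x)) - e k (e j (e i x))) =
  \sum_l jac i j k l * e l x.
Proof.
rewrite -eB !fe_bracket e_sum; under eq_bigr do rewrite feM.
rewrite big_split -addrA -sumrB /=.
under [X in _ + X = _]eq_bigr do rewrite -mulrBr fe_bracket mulr_sumr.
rewrite exchange_big -big_split; apply: eq_bigr => l _ /=.
by rewrite /jac mulrDl mulr_suml; congr (_ + _); apply: eq_bigr => p _; rewrite mulrA.
Qed.

Lemma mulr3Dl (x y z t : A) : (x + y + z) * t = x * t + y * t + z * t.
Proof. by ring. Qed.

(** The cyclic sum of double commutators of operators vanishes identically, and [fe_indep] passes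
    from the operator to its coefficients. The vanishing and the symmetry of curvature components
    below come from here. *)
Lemma jacobi i j k l : jac i j k l + jac j k i l + jac k i j l = 0.
Proof.
apply: (fe_indep (c := F) (y := fun l => jac i j k l + jac j k i l + jac k i j l)) => x.
under eq_bigr do rewrite (mulr3Dl (jac _ _ _ _)).
by rewrite !big_split /= -!jac_sum; ring.
Qed.

(** The value on (e_i, e_j) of the curvature form d omega_a^b - omega_a^d /\ omega_d^b, for
    arguments of every type. *)
Definition Rm i j a b : A :=
  e i (w j a b) - e j (w i a b) - \sum_k c i j k * w k a b
  - \sum_d (w i a d * w j d b - w j a d * w i d b).

Definition cov i s a : A := e i (s a) - \sum_b w i a b * s b.

Lemma ricci_identity i j s a :
  cov i (cov j s) a - cov j (cov i s) a - \sum_k c i j k * cov k s a = - \sum_b Rm i j a b * s b.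
Proof.
have expand i' j' : cov i' (cov j' s) a = e i' (e j' (s a)) - \sum_b e i' (w j' a b) * s b
    - \sum_b w j' a b * e i' (s b) - \sum_b w i' a b * e j' (s b)
    + \sum_b (\sum_d w i' a d * w j' d b) * s b.
  rewrite /cov eB e_sum.
  have -> : \sum_b e i' (w j' a b * s b) =
      \sum_b e i' (w j' a b) * s b + \sum_b w j' a b * e i' (s b).
    by rewrite -big_split; apply: eq_bigr => b _; rewrite feM.
  have -> : \sum_b w i' a b * (e j' (s b) - \sum_d w j' b d * s d) =
      \sum_b w i' a b * e j' (s b) - \sum_b (\sum_d w i' a d * w j' d b) * s b.
    under eq_bigr do rewrite mulrBr mulr_sumr.
    rewrite sumrB exchange_big /=; congr (_ - _); apply: eq_bigr => b _.
    by rewrite mulr_suml; apply: eq_bigr => d _; rewrite mulrA.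
  by ring.
rewrite !expand /Rm.
have -> : \sum_k c i j k * cov k s a =
    (e i (e j (s a)) - e j (e i (s a))) - \sum_b (\sum_k c i j k * w k a b) * s b.
  rewrite fe_bracket; under eq_bigr do rewrite mulrBr mulr_sumr.
  rewrite sumrB exchange_big /=; congr (_ - _); apply: eq_bigr => b _.
  by rewrite mulr_suml; apply: eq_bigr => k _; rewrite mulrA.
under [X in _ = - X]eq_bigr do rewrite sumrB !mulrBl.
rewrite !sumrB; ring.
Qed.

Lemma sumM0 (I : finType) (f : I -> A) : \sum_i f i * 0 = 0.
Proof. by rewrite big1 // => i _; rewrite mulr0. Qed.

Lemma sum0M (I : finType) (f : I -> A) : \sum_i 0 * f i = 0.
Proof. by rewrite big1 // => i _; rewrite mul0r. Qed.

Lemma sumBM (I : finType) (f g h : I -> A) :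
  \sum_i (f i - g i) * h i = \sum_i f i * h i - \sum_i g i * h i.
Proof. by rewrite -sumrB; apply: eq_bigr => i _; rewrite mulrBl. Qed.

Lemma sumMB (I : finType) (f g h : I -> A) :
  \sum_i h i * (f i - g i) = \sum_i h i * f i - \sum_i h i * g i.
Proof. by rewrite -sumrB; apply: eq_bigr => i _; rewrite mulrBr. Qed.

Lemma sumNM (I : finType) (f h : I -> A) : \sum_i - f i * h i = - \sum_i f i * h i.
Proof. by rewrite -sumrN; apply: eq_bigr => i _; rewrite mulNr. Qed.

Lemma sumMN (I : finType) (f h : I -> A) : \sum_i f i * - h i = - \sum_i f i * h i.
Proof. by rewrite -sumrN; apply: eq_bigr => i _; rewrite mulrN. Qed.

Definition sumE := (sumM0, sum0M, sumBM, sumMB, sumNM, sumMN, sumrB, sumrN).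

Let e0 i := der0 (@feD _ _ F i).

(** The Z_{b'}-component of the Jacobi identity for Z_{\bar a}, Z_{\bar d}, Z_b is this curvature
    component. The next two lemmas use the triples (T, Z_b, Z_{\bar d}) and (Z_a, Z_b, Z_{\bar
    d}). *)
Lemma Rm_WW a d b b' : Rm (iW a) (iW d) b b' = 0.
Proof.
rewrite -[RHS](jacobi (iW a) (iW d) (iZ b) (iZ b')).
by rewrite /jac /Rm !sum_frame_index /= !(eN, eB, e0) !sumE; ring.
Qed.

Lemma Rm_TW d b b' : Rm (iT n) (iW d) b b' = 0.
Proof.
apply: oppr_inj; rewrite oppr0 -[RHS](jacobi (iT n) (iZ b) (iW d) (iZ b')).
by rewrite /jac /Rm !sum_frame_index /= !(eN, eB, e0) !sumE; ring.
Qed.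

Lemma Rm_ZW_sym a d b b' : Rm (iZ a) (iW d) b b' = Rm (iZ b) (iW d) a b'.
Proof.
apply: (addrI (- Rm (iZ a) (iW d) b b')); rewrite addNr.
rewrite -[LHS](jacobi (iZ a) (iZ b) (iW d) (iZ b')).
by rewrite /jac /Rm !sum_frame_index /= !(eN, eB, e0) !sumE; ring.
Qed.

Lemma frame_bracketC i j k : c j i k = - c i j k.
Proof.
by case: i j k => [[a|a]|[]] [[d|d]|[]] [[b|b]|[]] //=; rewrite ?opprB ?opprK ?oppr0.
Qed.

Lemma Rm_anti i j a b : Rm j i a b = - Rm i j a b.
Proof.
rewrite /Rm; under eq_bigr do rewrite frame_bracketC.
by rewrite !sumE; ring.
Qed.

(** By skewness omega_{\bar a}^{\bar b} = - omega_b^a: this is the connection on barred indices, and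
    [covd] is the corresponding covariant derivative. *)
Definition wd i a b := - w i b a.

Definition covd i s a : A := e i (s a) - \sum_b wd i a b * s b.

(** The derivative of a tensor with two lower indices; [x] and [y] are the connection matrices of
    the first and the second index, [w i] for an unbarred and [wd i] for a barred one. *)
Definition cov2 i (x y : 'I_n -> 'I_n -> A) (t : 'I_n -> 'I_n -> A) a b : A :=
  e i (t a b) - \sum_d x a d * t d b - \sum_d y b d * t a d.

Lemma eq_cov2 i x y x' y' t t' a b : x =2 x' -> y =2 y' -> t =2 t' ->
  cov2 i x y t a b = cov2 i x' y' t' a b.
Proof.
by move=> ex ey et; rewrite /cov2 et; congr (_ - _ - _); apply: eq_bigr => d _; rewrite ?ex ?ey et.
Qed.

Lemma cov2C i x y t a b : cov2 i x y t a b = cov2 i y x (fun a b => t b a) b a.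
Proof. by rewrite /cov2 addrAC. Qed.

(** With [w] on one index and [wd] on the other, the contraction is by the parallel metric: the
    connection terms cancel in pairs. *)
Lemma cov2_trace i t : \sum_a cov2 i (w i) (wd i) t a a = e i (\sum_a t a a).
Proof.
rewrite /cov2 /wd 2!sumrB e_sum [X in _ - X - _]exchange_big /= -addrA -opprD.
rewrite -big_split /= [X in _ - X]big1 ?subr0 // => a _.
by rewrite -big_split /= big1 // => d _; rewrite mulNr addrN.
Qed.

Lemma cov_pair i s r : e i (\sum_a s a * r a) = \sum_a (cov i s a * r a + s a * covd i r a).
Proof.
rewrite e_sum; under eq_bigr do rewrite feM.
under [RHS]eq_bigr do rewrite mulrBl mulrBr addrACA.
rewrite [RHS]big_split /= -[LHS]addr0; congr (_ + _); rewrite big_split /= !sumrN.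
under eq_bigr do rewrite mulr_suml.
under [X in _ - X]eq_bigr do rewrite mulr_sumr.
rewrite [X in _ - X]exchange_big /= -opprD -big_split /= big1 ?oppr0 // => a _.
by rewrite -big_split /= big1 // => b _; rewrite /wd; ring.
Qed.

Definition grad (x : A) : 'I_n -> A := fun a => e (iZ a) x.
(** [hessZ x a b] is x_{ab} and [hessW x a b] is x_{a \bar b}: the second index is the one
    differentiated last. *)
Definition hessZ (x : A) a b : A := cov (iZ b) (grad x) a.
Definition hessW (x : A) a b : A := cov (iW b) (grad x) a.

Lemma hessZ_sym x a b : hessZ x a b = hessZ x b a.
Proof.
apply/eqP; rewrite /hessZ /cov /grad -subr_eq0; apply/eqP.
transitivity (e (iZ b) (e (iZ a) x) - e (iZ a) (e (iZ b) x) -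
  (\sum_d w (iZ b) a d * e (iZ d) x - \sum_d w (iZ a) b d * e (iZ d) x)); first by ring.
by rewrite fe_bracket sum_frame_index /= !sumE; ring.
Qed.

(** Without torsion [T, Z_a] has no barred component, so x_{a0} = x_{0a}. With [Rm_TW] this lets T
    commute with the sub-Laplacian. *)
Lemma cov_T x a : cov (iT n) (grad x) a = e (iZ a) (e (iT n) x).
Proof.
rewrite /cov /grad; have := fe_bracket F (iT n) (iZ a) x.
rewrite sum_frame_index /= !sumE => h.
transitivity ((e (iT n) (e (iZ a) x) - e (iZ a) (e (iT n) x)) + e (iZ a) (e (iT n) x)
  - \sum_b w (iT n) a b * e (iZ b) x); first by ring.
by rewrite h; ring.
Qed.

(** Metric compatibility expresses the Hessian of the scalar s_d r_d, with [s] unbarred and [r]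
    barred, through covariant derivatives alone. It is used with [s] and [r] the two halves of the
    gradient. *)
Lemma mm_pair s r a b : hessW (\sum_d s d * r d) a b =
  \sum_d (cov2 (iW b) (w (iW b)) (w (iW b)) (fun d a => cov (iZ a) s d) d a * r d
   + cov (iZ a) s d * covd (iW b) r d + cov (iW b) s d * covd (iZ a) r d
   + s d * cov2 (iW b) (wd (iW b)) (w (iW b)) (fun d a => covd (iZ a) r d) d a).
Proof.
have e1 : e (iW b) (e (iZ a) (\sum_d s d * r d)) = \sum_d
    (cov (iW b) (cov (iZ a) s) d * r d + cov (iZ a) s d * covd (iW b) r d +
     (cov (iW b) s d * covd (iZ a) r d + s d * covd (iW b) (covd (iZ a) r) d)).
  by rewrite cov_pair big_split /= feD !cov_pair -big_split.
rewrite /hessW {1}/cov /grad e1; under [X in _ - X]eq_bigr do rewrite cov_pair mulr_sumr.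
rewrite exchange_big -sumrB; apply: eq_bigr => d _ /=.
have -> : \sum_i w (iW b) a i * (cov (iZ i) s d * r d + s d * covd (iZ i) r d) =
    (\sum_i w (iW b) a i * cov (iZ i) s d) * r d + s d * (\sum_i w (iW b) a i * covd (iZ i) r d).
  rewrite mulr_suml mulr_sumr -big_split; apply: eq_bigr => i _ /=; ring.
have -> : cov2 (iW b) (w (iW b)) (w (iW b)) (fun d a => cov (iZ a) s d) d a =
    cov (iW b) (cov (iZ a) s) d - \sum_i w (iW b) a i * cov (iZ i) s d by [].
have -> : cov2 (iW b) (wd (iW b)) (w (iW b)) (fun d a => covd (iZ a) r d) d a =
    covd (iW b) (covd (iZ a) r) d - \sum_i w (iW b) a i * covd (iZ i) r d by [].
ring.
Qed.

(** Barred derivatives commute without remainder: [Rm_WW] vanishes and brackets of barred fields are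
    barred. *)
Lemma cov2_hessW_sym x a b d : cov2 (iW d) (w (iW d)) (wd (iW d)) (hessW x) a b =
  cov2 (iW b) (w (iW b)) (wd (iW b)) (hessW x) a d.
Proof.
have e1 (i j : 'I_n) : cov2 (iW i) (w (iW i)) (wd (iW i)) (hessW x) a j =
    cov (iW i) (cov (iW j) (grad x)) a - \sum_k wd (iW i) j k * cov (iW k) (grad x) a by [].
have := ricci_identity (iW d) (iW b) (grad x) a.
rewrite sum_frame_index /= [in RHS]big1 ?oppr0; last by move=> k _; rewrite Rm_WW mul0r.
rewrite !e1 /wd !sumE => h; apply/eqP; rewrite -subr_eq0 -[X in _ == X]h; apply/eqP; ring.
Qed.

(** The Ricci identity for Z_{\bar d} and Z_a acting on x_b. Besides curvature, the T-component of
    their bracket contributes i delta_{ad} x_{b0}, rewritten by [cov_T]. *)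
Lemma cov2_hessZ x a d b : cov2 (iW d) (w (iW d)) (w (iW d)) (hessZ x) b a =
  cov2 (iZ a) (w (iZ a)) (wd (iZ a)) (hessW x) b d
  + \sum_k Rm (iZ a) (iW d) b k * grad x k + im F *+ (a == d) * e (iZ b) (e (iT n) x).
Proof.
have -> : cov2 (iW d) (w (iW d)) (w (iW d)) (hessZ x) b a =
  cov (iW d) (cov (iZ a) (grad x)) b - \sum_k w (iW d) a k * cov (iZ k) (grad x) b by [].
have -> : cov2 (iZ a) (w (iZ a)) (wd (iZ a)) (hessW x) b d =
  cov (iZ a) (cov (iW d) (grad x)) b - \sum_k wd (iZ a) d k * cov (iW k) (grad x) b by [].
have := ricci_identity (iW d) (iZ a) (grad x) b.
rewrite sum_frame_index /= cov_T; under [in RHS]eq_bigr do rewrite Rm_anti.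
rewrite /wd !sumE opprK => <-; ring.
Qed.

Lemma sum_delta (y : 'I_n -> A) (z : A) a : \sum_b z *+ (a == b) * y b = z * y a.
Proof.
rewrite (bigD1 a) //= eqxx mulr1n big1 ?addr0 // => b.
by rewrite eq_sym => /negbTE ->; rewrite mulr0n mul0r.
Qed.

(** By symmetry x_{ab \bar b} = x_{ba \bar b}; exchanging the last two indices then leaves the trace
    x_{b \bar b} differentiated along Z_a. *)
Lemma div_hessZ x a : \sum_b cov2 (iW b) (w (iW b)) (w (iW b)) (hessZ x) a b =
  e (iZ a) (\sum_b hessW x b b) + \sum_b \sum_k Rm (iZ a) (iW b) b k * grad x k
  + im F * e (iZ a) (e (iT n) x).
Proof.
rewrite -(cov2_trace (iZ a) (hessW x)) -(sum_delta (fun b => e (iZ b) (e (iT n) x))).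
rewrite -!big_split; apply: eq_bigr => b _ /=; rewrite cov2C.
rewrite -(cov2_hessZ x a b b); apply: eq_cov2 => // i j; exact: hessZ_sym.
Qed.

Lemma cov2_delta i y a b : e i (im F) = 0 ->
  cov2 i (w i) (wd i) (fun a b => im F *+ (a == b) * y) a b = im F *+ (a == b) * e i y.
Proof.
move=> h; rewrite /cov2 feM (derMn (@feD _ _ F i)) h mul0rn mul0r add0r.
under eq_bigr do rewrite mulrC -mulrA eq_sym.
rewrite sum_delta; under eq_bigr do rewrite mulrC -mulrA.
by rewrite sum_delta /wd; ring.
Qed.

Lemma cov2D i x y t t' a b :
  cov2 i x y (fun a b => t a b + t' a b) a b = cov2 i x y t a b + cov2 i x y t' a b.
Proof.
rewrite /cov2 feD; under eq_bigr do rewrite mulrDr.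
under [X in _ - _ - X]eq_bigr do rewrite mulrDr.
by rewrite !big_split /=; ring.
Qed.

End FrameCurvature.

Section Bochner.
Variables (n : nat) (A : comPzRingType).
Implicit Types (F : crframe n A) (x : A) (a b : 'I_n).

(** The term [hessW (swap F) x b a] is x_{\bar b a}; the difference of the two Hessians comes from
    the T-component of [Z_{\bar b}, Z_a]. *)
Lemma hessW_swap F x a b :
  hessW F x a b = hessW (swap F) x b a + im F *+ (a == b) * fe F (iT n) x.
Proof.
rewrite /hessW /cov /grad /= !sumE; apply/eqP; rewrite -subr_eq0; apply/eqP.
have := fe_bracket F (iW b) (iZ a) x; rewrite sum_frame_index /= => h.
transitivity ((fe F (iW b) (fe F (iZ a) x) - fe F (iZ a) (fe F (iW b) x)) -
  (\sum_b0 fw F (iW b) a b0 * fe F (iZ b0) x + \sum_b0 fw F (iZ a) b0 b * fe F (iW b0) x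
   + im F *+ (a == b) * fe F (iT n) x)); first by ring.
by rewrite h subrr.
Qed.

Lemma hessW_swap2 F x a b : hessW (swap (swap F)) x a b = hessW F x a b.
Proof. by rewrite /hessW /cov /grad /=; congr (_ - _); apply: eq_bigr => d _; rewrite opprK. Qed.

(** After x_{a \bar b} is replaced by x_{\bar b a} plus a T-term, the conjugate of [cov2_hessW_sym]
    exchanges the two unbarred derivatives and a trace appears; no curvature arises. *)
Lemma div_hessW F x a : \sum_b cov2 F (iZ b) (fw F (iZ b)) (wd F (iZ b)) (hessW F x) a b =
  fe F (iZ a) (\sum_b hessW (swap F) x b b) + im F * fe F (iZ a) (fe F (iT n) x).
Proof.
have -> : fe F (iZ a) (\sum_b hessW (swap F) x b b) =
    fe (swap F) (iW a) (\sum_b hessW (swap F) x b b) by [].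
rewrite -(cov2_trace (swap F)) -(sum_delta (fun b => fe F (iZ b) (fe F (iT n) x))) -big_split.
apply: eq_bigr => b _ /=; rewrite cov2_hessW_sym.
rewrite (@eq_cov2 _ _ F _ _ _ (fw F (iZ b)) (wd F (iZ b)) _
  (fun a b => hessW (swap F) x b a + im F *+ (a == b) * fe F (iT n) x)) //; last first.
  by move=> i j; exact: hessW_swap.
rewrite cov2D cov2_delta ?fe_im // [cov2 _ _ _ _ _ _ _ in LHS]cov2C; congr (_ + _).
by apply: (@eq_cov2 _ _ F) => // i j; rewrite /wd /= opprK.
Qed.

Definition grad_sq F x : A := \sum_a grad F x a * grad (swap F) x a.

Definition ric F a b : A := \sum_d Rm F (iZ a) (iW b) d d.

Definition hess_sq F x : A :=
  \sum_a \sum_b (hessZ F x a b * hessZ (swap F) x a b + hessW F x a b * hessW (swap F) x a b).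

Definition lap F x : A := \sum_a (hessW F x a a + hessW (swap F) x a a).

Lemma Rm_swap F a b d k : Rm (swap F) (iZ a) (iW b) d k = Rm F (iZ b) (iW a) k d.
Proof.
rewrite /Rm !sum_frame_index /= !(derN (@feD _ _ F _)) !sumE.
have sumC (f g : 'I_n -> A) : \sum_i f i * g i = \sum_i g i * f i.
  by apply: eq_bigr => i _; rewrite mulrC.
rewrite (sumC (fun i => fw F (iW a) i d)) (sumC (fun i => fw F (iZ b) i d)).
by rewrite mulNrn [b == a]eq_sym; ring.
Qed.

(** [Rm_ZW_sym] exchanges two unbarred indices; in the conjugate frame it exchanges two barred ones,
    and the contraction met in [div_hessZ] becomes the trace defining the Ricci tensor. *)
Lemma ric_contract F a k : \sum_b Rm F (iZ a) (iW b) b k = ric F a k.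
Proof.
by apply: eq_bigr => b _; rewrite -Rm_swap Rm_ZW_sym Rm_swap.
Qed.

Lemma ric_swap F a b : ric (swap F) a b = ric F b a.
Proof. by apply: eq_bigr => d _; rewrite Rm_swap. Qed.

(** [mm_pair] for the two halves of the gradient, traced. The third derivatives are those of
    [div_hessZ] and of [div_hessW] in the conjugate frame; only the first carries curvature. *)
Lemma bochner_half F x :
  \sum_b hessW F (grad_sq F x) b b =
  hess_sq F x + \sum_a \sum_b ric F a b * grad (swap F) x a * grad F x b
  + (\sum_a (grad (swap F) x a * fe F (iZ a) (\sum_b hessW F x b b) +
             grad F x a * fe F (iW a) (\sum_b hessW F x b b)))
  + im F * \sum_a (grad (swap F) x a * fe F (iZ a) (fe F (iT n) x)
                   - grad F x a * fe F (iW a) (fe F (iT n) x)).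
Proof.
set LW := \sum_b hessW F x b b.
rewrite /grad_sq /hess_sq; under eq_bigr do rewrite mm_pair.
rewrite exchange_big mulr_sumr -!big_split; apply: eq_bigr => a _ /=; rewrite !big_split /=.
rewrite -mulr_suml -mulr_sumr.
have -> : \sum_b cov2 F (iW b) (fw F (iW b)) (fw F (iW b))
   (fun d a => cov F (iZ a) (grad F x) d) a b = \sum_b cov2 F (iW b) (fw F (iW b)) (fw F (iW b))
   (hessZ F x) a b by [].
rewrite div_hessZ -/LW.
have -> : \sum_b cov2 F (iW b) (wd F (iW b)) (fw F (iW b))
   (fun d a => covd F (iZ a) (grad (swap F) x) d) a b =
   fe F (iW a) LW - im F * fe F (iW a) (fe F (iT n) x).
  have := div_hessW (swap F) x a; rewrite /= mulNr.
  under [in RHS]eq_bigr do rewrite hessW_swap2.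
  move=> <-; apply: eq_bigr => b _; apply: (@eq_cov2 _ _ F) => // i j.
  by rewrite /wd /= opprK.
have -> : \sum_b \sum_k Rm F (iZ a) (iW b) b k * grad F x k = \sum_k ric F a k * grad F x k.
  by rewrite exchange_big; apply: eq_bigr => k _; rewrite -mulr_suml ric_contract.
have -> : \sum_b ric F a b * grad (swap F) x a * grad F x b =
    (\sum_b ric F a b * grad F x b) * grad (swap F) x a.
  by rewrite mulr_suml; apply: eq_bigr => b _; rewrite mulrAC.
have -> : \sum_b hessZ F x a b * hessZ (swap F) x a b =
  \sum_b cov F (iZ b) (grad F x) a * covd F (iW b) (grad (swap F) x) a by [].
have -> : \sum_b hessW F x a b * hessW (swap F) x a b =
  \sum_b cov F (iW b) (grad F x) a * covd F (iZ b) (grad (swap F) x) a by [].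
rewrite -[fe F (iW a) x]/(grad (swap F) x a).
ring.
Qed.

End Bochner.

(** * Evolution equations for the linearized heat operator *)

Section Evolution.
Variables (n : nat) (A : comPzRingType) (F : crframe n A).
Implicit Types (x y : A) (a b : 'I_n).
Local Notation e := (fe F).
Local Notation D := (fD F).

Definition gpair x y : A :=
  \sum_a (grad F x a * grad (swap F) y a + grad (swap F) x a * grad F y a).

Lemma gpairC x y : gpair x y = gpair y x.
Proof. by apply: eq_bigr => a _; ring. Qed.

Lemma gpair_diag x : gpair x x = 2 * grad_sq F x.
Proof. by rewrite mulr_sumr; apply: eq_bigr => a _; ring. Qed.

Lemma gpairD x y z : gpair x (y + z) = gpair x y + gpair x z.
Proof.
rewrite -big_split; apply: eq_bigr => a _ /=; rewrite /grad /= !feD; ring.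
Qed.

Lemma gpairM x y z : gpair x (y * z) = y * gpair x z + z * gpair x y.
Proof.
rewrite !mulr_sumr -big_split; apply: eq_bigr => a _ /=; rewrite /grad /= !feM; ring.
Qed.

Lemma hessWD (G : crframe n A) x y a b : hessW G (x + y) a b = hessW G x a b + hessW G y a b.
Proof.
rewrite /hessW /cov /grad !feD; under eq_bigr do rewrite feD mulrDr.
by rewrite big_split /=; ring.
Qed.

Lemma hessWM (G : crframe n A) x y a b : hessW G (x * y) a b = x * hessW G y a b + y * hessW G x a b
  + (fe G (iW b) x * grad G y a + grad G x a * fe G (iW b) y).
Proof.
rewrite /hessW /cov /grad !(feM, feD).
have -> : \sum_d fw G (iW b) a d * fe G (iZ d) (x * y) =
    y * (\sum_d fw G (iW b) a d * fe G (iZ d) x) + x * (\sum_d fw G (iW b) a d * fe G (iZ d) y).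
  by rewrite !mulr_sumr -big_split; apply: eq_bigr => d _ /=; rewrite feM; ring.
ring.
Qed.

Lemma lapD x y : lap F (x + y) = lap F x + lap F y.
Proof. by rewrite -big_split; apply: eq_bigr => a _ /=; rewrite !hessWD; ring. Qed.

Lemma lapM x y : lap F (x * y) = x * lap F y + y * lap F x + 2 * gpair x y.
Proof.
rewrite !mulr_sumr -!big_split; apply: eq_bigr => a _ /=.
by rewrite !hessWM -[fe (swap F) _ _]/(e _ _) /grad /=; ring.
Qed.

Lemma hess_sq_swap x : hess_sq (swap F) x = hess_sq F x.
Proof.
apply: eq_bigr => a _; apply: eq_bigr => b _; rewrite hessW_swap2 [hessW _ _ _ _ * _]mulrC.
congr (_ + _); rewrite mulrC; congr (_ * _).
by rewrite /hessZ /cov /grad /=; congr (_ - _); apply: eq_bigr => d _; rewrite opprK.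
Qed.

Definition ric_form x : A := \sum_a \sum_b ric F a b * grad (swap F) x a * grad F x b.

(** For real [x] this is the multiple of <J grad_b x, grad_b (T x)> produced by the T-components of
    the brackets. It has no sign. *)
Definition torsion_term x : A :=
  im F * \sum_a (grad (swap F) x a * grad F (e (iT n) x) a - grad F x a * grad (swap F) (e (iT n) x) a).

(** The half formula plus its instance at [swap F], where both [im] and the difference of gradients
    change sign, so that the cross terms add up. *)
Lemma bochner x : lap F (grad_sq F x) =
  2 * hess_sq F x + 2 * ric_form x + gpair x (lap F x) + 2 * torsion_term x.
Proof.
have gs : grad_sq (swap F) x = grad_sq F x by apply: eq_bigr => a _; rewrite mulrC.
have h1 := bochner_half F x; have := bochner_half (swap F) x.
rewrite gs hess_sq_swap => h2.
rewrite /lap big_split /= h1 h2.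
have -> : \sum_a \sum_b ric (swap F) a b * grad (swap (swap F)) x a * grad (swap F) x b = ric_form x.
  rewrite exchange_big; apply: eq_bigr => b _; apply: eq_bigr => a _ /=.
  by rewrite ric_swap mulrAC.
have -> : \sum_a (grad (swap (swap F)) x a * fe (swap F) (iZ a) (e (iT n) x) -
    grad (swap F) x a * fe (swap F) (iW a) (e (iT n) x)) =
  - \sum_a (grad (swap F) x a * e (iZ a) (e (iT n) x) - grad F x a * e (iW a) (e (iT n) x)).
  by rewrite -sumrN; apply: eq_bigr => a _; rewrite /grad /=; ring.
have -> : gpair x (\sum_a (hessW F x a a + hessW (swap F) x a a)) =
  \sum_a (grad (swap F) x a * e (iZ a) (\sum_b hessW F x b b) +
     grad F x a * e (iW a) (\sum_b hessW F x b b)) +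
  \sum_a (grad (swap (swap F)) x a * fe (swap F) (iZ a) (\sum_b hessW (swap F) x b b) +
     grad (swap F) x a * fe (swap F) (iW a) (\sum_b hessW (swap F) x b b)).
  rewrite big_split /= gpairD; congr (_ + _); apply: eq_bigr => a _; rewrite /grad /=; ring.
rewrite -[im (swap F)]/(- im F) mulrNN /torsion_term -[\sum_a \sum_b _]/(ric_form x); ring.
Qed.

(** T passes the first derivative by [cov_T] and the second because [Rm_TW] vanishes; the trace then
    commutes with T by [cov2_trace]. *)
Lemma hessW_T (G : crframe n A) x :
  \sum_a hessW G (fe G (iT n) x) a a = fe G (iT n) (\sum_a hessW G x a a).
Proof.
rewrite -(cov2_trace G); apply: eq_bigr => a _.
have -> : hessW G (fe G (iT n) x) a a = cov G (iW a) (cov G (iT n) (grad G x)) a.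
  by congr (cov G (iW a) _ a); apply/funext => b; rewrite cov_T.
have := ricci_identity G (iT n) (iW a) (grad G x) a.
rewrite sum_frame_index /= [in RHS]big1 ?oppr0; last by move=> k _; rewrite Rm_TW mul0r.
have -> : cov2 G (iT n) (fw G (iT n)) (wd G (iT n)) (hessW G x) a a =
  cov G (iT n) (cov G (iW a) (grad G x)) a
   - \sum_k wd G (iT n) a k * cov G (iW k) (grad G x) a by [].
rewrite /wd !sumE => h; apply/eqP; rewrite eq_sym -subr_eq0 -[X in _ == X]h; apply/eqP; ring.
Qed.

Lemma lap_T x : lap F (e (iT n) x) = e (iT n) (lap F x).
Proof.
have e1 y : lap F y = \sum_a hessW F y a a + \sum_a hessW (swap F) y a a by rewrite /lap big_split.
rewrite !e1 feD hessW_T; congr (_ + _).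
exact: (hessW_T (swap F) x).
Qed.

Lemma fD_sum (I : Type) (l : seq I) (f : I -> A) : D (\sum_(i <- l) f i) = \sum_(i <- l) D (f i).
Proof. exact: (der_sum (@fDD _ _ F)). Qed.

Lemma lap_D x : lap F (D x) = D (lap F x).
Proof.
have h (G : crframe n A) a : hessW G (fD G x) a a = fD G (hessW G x a a).
  rewrite /hessW /cov /grad (derB (@fDD _ _ G)) !fD_fe (der_sum (@fDD _ _ G)); congr (_ - _).
  by apply: eq_bigr => b _; rewrite fDM fD_w mul0r add0r fD_fe.
rewrite /lap fD_sum; apply: eq_bigr => a _; rewrite fDD h; congr (_ + _).
by have := h (swap F) a.
Qed.

Lemma gpair_D x : D (gpair x x) = 2 * gpair x (D x).
Proof.
rewrite fD_sum mulr_sumr; apply: eq_bigr => a _; rewrite fDD !fDM /grad /= !fD_fe; ring.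
Qed.

Lemma gpair_T x : e (iT n) (gpair x x) = 2 * gpair x (e (iT n) x).
Proof.
have h : e (iT n) (grad_sq F x) = gpair x (e (iT n) x).
  rewrite /grad_sq cov_pair; apply: eq_bigr => a _; rewrite cov_T.
  rewrite -[covd F (iT n) _ a]/(cov (swap F) (iT n) (grad (swap F) x) a) cov_T.
  by rewrite /grad /=; ring.
have -> : gpair x x = grad_sq F x + grad_sq F x by rewrite gpair_diag; ring.
by rewrite feD h; ring.
Qed.

(* Linearization of the equation [D f = lap f + gpair f f] at a solution f. *)
Definition heat_op f x : A := lap F x + 2 * gpair f x - D x.

Lemma heat_op_scale f x y : (forall i, e i y = 0) -> heat_op f (y * x) = y * heat_op f x - D y * x.
Proof.
move=> hy; have gy z : gpair z y = 0.
  by rewrite /gpair big1 // => a _; rewrite /grad /= !hy; ring.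
have ly : lap F y = 0.
  rewrite /lap big1 // => a _; rewrite /hessW /cov /grad /= !hy !(der0 (@feD _ _ F _)).
  by rewrite !big1 ?subr0 ?addr0 // => i _; rewrite hy mulr0.
by rewrite /heat_op lapM gpairM (gpairC y) gy ly gy fDM; ring.
Qed.

Lemma heat_opD f x y : heat_op f (x + y) = heat_op f x + heat_op f y.
Proof. by rewrite /heat_op lapD gpairD fDD; ring. Qed.

Lemma heat_op_sq f x : heat_op f (x * x) = 2 * x * heat_op f x + 2 * gpair x x.
Proof. by rewrite /heat_op lapM gpairM fDM; ring. Qed.

Variable f : A.
Hypothesis heat : D f = lap F f + gpair f f.

Lemma heat_op_D : heat_op f (D f) = 0.
Proof. by rewrite /heat_op lap_D [in D (D f)]heat fDD gpair_D; ring. Qed.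

Lemma heat_op_T : heat_op f (e (iT n) f) = 0.
Proof. by rewrite /heat_op fD_fe heat feD lap_T gpair_T; ring. Qed.

Lemma heat_op_gradient :
  heat_op f (gpair f f) = 4 * hess_sq F f + 4 * ric_form f + 4 * torsion_term f.
Proof.
rewrite /heat_op gpair_D heat gpairD.
have -> : lap F (gpair f f) = lap F (grad_sq F f) + lap F (grad_sq F f).
  by rewrite -lapD gpair_diag; congr (lap F _); ring.
by rewrite bochner; ring.
Qed.

(** Here [tau] stands for t - eps, and [kappa] for the weight n/3 of (T f)^2. Since f_t and T f
    solve the linearized equation, only the gradient terms and the derivatives of the powers of
    [tau] survive. *)
Lemma evolution (tau delta kappa : A) :
  (forall i, e i tau = 0) -> (forall i, e i delta = 0) -> (forall i, e i kappa = 0) ->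
  D tau = 1 -> D delta = 0 -> D kappa = 0 ->
  heat_op f (tau * gpair f f + - (delta * tau) * D f
     + kappa * (tau * tau) * (e (iT n) f * e (iT n) f)) =
  tau * (4 * hess_sq F f + 4 * ric_form f + 4 * torsion_term f)
  + 2 * kappa * (tau * tau) * gpair (e (iT n) f) (e (iT n) f)
  - gpair f f + delta * D f - 2 * kappa * tau * (e (iT n) f * e (iT n) f).
Proof.
move=> et ed ek Dt Dd Dk.
have edt i : e i (- (delta * tau)) = 0 by rewrite (derN (@feD _ _ F i)) feM et ed; ring.
have ekt i : e i (kappa * (tau * tau)) = 0 by rewrite !feM et ek; ring.
rewrite !heat_opD (heat_op_scale f (gpair f f) et) (heat_op_scale f (D f) edt).
rewrite (heat_op_scale f _ ekt).
rewrite (derN (@fDD _ _ F)) !fDM Dt Dd Dk heat_op_gradient heat_op_sq heat_op_T heat_op_D; ring.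
Qed.

End Evolution.

(** * Real inequalities at a maximum *)

Section PointwiseEstimate.
Variable R : realType.

(** Nonnegativity of the sum of squared deviations from the mean. *)
Lemma sum_sqr_ge (n : nat) (mu : 'I_n -> R) : (0 < n)%N ->
  (\sum_a mu a) ^+ 2 / n%:R <= \sum_a mu a ^+ 2.
Proof.
move=> n0; have nR : (0 : R) < n%:R by rewrite ltr0n.
set S := \sum_a mu a; pose c := S / n%:R.
have : 0 <= \sum_a (mu a - c) ^+ 2 by apply: sumr_ge0 => a _; apply: sqr_ge0.
have -> : \sum_a (mu a - c) ^+ 2 = \sum_a mu a ^+ 2 - 2 * c * S + n%:R * c ^+ 2.
  rewrite mulr_sumr -sumrB.
  have -> : n%:R * c ^+ 2 = \sum_(a < n) c ^+ 2 by rewrite sumr_const card_ord mulr_natl.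
  by rewrite -big_split; apply: eq_bigr => a _ /=; ring.
have -> : 2 * c * S = 2 * (S ^+ 2 / n%:R) by rewrite /c; field; rewrite gt_eqF.
have -> : n%:R * c ^+ 2 = S ^+ 2 / n%:R by rewrite /c; field; rewrite gt_eqF.
by move=> h; lra.
Qed.

(** The parabola X^2 / N lies above its tangent 2X - N at X = N. After this replacement the terms in
    [S] cancel and Y <= N - (2 (d - 1) - 6/n) G remains; d > 7 makes the bracket positive for every
    n >= 1. *)
Lemma final_estimate (N Y S G d n : R) : 0 < n -> 7 < d -> N = n * d ^+ 2 -> 0 <= G ->
  ((d - 1) * G + Y - S) ^+ 2 / N + 2 * S - 6 * G / n - Y <= 0 -> 1 <= n -> Y <= N.
Proof.
move=> n0 d7 eN G0 h n1; have N0 : 0 < N by rewrite eN mulr_gt0 ?exprn_gt0 //; lra.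
set X := (d - 1) * G + Y - S in h.
have hX : 2 * X - N <= X ^+ 2 / N.
  rewrite ler_pdivlMr // -subr_ge0.
  have -> : X ^+ 2 - (2 * X - N) * N = (X - N) ^+ 2 by ring.
  exact: sqr_ge0.
have hG : 6 * G / n <= 6 * G by rewrite ler_pdivrMr // ler_peMr //; lra.
have hdG : 6 * G <= (d - 1) * G by rewrite ler_wpM2r //; lra.
move: (X ^+ 2 / N) h hX => Q h; rewrite /X; move: ((d - 1) * G) (6 * G / n) hG hdG h => P P' *; lra.
Qed.

(** At the maximum, x + i y is f_a, p + i q is (T f)_a, [mu] the real part of f_{a \bar a}, and
    [f0], [L], [k], [g] are T f, Delta_b f, |grad_b f|^2, f_t. For a weight c the multiples of t^2
    f0^2 are n - 2c from the hypothesis, c from eliminating f_t, and -2c from the tangent bound in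
    [final_estimate]; their sum vanishes at c = n/3. *)
Lemma max_estimate (n : nat) (t d f0 L k g hs ric0 : R) (x y p q mu : 'I_n -> R) :
  (0 < n)%N -> 7 < d -> 0 < t -> k = 2 * \sum_a (x a ^+ 2 + y a ^+ 2) -> L = 2 * \sum_a mu a ->
  g = L + k -> \sum_a (mu a ^+ 2 + f0 ^+ 2 / 4) <= hs -> 0 <= ric0 ->
  t * (4 * hs + 4 * ric0 + 4 * \sum_a (2 * (y a * p a - x a * q a)))
    + 2 * (n%:R / 3) * (t * t) * (2 * \sum_a (p a ^+ 2 + q a ^+ 2))
    - k + d * g - 2 * (n%:R / 3) * t * (f0 * f0) <= 0 ->
  t * k - d * t * g + n%:R / 3 * (t * t) * (f0 * f0) <= n%:R * d ^+ 2.
Proof.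
move=> n0 d7 t0 ek eL eg hhs hr h; have nR : (0 : R) < n%:R by rewrite ltr0n.
have n1 : (1 : R) <= n%:R by rewrite ler1n.
set c := n%:R / 3 in h *; have c0 : 0 < c by rewrite divr_gt0.
(* Completing the square in each component bounds the cross term by the gradient of T f, at the cost
   of 2 k / c = 6 k / n. *)
have cross : 0 <= 4 * t * \sum_a (2 * (y a * p a - x a * q a))
    + 4 * c * (t * t) * \sum_a (p a ^+ 2 + q a ^+ 2) + 2 / c * k.
  rewrite ek !mulr_sumr -!big_split; apply: sumr_ge0 => a _ /=.
  have -> : 4 * t * (2 * (y a * p a - x a * q a)) + 4 * c * (t * t) * (p a ^+ 2 + q a ^+ 2)
      + 2 / c * (2 * (x a ^+ 2 + y a ^+ 2)) =
      4 / c * ((c * t * q a - x a) ^+ 2 + (c * t * p a + y a) ^+ 2).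
    by field; rewrite gt_eqF.
  by rewrite mulr_ge0 ?divr_ge0 ?addr_ge0 ?sqr_ge0 // ltW.
(* The real parts of the diagonal entries give L^2 / n by [sum_sqr_ge]; their n imaginary parts, of
   square f0^2 / 4, give n f0^2. *)
have hess : L ^+ 2 / n%:R + n%:R * f0 ^+ 2 <= 4 * hs.
  have := sum_sqr_ge mu n0; move: hhs; rewrite big_split /= sumr_const card_ord -[_ *+ n]mulr_natl.
  have -> : L ^+ 2 / n%:R = 4 * ((\sum_a mu a) ^+ 2 / n%:R) by rewrite eL; ring.
  by move=> h1 h2; lra.
have k0 : 0 <= k.
  by rewrite ek mulr_ge0 // sumr_ge0 // => a _; rewrite addr_ge0 ?sqr_ge0.
set Y := t * k - _ + _; set N := n%:R * d ^+ 2.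
have N0 : 0 < N by rewrite mulr_gt0 ?exprn_gt0 //; lra.
apply: (@final_estimate N Y (c * (t * t) * (f0 * f0)) (t * k) d n%:R) => //.
  by rewrite mulr_ge0 // ltW.
(* As g = L + k, the combination being squared is - d t L; this is the origin of N = n d^2. *)
have eL2 : ((d - 1) * (t * k) + Y - c * (t * t) * (f0 * f0)) ^+ 2 / N = t * t * (L ^+ 2 / n%:R).
  by rewrite /Y /N eg; field; rewrite gt_eqF //=; apply/eqP; lra.
rewrite eL2.
have b1 : t * (L ^+ 2 / n%:R + n%:R * f0 ^+ 2) <= t * (4 * hs) by rewrite ler_pM2l.
have b2 : 0 <= t * (4 * ric0) by rewrite mulr_ge0 ?mulr_ge0 // ltW.
have b3 : 2 / c * k = 6 * k / n%:R by rewrite /c; field; rewrite gt_eqF.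
have main : t * (L ^+ 2 / n%:R) + n%:R * t * (f0 * f0) - 6 * k / n%:R - k + d * g
    - 2 * c * t * (f0 * f0) <= 0.
  rewrite -b3; apply: le_trans h.
  have := cross; have := b1; have := b2; rewrite !mulrDr => u1 u2 u3; lra.
have : t * (t * (L ^+ 2 / n%:R) + n%:R * t * (f0 * f0) - 6 * k / n%:R - k + d * g
    - 2 * c * t * (f0 * f0)) <= 0 by rewrite pmulr_rle0.
have nc : n%:R = 3 * c by rewrite /c; field.
apply: le_trans; rewrite le_eqVlt; apply/orP; left; apply/eqP; rewrite /Y.
have -> : n%:R * t * (f0 * f0) = 3 * c * t * (f0 * f0) by rewrite nc.
ring.
Qed.

End PointwiseEstimate.

(** * Forms and unitary frames *)

Section FormAlgebra.
Variables (R : realType) (m : nat) (M : manifold R m).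
Implicit Types (U V : set M) (X Y : vfield M) (p q : M) (u v w : tvec M) (eta : oneform M).

(** A linear functional on complexified tangent vectors at [p], given on representatives: the
    pointwise half of [form_on]. *)
Definition covector p (phi : tvec M -> R[i]) : Prop := forall (a : R[i]) u v w,
  tangent p u -> tangent p v -> tangent p w -> tveq p u (tlin a v w) -> phi u = a * phi v + phi w.

Lemma covector_form U eta p : form_on U eta -> U p -> covector p (eta p).
Proof. by move=> [h _] Up a u v w; apply: h. Qed.

Lemma tveq_tconj p u v : tveq p u v -> tveq p (tconj u) (tconj v).
Proof. by move=> h f hf; rewrite /tconj (h _ (smooth_atJ hf)). Qed.

Lemma tconj_tlin (a : R[i]) u v : tconj (tlin a u v) = tlin a^* (tconj u) (tconj v).
Proof. by apply/funext => f; rewrite /tconj /tlin cjD cjM. Qed.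

Lemma tconjK v : tconj (tconj v) = v.
Proof.
apply/funext => f; rewrite /tconj cjK; congr v; apply/funext => x; exact: cjK.
Qed.

Lemma covector_conj p phi : covector p phi -> covector p (fun v => (phi (tconj v))^*).
Proof.
move=> h a u v w tu tv tw e; have /(h a^*) -> : tveq p (tconj u) (tlin a^* (tconj v) (tconj w)).
- by move=> f hf; rewrite -tconj_tlin; exact: (tveq_tconj e hf).
- by rewrite cjD cjM cjK.
- exact: tangent_tconj.
- exact: tangent_tconj.
- exact: tangent_tconj.
Qed.

(* Since [tlin 0 v v] and [v] are equal, linearity includes compatibility with [tveq]. *)
Lemma covector_tveq p phi u v : covector p phi -> tangent p u -> tangent p v -> tveq p u v ->
  phi u = phi v.
Proof.
move=> h tu tv e; rewrite (h 0 u v v) // ?mul0r ?add0r // => f hf.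
by rewrite /tlin mul0r add0r e.
Qed.

Lemma covector0 p phi u : covector p phi -> tangent p u -> tveq p u (@tzero R m M) -> phi u = 0.
Proof.
move=> h tu e; rewrite (h (-1) u u u) // ?mulN1r ?addNr // => f hf.
by rewrite /tlin mulN1r addNr e.
Qed.

Lemma covector_tsum p phi (I : Type) (l : seq I) (a : I -> R[i]) (v : I -> tvec M) u :
  covector p phi -> tangent p u -> (forall i, tangent p (v i)) -> tveq p u (tsum l a v) ->
  phi u = \sum_(i <- l) a i * phi (v i).
Proof.
move=> h tu tv e; rewrite (covector_tveq h tu (tangent_tsum l a tv) e).
elim: l {e} => [|i l IH].
  by rewrite big_nil tsum_nil; apply: covector0 h (tangent_tzero _) _.
rewrite big_cons -IH; apply: h => //; try exact: tangent_tsum.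
by move=> f _; rewrite tsum_cons.
Qed.

Lemma sm_form U eta X : form_on U eta -> open U -> vfield_on U X ->
  smooth_on U (fun q => eta q (X q)).
Proof. by move=> [_ h] oU hX; apply: h. Qed.

Lemma dform_tveq U eta X X' Y p : form_on U eta -> open U -> U p -> vfield_on U X ->
  vfield_on U X' -> vfield_on U Y -> (forall q, U q -> tveq q (X q) (X' q)) ->
  dform eta X Y p = dform eta X' Y p.
Proof.
move=> fe oU Up hX hX' hY e; have [tX _] := hX; have [tX' _] := hX'; have [tY _] := hY.
have at_ f : smooth_on U f -> smooth_at p f by move=> ?; exists U.
rewrite /dform (e p Up); last by apply: at_; exact: (sm_form fe oU hY).
congr (_ - _ - _).
  apply: (tangent_local (tY p Up) oU Up); first by apply: at_; exact: (sm_form fe oU hX).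
  by move=> q Uq; apply: covector_tveq (covector_form fe Uq) (tX q Uq) (tX' q Uq) (e q Uq).
have [tb _] := vfield_bracket oU hX hY; have [tb' _] := vfield_bracket oU hX' hY.
apply: covector_tveq (covector_form fe Up) (tb p Up) (tb' p Up) _ => f [V [oV Vp hf]].
have oVU : open (V `&` U) by apply: openI.
rewrite /bracket (e p Up); last first.
  exists (V `&` U); split=> //; apply: (proj2 hY) => //.
  by apply: sub_sm hf => x [].
congr (_ - _); apply: (tangent_local (tY p Up) oVU) => //.
  exists (V `&` U); split=> //; apply: (proj2 hX) => //.
  by apply: sub_sm hf => x [].
by move=> q [Vq Uq]; apply: e => //; exists V.
Qed.

Lemma dformC U eta X Y p : form_on U eta -> open U -> U p -> vfield_on U X -> vfield_on U Y ->
  dform eta Y X p = - dform eta X Y p.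
Proof.
move=> fe oU Up hX hY; have [tb _] := vfield_bracket oU hX hY; have [tb' _] := vfield_bracket oU hY hX.
have e : eta p (bracket Y X p) = - eta p (bracket X Y p).
  have z := tangent_tzero p.
  rewrite (covector_form fe Up (a := -1) (v := bracket X Y p) (w := @tzero R m M)) //; try exact: tb; try exact: tb'.
    by rewrite (covector0 (covector_form fe Up) z) // addr0 mulN1r.
  by move=> f _; rewrite /tlin /tzero /bracket; ring.
by rewrite /dform e; ring.
Qed.

(** Tensoriality: the term in [Y p a] from differentiating eta(a X + X') cancels against the one
    coming from the bracket. *)
Lemma dform_tlin U eta (a : M -> R[i]) X X' Y p : form_on U eta -> open U -> U p -> smooth_on U a ->
  vfield_on U X -> vfield_on U X' -> vfield_on U Y ->
  dform eta (fun q => tlin (a q) (X q) (X' q)) Y p = a p * dform eta X Y p + dform eta X' Y p.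
Proof.
move=> fe oU Up ha hX hX' hY; have [tX sX] := hX; have [tX' sX'] := hX'; have [tY sY] := hY.
have at_ f : smooth_on U f -> smooth_at p f by move=> ?; exists U.
have sa := at_ _ ha; have sX1 := at_ _ (sm_form fe oU hX).
have sX'1 := at_ _ (sm_form fe oU hX').
have hS := vfield_tlin oU ha hX hX'.
rewrite /dform {1}/tlin.
have -> : Y p (fun q => eta q (tlin (a q) (X q) (X' q))) =
    Y p a * eta p (X p) + a p * Y p (fun q => eta q (X q)) + Y p (fun q => eta q (X' q)).
  rewrite -(tangent_leibniz (tY p Up) sa sX1) -(tangentD (tY p Up)) //; last exact: smooth_atM.
  apply: (tangent_local (tY p Up) oU Up); first by apply: at_; exact: (sm_form fe oU hS).
  move=> q Uq; apply: (covector_form fe Uq); [exact: (proj1 hS) | exact: tX | exact: tX' | by []].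
have -> : eta p (bracket (fun q => tlin (a q) (X q) (X' q)) Y p) =
    a p * eta p (bracket X Y p) + ((- Y p a) * eta p (X p) + eta p (bracket X' Y p)).
  have tbX := proj1 (vfield_bracket oU hX hY) p Up; have tbX' := proj1 (vfield_bracket oU hX' hY) p Up.
  have t2 := tangent_tlin (- Y p a) (tX p Up) tbX'.
  have -> : (- Y p a) * eta p (X p) + eta p (bracket X' Y p) =
      eta p (tlin (- Y p a) (X p) (bracket X' Y p)).
    by symmetry; apply: (covector_form fe Up) => //; exact: tX.
  apply: (covector_form fe Up) => //; first exact: (proj1 (vfield_bracket oU hS hY)).
  move=> f [V [oV Vp hf]]; rewrite /bracket {1 2}/tlin.
  have oVU : open (V `&` U) by apply: openI.
  have hf' : smooth_on (V `&` U) f by apply: sub_sm hf => x [].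
  have fX : smooth_at p (fun q => X q f) by exists (V `&` U); split=> //; apply: sX => // x [].
  have fX' : smooth_at p (fun q => X' q f) by exists (V `&` U); split=> //; apply: sX' => // x [].
  rewrite (tangentD (tY p Up)) //; last exact: smooth_atM.
  by rewrite (tangent_leibniz (tY p Up)) // /tlin; ring.
ring.
Qed.

Lemma dform_zero U eta Y p : form_on U eta -> open U -> U p -> vfield_on U Y ->
  dform eta (fun=> @tzero R m M) Y p = 0.
Proof.
move=> fe oU Up hY; have := dform_tlin fe oU Up (sm_cst U (-1)) hY hY hY.
have -> : (fun q => tlin (-1) (Y q) (Y q)) = (fun=> @tzero R m M).
  by apply/funext => q; apply/funext => f; rewrite /tlin mulN1r addNr.
by move=> ->; rewrite mulN1r addNr.
Qed.

Lemma dform_tsum U eta (I : Type) (l : seq I) (a : I -> M -> R[i]) (Z : I -> vfield M) Y p :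
  form_on U eta -> open U -> U p -> (forall i, smooth_on U (a i)) -> (forall i, vfield_on U (Z i)) ->
  vfield_on U Y ->
  dform eta (fun q => tsum l (fun i => a i q) (fun i => Z i q)) Y p =
    \sum_(i <- l) a i p * dform eta (Z i) Y p.
Proof.
move=> fe oU Up ha hZ hY; elim: l => [|i l IH].
  rewrite big_nil -(dform_zero fe oU Up hY); congr (dform _ _ _ _).
  by apply/funext => q; rewrite tsum_nil.
rewrite big_cons -IH -(dform_tlin fe) //; last exact: vfield_tsum.
by congr (dform _ _ _ _); apply/funext => q; rewrite tsum_cons.
Qed.

Lemma bracket_fconj X Y : bracket (fconj X) (fconj Y) = fconj (bracket X Y).
Proof.
apply/funext => p; apply/funext => f; rewrite /bracket /fconj /tconj.
have cjB (x y : R[i]) : (x - y)^* = x^* - y^* by exact: rmorphB.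
by rewrite cjB; congr (_^* - _^*); congr (_ p _); apply/funext => q; rewrite cjK.
Qed.

Lemma dform_conj U eta X Y p : form_on U eta -> open U -> U p -> vfield_on U X -> vfield_on U Y ->
  (forall q v, tangent q v -> eta q (tconj v) = (eta q v)^*) ->
  dform eta (fconj X) (fconj Y) p = (dform eta X Y p)^*.
Proof.
move=> fe oU Up hX hY re.
have key X' Y' : vfield_on U X' -> vfield_on U Y' ->
    fconj X' p (fun q => eta q (fconj Y' q)) = (X' p (fun q => eta q (Y' q)))^*.
  move=> hX' hY'; rewrite /fconj {1}/tconj; congr (_^*).
  apply: (tangent_local (proj1 hX' p Up) oU Up).
    exists U; split=> //; apply: smJ => //.
    by have := sm_form fe oU (vfield_fconj oU hY').
  by move=> q Uq; rewrite re ?cjK //; apply: (proj1 hY').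
have cjB (x y : R[i]) : (x - y)^* = x^* - y^* by exact: rmorphB.
rewrite /dform bracket_fconj !key // /fconj re ?cjB //.
exact: (proj1 (vfield_bracket oU hX hY)).
Qed.

Lemma form_on_sub U V eta : V `<=` U -> form_on U eta -> form_on V eta.
Proof.
move=> VU [h s]; split=> [p a u v w Vp|W X oW WV]; first by apply: h; apply: VU.
by apply: s => // x /WV /VU.
Qed.

Lemma sm_dform U eta X Y : form_on U eta -> open U -> vfield_on U X -> vfield_on U Y ->
  smooth_on U (dform eta X Y).
Proof.
move=> fe oU hX hY.
apply: smB => //; last exact: (sm_form fe oU (vfield_bracket oU hX hY)).
apply: smB => //; first exact: (vfield_app oU hX (sm_form fe oU hY)).
exact: (vfield_app oU hY (sm_form fe oU hX)).
Qed.

Lemma rsm_pos_open U (r : M -> R) : open U -> rsmooth_on U r -> open (U `&` [set q | 0 < r q]).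
Proof.
move=> oU hr; rewrite openE => q [Uq rq]; have [c [ac cq]] := atlas_cover q.
have Wq := cdomain_cmap cq Uq; have oD := @cdomain_open _ _ _ c _ oU.
have cr := Ck_cont (hr c ac 0%N) Wq.
have N : nbhs (cmap c q) [set x | 0 < r (cinv c x)].
  by apply: (cvgr_gt _ cr); rewrite cmapK.
have := cmap_cont cq N; rewrite /interior => N2.
have cN : nbhs q (cdom c) by apply: open_nbhs_nbhs; split=> //; apply: cdom_open.
have UN : nbhs q U by apply: open_nbhs_nbhs.
apply: filterS (filterI (filterI UN cN) N2) => x [[Ux cx]] /=.
by rewrite cmapK.
Qed.

End FormAlgebra.

(** * Linear algebra of biorthogonal systems *)

Section DualSystems.
Variable F : fieldType.

(** A rank bound, used to show that a Levi-orthonormal family of fewer than n fields cannot span. *)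
Lemma biorthogonal_leq (I J : finType) (g : I -> J -> F) (c : J -> I -> F) :
  (forall i i', \sum_j g i j * c j i' = (i == i')%:R) -> (#|I| <= #|J|)%N.
Proof.
move=> h; pose G := \matrix_(i < #|I|, j < #|J|) g (enum_val i) (enum_val j).
pose C := \matrix_(j < #|J|, i < #|I|) c (enum_val j) (enum_val i).
have : G *m C = 1%:M.
  apply/matrixP => i i'; rewrite !mxE -(inj_eq enum_val_inj) -h.
  rewrite [RHS](reindex (enum_val (A := J))) /=; last exact/onW_bij/enum_val_bij.
  by apply: eq_bigr => j _; rewrite !mxE.
by move/mulmx1_min.
Qed.

Lemma biorthogonal_sym (I J : finType) (g : I -> J -> F) (c : J -> I -> F) : #|I| = #|J| ->
  (forall i i', \sum_j g i j * c j i' = (i == i')%:R) ->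
  forall j j', \sum_i c j i * g i j' = (j == j')%:R.
Proof.
move=> eIJ h j0 j0'; pose G := \matrix_(i < #|I|, j < #|J|) g (enum_val i) (enum_val j).
pose C := \matrix_(j < #|J|, i < #|I|) c (enum_val j) (enum_val i).
have GC : G *m C = 1%:M.
  apply/matrixP => i i'; rewrite !mxE -(inj_eq enum_val_inj) -h.
  rewrite [RHS](reindex (enum_val (A := J))) /=; last exact/onW_bij/enum_val_bij.
  by apply: eq_bigr => j _; rewrite !mxE.
have comm (k l : nat) (A : 'M[F]_(k, l)) (B : 'M[F]_(l, k)) : k = l -> A *m B = 1%:M -> B *m A = 1%:M.
  by move=> e; case: _ / e A B => A B; apply: mulmx1C.
have /matrixP/(_ (enum_rank j0) (enum_rank j0')) := comm _ _ _ _ eIJ GC.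
rewrite !mxE (inj_eq enum_rank_inj) => <-.
rewrite [LHS](reindex (enum_val (A := I))) /=; last exact/onW_bij/enum_val_bij.
by apply: eq_bigr => i _; rewrite !mxE !enum_rankK.
Qed.

End DualSystems.

Section FrameSpan.
Variables (R : realType) (m : nat) (M : manifold R m) (p : M).

Lemma cdir_crdC (c : chart R m M) i j : atlas c -> cdom c p -> cdir c i p (crdC c j) = (i == j)%:R.
Proof.
move=> ac cp; rewrite /cdir /crdC /=.
have -> : cpart c i (fun=> 0) p = 0 by rewrite /cpart derive_cst.
have -> : cpart c i (fun q => crd c j q) p = (i == j)%:R.
  transitivity ('D_(bvec R i) (fun x : 'rV[R]_m => x 0 j) (cmap c p)).
    apply: near_eq_derive; have ix := cmap_img cp.
    apply: filterS (open_nbhs_nbhs (conj (cimg_open (c := c)) ix)) => x ix'.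
    by rewrite /crd cinvK.
  have [_ ->] := is_derive_coord j (is_derive_id (cmap c p) (bvec R i)).
  by rewrite /bvec mxE eqxx /= eq_sym.
by case: (i == j).
Qed.

(** In coordinates, duality says that the matrix of the vectors times that of the covectors is the
    identity; both are square because the family has [m] members, so the product in the other order
    is the identity too. *)
Lemma dual_system_span (I : finType) (e : I -> tvec M) (phi : I -> tvec M -> R[i]) :
  #|I| = m -> (forall j, tangent p (e j)) -> (forall j, covector p (phi j)) ->
  (forall j l, phi l (e j) = (j == l)%:R) ->
  forall v f, tangent p v -> smooth_at p f -> v f = \sum_j phi j v * e j f.
Proof.
move=> cI te cphi dual v f tv hf; have [c [ac cp]] := atlas_cover p.
pose g j i := e j (crdC c i); pose C i l := phi l (cdir c i p).
have expand u : tangent p u -> tveq p u (tsum (index_enum _) (fun i => u (crdC c i)) (fun i => cdir c i p)).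
  by move=> tu h hh; apply: (tangent_coord ac).
have phiE l u : tangent p u -> phi l u = \sum_i u (crdC c i) * C i l.
  move=> tu; apply: covector_tsum (expand u tu) => //.
  by move=> i; apply: tangent_cdir.
have h j l : \sum_i g j i * C i l = (j == l)%:R by rewrite -phiE // dual.
have h2 := biorthogonal_sym (g := g) (c := C) _ h.
rewrite (tangent_coord ac tv cp hf).
transitivity (\sum_i v (crdC c i) * \sum_i' (\sum_j C i j * g j i') * cdir c i' p f).
  apply: eq_bigr => i _; congr (_ * _); rewrite (bigD1 i) //= h2 ?cI ?card_ord // eqxx mul1r.
  by rewrite big1 ?addr0 // => i' ne; rewrite h2 ?cI ?card_ord // eq_sym (negbTE ne) mul0r.
have -> : \sum_j phi j v * e j f = \sum_j (\sum_i v (crdC c i) * C i j) * \sum_i' g j i' * cdir c i' p f.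
  by apply: eq_bigr => j _; rewrite phiE // (tangent_coord ac (te j) cp hf).
under [RHS]eq_bigr do rewrite mulr_suml; rewrite exchange_big; apply: eq_bigr => i _ /=.
under [RHS]eq_bigr do rewrite -mulrA; rewrite -mulr_sumr; congr (_ * _).
under [RHS]eq_bigr do rewrite mulr_sumr; rewrite exchange_big; apply: eq_bigr => i' _ /=.
by rewrite mulr_suml; apply: eq_bigr => j _; rewrite mulrA.
Qed.

End FrameSpan.

(** * The projection onto T_{1,0} and local unitary frames *)

Section UnitaryFrames.
Variables (R : realType) (n : nat) (M : pseudohermitian R n).
Implicit Types (U V : set M) (X Y : vfield M) (p q : M) (u v w : tvec M).
Local Notation th0 := (@theta R n M).
Local Notation J := (@Jop R n M).
Local Notation T := (@reeb R n M).

Lemma cj_sum (I : Type) (l : seq I) (F : I -> R[i]) : (\sum_(i <- l) F i)^* = \sum_(i <- l) (F i)^*.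
Proof. exact: (big_morph _ (@cjD R) (conjC0 _)). Qed.

Lemma theta_covector p : covector p (th0 p).
Proof. exact: covector_form (@theta_form R n M) I. Qed.

Lemma theta_form_on U : form_on U th0.
Proof. exact: form_on_sub (@theta_form R n M). Qed.

Lemma tangent_reeb p : tangent p (T p).
Proof. exact: (proj1 (@reeb_field R n M)). Qed.

Lemma vfield_reeb U : vfield_on U T.
Proof. exact: vfield_sub (@reeb_field R n M). Qed.

Definition hor p v : tvec M := tlin (- th0 p v) (T p) v.

(** The operator (1 - i J)/2 after [hor]: the projection onto T_{1,0} along T_{0,1} and the Reeb
    direction. *)
Definition proj p v : tvec M :=
  tlin (2^-1) (hor p v) (tlin (- ('i / 2)) (J p (hor p v)) (@tzero R _ M)).

Lemma hor_contact p v : tangent p v -> contact_vec th0 p (hor p v).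
Proof.
move=> tv; have tT := tangent_reeb p; have th := tangent_tlin (- th0 p v) tT tv.
split=> //; rewrite /hor (theta_covector th tT tv (a := - th0 p v)) //.
by rewrite (@theta_reeb R n M) mulr1 addNr.
Qed.

Lemma tangent_hor p v : tangent p v -> tangent p (hor p v).
Proof. by move=> /hor_contact[]. Qed.

Lemma tangent_J p v : tangent p v -> tangent p (J p (hor p v)).
Proof. by move=> /hor_contact/(@J_contact R n M)[]. Qed.

Lemma tangent_proj p v : tangent p v -> tangent p (proj p v).
Proof.
move=> tv; apply: tangent_tlin; first exact: tangent_hor.
by apply: tangent_tlin; [apply: tangent_J | apply: tangent_tzero].
Qed.

Lemma J_tveq p u v : contact_vec th0 p u -> contact_vec th0 p v -> tveq p u v ->
  tveq p (J p u) (J p v).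
Proof.
move=> cu cv e f hf; have := @J_linear R n M p 0 u v v cu cv cv.
move=> -> //; first by rewrite /tlin mul0r add0r.
by move=> g hg; rewrite /tlin mul0r add0r e.
Qed.

Lemma J_zero p u : contact_vec th0 p u -> tveq p u (@tzero R _ M) -> tveq p (J p u) (@tzero R _ M).
Proof.
move=> cu e f hf; have := @J_linear R n M p (-1) u u u cu cu cu.
move=> -> //; first by rewrite /tlin mulN1r addNr.
by move=> g hg; rewrite /tlin mulN1r addNr e.
Qed.

Lemma hor_tlin p (a : R[i]) u v w : tangent p u -> tangent p v -> tangent p w ->
  tveq p u (tlin a v w) -> tveq p (hor p u) (tlin a (hor p v) (hor p w)).
Proof.
move=> tu tv tw e f hf; rewrite /hor /tlin (theta_covector tu tv tw e) (e f hf) /tlin; ring.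
Qed.

Lemma proj_tlin p (a : R[i]) u v w : tangent p u -> tangent p v -> tangent p w ->
  tveq p u (tlin a v w) -> tveq p (proj p u) (tlin a (proj p v) (proj p w)).
Proof.
move=> tu tv tw e f hf; have eh := hor_tlin tu tv tw e.
have := @J_linear R n M p a _ _ _ (hor_contact tu) (hor_contact tv) (hor_contact tw) eh f hf.
have := eh f hf; rewrite /proj {2 3 4 5 6 7}/tlin => -> ->; rewrite /tlin /tzero; ring.
Qed.

Lemma proj_zero p v : tangent p v -> tveq p (hor p v) (@tzero R _ M) -> tveq p (proj p v) (@tzero R _ M).
Proof.
move=> tv e f hf; rewrite /proj /tlin (e f hf) (J_zero (hor_contact tv) e hf) /tzero; ring.
Qed.

Lemma proj_tsum p (I : Type) (l : seq I) (a : I -> R[i]) (v : I -> tvec M) u : tangent p u ->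
  (forall i, tangent p (v i)) -> tveq p u (tsum l a v) ->
  tveq p (proj p u) (tsum l a (fun i => proj p (v i))).
Proof.
move=> tu tv; elim: l u tu => [|i l IH] u tu e.
  rewrite tsum_nil; apply: proj_zero => // f hf; rewrite /hor /tlin.
  have e0 : tveq p u (@tzero R _ M) by move=> g hg; rewrite e // tsum_nil.
  by rewrite (e0 f hf) (covector0 (@theta_covector p) tu e0) oppr0 mul0r add0r.
have ts := tangent_tsum l a tv.
have e1 : tveq p u (tlin (a i) (v i) (tsum l a v)) by move=> g hg; rewrite e // tsum_cons.
move=> f hf; rewrite (proj_tlin tu (tv i) ts e1 hf) tsum_cons /tlin.
by rewrite (IH _ ts).
Qed.

Lemma hor_T10 p v : T10_vec th0 J p v -> tveq p (hor p v) v.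
Proof. by move=> [[tv e] _] f hf; rewrite /hor /tlin e oppr0 mul0r add0r. Qed.

Lemma imagM : 'i * 'i = -1 :> R[i]. Proof. by rewrite -expr2 sqrCi. Qed.

Lemma proj_T10 p v : T10_vec th0 J p v -> tveq p (proj p v) v.
Proof.
move=> h f hf; have [cv eJ] := h; have [tv _] := cv; have eh := hor_T10 h.
rewrite /proj /tlin /tzero (eh f hf) (J_tveq (hor_contact tv) cv eh hf) (eJ f hf) /tlin /tzero addr0.
rewrite addr0 mulrA -mulrDl.
have -> : 2^-1 + - ('i / 2) * 'i = 1 :> R[i].
  transitivity (2^-1 + - ('i * 'i) / 2 : R[i]); first by ring.
  by rewrite imagM opprK; field.
exact: mul1r.
Qed.

Lemma contact_tconj p v : contact_vec th0 p v -> contact_vec th0 p (tconj v).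
Proof.
move=> [tv e]; split; first exact: tangent_tconj.
by rewrite (@theta_real R n M) // e conjC0.
Qed.

Lemma proj_T01 p v : T10_vec th0 J p v -> tveq p (proj p (tconj v)) (@tzero R _ M).
Proof.
move=> h f hf; have [cv eJ] := h; have [tv _] := cv.
have cc := contact_tconj cv; have [tc ec] := cc.
have eh : tveq p (hor p (tconj v)) (tconj v).
  by move=> g hg; rewrite /hor /tlin ec oppr0 mul0r add0r.
rewrite /proj /tlin /tzero (eh f hf) (J_tveq (hor_contact tc) cc eh hf) (@J_real R n M p v cv f hf).
rewrite /tconj (eJ _ (smooth_atJ hf)) /tlin /tzero !addr0 cjM conjCi.
move: ((v _)^*) => z.
have -> : 2^-1 * z + - ('i / 2) * (- 'i * z) = (1 + 'i * 'i) / 2 * z by ring.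
by rewrite imagM subrr mul0r mul0r.
Qed.

Lemma proj_reeb p : tveq p (proj p (T p)) (@tzero R _ M).
Proof.
apply: proj_zero; first exact: tangent_reeb.
by move=> f hf; rewrite /hor /tlin (@theta_reeb R n M) mulN1r addNr.
Qed.

Lemma real_decomp p v : tangent p v -> tveq p (tconj v) v ->
  tveq p v (tlin (th0 p v) (T p) (tlin 1 (proj p v) (tconj (proj p v)))).
Proof.
move=> tv rv f hf; have tc := tangent_tconj tv.
have th_real : th0 p (tconj v) = th0 p v by apply: covector_tveq (@theta_covector p) _ _ rv.
have hr : tveq p (tconj (hor p v)) (hor p v).
  move=> g hg; rewrite /hor tconj_tlin /tlin (@reeb_real R n M p g hg) (rv g hg).
  have cN (x : R[i]) : (- x)^* = - x^* by exact: rmorphN.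
  by rewrite cN -(@theta_real R n M) // th_real.
have hJ : tconj (J p (hor p v)) f = J p (hor p v) f.
  have cv := hor_contact tv; rewrite -(@J_real R n M p _ cv f hf).
  exact: (J_tveq (contact_tconj cv) cv hr hf).
have tlinE (a : R[i]) (u w : tvec M) g : tlin a u w g = a * u g + w g by [].
have c2 : (2^-1 : R[i])^* = 2^-1 by rewrite fmorphV /= (rmorph_nat _ 2).
have ci : (- ('i / 2) : R[i])^* = 'i / 2.
  have cN (x : R[i]) : (- x)^* = - x^* by exact: rmorphN.
  by rewrite cN cjM conjCi c2; ring.
have c0 : tconj (@tzero R _ M) f = 0 by rewrite /tconj /tzero conjC0.
by rewrite !tlinE /proj !tlinE (tconj_tlin 2^-1) (tconj_tlin (- ('i / 2))) !tlinE hJ (hr f hf) c2 ci c0 /hor !tlinE /tzero; field.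
Qed.

(** Since J^2 = -1, applying J to (1 - i J)/2 multiplies it by i; smoothness is that of theta, the
    Reeb field and J. *)
Lemma T10_proj U X : open U -> vfield_on U X -> T10_field th0 J U (fun q => proj q (X q)).
Proof.
move=> oU hX; have [tX _] := hX; have sth := sm_form (@theta_form_on U) oU hX.
have hH : contact_field th0 U (fun q => hor q (X q)).
  split; last by move=> q Uq; have [] := hor_contact (tX q Uq).
  by apply: vfield_tlin => //; [apply: smN | apply: vfield_reeb].
have hJ := @J_smooth R n M U _ oU hH.
split=> [|q Uq].
  apply: vfield_tlin => //; [exact: sm_cst | exact: hH.1 |].
  by apply: vfield_tlin => //; [exact: sm_cst | exact: vfield_zero].
have tq := tX q Uq; have ch := hor_contact tq; have cJ := @J_contact R n M q _ ch.
have tJ := cJ.1; have z := @tangent_tzero R _ M q.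
have cz : contact_vec th0 q (@tzero R _ M).
  by split=> //; apply: covector0 (@theta_covector q) z _.
have c2 : contact_vec th0 q (tlin (- ('i / 2)) (J q (hor q (X q))) (@tzero R _ M)).
  have t2 := tangent_tlin (- ('i / 2)) tJ z; split=> //.
  by rewrite (@theta_covector q _ _ _ _ t2 tJ z (fun _ _ => erefl)) cJ.2 cz.2 mulr0 addr0.
have cp : contact_vec th0 q (proj q (X q)).
  have tp := tangent_proj tq; split=> //.
  by rewrite (@theta_covector q _ _ _ _ tp ch.1 c2.1 (fun _ _ => erefl)) ch.2 c2.2 mulr0 addr0.
split=> // f hf.
rewrite (@J_linear R n M q _ _ _ _ cp ch c2 (fun _ _ => erefl) f hf) {1}/tlin.
rewrite (@J_linear R n M q _ _ _ _ c2 cJ cz (fun _ _ => erefl) f hf) {1}/tlin.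
rewrite (@J_sqr R n M q _ ch f hf) (J_zero cz (fun _ _ => erefl) hf).
rewrite /proj /tlin /tzero; move: (J q _ f) (hor q _ f) => z1 z2.
have -> : 2^-1 * z1 + (- ('i / 2) * (-1 * z2 + 0) + 0) =
  'i * (2^-1 * z2 + (- ('i / 2) * z1 + 0)) + 0 + (1 + 'i * 'i) / 2 * z1 by field.
by rewrite imagM subrr !mul0r addr0.
Qed.

(** The Hermitian form whose matrix in a frame of T_{1,0} is h_{a \bar b}. *)
Definition levi X Y p : R[i] := - 'i * dform th0 X (fconj Y) p.

Lemma sm_levi U X Y : open U -> vfield_on U X -> vfield_on U Y -> smooth_on U (levi X Y).
Proof.
move=> oU hX hY; apply: smM => //; first exact: sm_cst.
by apply: sm_dform (@theta_form_on U) _ _ _ => //; apply: vfield_fconj.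
Qed.

Lemma levi_tsum U (I : Type) (l : seq I) (a : I -> M -> R[i]) (Z : I -> vfield M) X Y p :
  open U -> U p -> (forall i, smooth_on U (a i)) -> (forall i, vfield_on U (Z i)) ->
  vfield_on U X -> vfield_on U Y ->
  (forall q, U q -> tveq q (X q) (tsum l (fun i => a i q) (fun i => Z i q))) ->
  levi X Y p = \sum_(i <- l) a i p * levi (Z i) Y p.
Proof.
move=> oU Up ha hZ hX hY e; have hYc := vfield_fconj oU hY; have fe := @theta_form_on U.
rewrite /levi (dform_tveq fe oU Up hX (vfield_tsum l oU ha hZ) hYc e).
rewrite (dform_tsum l fe oU Up ha hZ hYc) mulr_sumr; apply: eq_bigr => i _; ring.
Qed.

Lemma levi_tveq U X X' Y p : open U -> U p -> vfield_on U X -> vfield_on U X' -> vfield_on U Y ->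
  (forall q, U q -> tveq q (X q) (X' q)) -> levi X Y p = levi X' Y p.
Proof.
move=> oU Up hX hX' hY e; rewrite /levi.
by rewrite (dform_tveq (@theta_form_on U) oU Up hX hX' (vfield_fconj oU hY) e).
Qed.

Lemma leviC U X Y p : open U -> U p -> vfield_on U X -> vfield_on U Y ->
  levi Y X p = (levi X Y p)^*.
Proof.
move=> oU Up hX hY; have fe := @theta_form_on U.
have cN (x : R[i]) : (- x)^* = - x^* by exact: rmorphN.
rewrite /levi cjM cN conjCi opprK -(dform_conj fe oU Up) //; last first.
- by move=> q v; apply: theta_real.
- exact: vfield_fconj.
have -> : fconj (fconj Y) = Y by apply/funext => q; apply: tconjK.
by rewrite (dformC fe oU Up (vfield_fconj oU hX)) // mulrNN.
Qed.

Definition orthoframe k U (Z : 'I_k -> vfield M) : Prop :=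
  (forall a, T10_field th0 J U (Z a)) /\
  (forall a b p, U p -> levi (Z a) (Z b) p = (a == b)%:R).

Lemma orthoframe_sub k U V Z : V `<=` U -> @orthoframe k U Z -> orthoframe V Z.
Proof.
move=> VU [h1 h2]; split=> [a|a b p /VU]; last exact: h2.
by have [hv ht] := h1 a; split; [apply: vfield_sub hv | move=> q /VU /ht].
Qed.

(* Gram-Schmidt: normalize the Levi-orthogonal part of [E], which does not vanish near [p]. *)
Lemma orthoframe_extend k U Z E p : open U -> U p -> @orthoframe k U Z -> T10_field th0 J U E ->
  ~ tveq p (E p) (tsum (index_enum _) (fun a => levi E (Z a) p) (fun a => Z a p)) ->
  exists V (Z' : 'I_k.+1 -> vfield M), [/\ open V, V p, V `<=` U & orthoframe V Z'].
Proof.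
move=> oU Up [hZ oZ] [hE tE] ne; have vZ a := (hZ a).1.
pose S : vfield M := fun q => tsum (index_enum _) (fun a => levi E (Z a) q) (fun a => Z a q).
have sl a : smooth_on U (levi E (Z a)) by apply: sm_levi.
have vS : vfield_on U S by apply: vfield_tsum.
pose W : vfield M := fun q => tlin (-1) (S q) (E q).
have vW : vfield_on U W by apply: vfield_tlin => //; apply: sm_cst.
have T10_lin q (a : R[i]) v w : T10_vec th0 J q v -> T10_vec th0 J q w -> T10_vec th0 J q (tlin a v w).
  move=> [cv ev] [cw ew]; have tl := tangent_tlin a cv.1 cw.1.
  have cl : contact_vec th0 q (tlin a v w).
    split=> //; rewrite (@theta_covector q _ _ _ _ tl cv.1 cw.1 (fun _ _ => erefl)).
    by rewrite cv.2 cw.2 mulr0 addr0.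
  split=> // f hf; rewrite (@J_linear R n M q _ _ _ _ cl cv cw (fun _ _ => erefl) f hf).
  by rewrite {1}/tlin (ev f hf) (ew f hf) /tlin /tzero; ring.
have T10_0 q : T10_vec th0 J q (@tzero R _ M).
  have z := @tangent_tzero R _ M q.
  have cz : contact_vec th0 q (@tzero R _ M).
    by split=> //; apply: covector0 (@theta_covector q) z _.
  by split=> // f hf; rewrite (J_zero cz (fun _ _ => erefl) hf) /tlin /tzero mulr0 addr0.
have T10_S q : U q -> T10_vec th0 J q (S q).
  move=> Uq; rewrite /S; elim: (index_enum _) => [|a l IH]; first by rewrite tsum_nil.
  by rewrite tsum_cons; apply: T10_lin => //; apply: (hZ a).2.
have T10_W : T10_field th0 J U W.
  by split=> // q Uq; apply: T10_lin; [apply: T10_S | apply: tE].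
have Wnz : ~ tveq p (W p) (@tzero R _ M).
  move=> h; apply: ne => f hf; have := h f hf; rewrite /W /tlin /tzero mulN1r addrC.
  by move/eqP; rewrite subr_eq0 => /eqP.
have levi_lin X1 X2 (a : M -> R[i]) Y q : U q -> smooth_on U a -> vfield_on U X1 -> vfield_on U X2 ->
    vfield_on U Y -> levi (fun q => tlin (a q) (X1 q) (X2 q)) Y q = a q * levi X1 Y q + levi X2 Y q.
  move=> Uq ha h1 h2 hY; rewrite /levi (dform_tlin (@theta_form_on U) oU Uq ha h1 h2) //.
    by ring.
  exact: vfield_fconj.
have WZ b q : U q -> levi W (Z b) q = 0.
  move=> Uq; rewrite (levi_lin S E (fun=> -1)) //; last exact: sm_cst.
  rewrite (levi_tsum (U := U) (l := index_enum _) (a := fun a => levi E (Z a)) (Z := Z)) //.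
  rewrite (bigD1 b) //= oZ // eqxx mulr1 big1 ?addr0 ?mulN1r ?addNr // => a ab.
  by rewrite oZ // (negbTE ab) mulr0.
pose r q := complex.Re (levi W W q).
have sWW := sm_levi oU vW vW.
have rE q : U q -> levi W W q = (r q)%:C%C.
  move=> Uq; have := leviC oU Uq vW vW; rewrite /r; case: (levi W W q) => a b.
  by move=> /(congr1 (@complex.Im R)); rewrite ImJ /= => /eqP; rewrite -addr_eq0 -mulr2n mulrn_eq0 /= => /eqP ->.
have hr : rsmooth_on U r := sWW.1.
pose V := U `&` [set q | 0 < r q].
have oV : open V by apply: rsm_pos_open.
have VU : V `<=` U by move=> q [].
have Vp : V p.
  split=> //=; have := @levi_pos R n M U W p oU Up T10_W Wnz.
  by rewrite -/(levi W W p) rE // ltcR.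
(* The normalizing factor r^(-1/2), written with exponential and logarithm so that its smoothness
   follows from theirs. *)
pose s q : R[i] := (expR (- 2^-1 * ln (r q)))%:C%C.
have ss : smooth_on V s.
  apply: sm_real; apply: rsm_expR => //; apply: rsmM => //; first exact: rsm_cst.
  by apply: rsm_ln => //; [move=> q [] | move=> c ac j; apply: sub_Ck (hr c ac j) => x [a /VU b]].
pose N : vfield M := fun q => tlin (s q) (W q) (@tzero R _ M).
have vWV := vfield_sub VU vW.
have vN : vfield_on V N by apply: vfield_tlin => //; apply: vfield_zero.
have T10_N : T10_field th0 J V N.
  by split=> // q /VU Uq; apply: T10_lin; [apply: T10_W.2 | apply: T10_0].
have leviN Y q : V q -> vfield_on V Y -> levi N Y q = s q * levi W Y q.
  move=> Vq hY; rewrite /levi (dform_tlin (@theta_form_on V) oV Vq ss vWV) //; last first.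
  - exact: vfield_fconj.
  - exact: vfield_zero.
  rewrite (dform_zero (@theta_form_on V)) //; last exact: vfield_fconj.
  by ring.
have NN q : V q -> levi N N q = 1.
  move=> Vq; have Uq := VU q Vq; have [_ /= rq] := Vq.
  rewrite leviN // (leviC oV Vq vN vWV) leviN // cjM -(leviC oV Vq vWV vWV) rE //.
  have -> : (s q)^* = s q by apply: complex_ext; rewrite ?ReJ ?ImJ /= ?oppr0.
  rewrite /s -!rmorphM /=; have -> : 1 = 1%:C%C :> R[i] by [].
  congr (_%:C%C); rewrite mulrA -expRD -mulrDl -{2}(lnK (x := r q)) ?posrE // -expRD.
  have -> : (- 2^-1 + - 2^-1) * ln (r q) + ln (r q) = 0 by field.
  exact: expR0.
have NZ b q : V q -> levi N (Z b) q = 0.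
  move=> Vq; rewrite leviN ?WZ ?mulr0 //; first exact: VU.
  exact: vfield_sub (vZ b).
exists V, (fun a => if unlift ord0 a is Some b then Z b else N); split=> //; split.
  move=> a; case: unliftP => [b _|_] //.
  by have [_] := orthoframe_sub VU (conj hZ oZ) => _; exact: (orthoframe_sub VU (conj hZ oZ)).1.
move=> a b q Vq; case: (unliftP ord0 a) => [a' ->|->]; case: (unliftP ord0 b) => [b' ->|->] /=.
- by rewrite oZ ?(inj_eq lift_inj) //; apply: VU.
- rewrite (leviC oV Vq vN) ?NZ ?conjC0 //; last exact: vfield_sub (vZ a').
- by rewrite NZ.
- by rewrite NN.
Qed.

Lemma card_frame_index k : #|frame_index k| = (k.*2.+1)%N.
Proof. by rewrite /frame_index !card_sum card_ord card_unit addnn addn1. Qed.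

Lemma cdir_real (c : chart R _ M) i p : atlas c -> cdom c p ->
  tveq p (tconj (cdir c i p)) (cdir c i p).
Proof.
move=> ac cp f hf; rewrite /tconj /cdir; case: hf => U [oU Up [f1 f2]].
apply: complex_ext; rewrite ?ReJ ?ImJ /=.
  by congr (cpart _ _ _ _); apply/funext => x; rewrite ReJ.
have -> : (fun x => complex.Im (f x)^*) = (fun x => - complex.Im (f x)).
  by apply/funext => x; rewrite ImJ.
have d := cpart_is_derive ac i oU Up cp f2.
by rewrite (cpartE (is_deriveN d)) opprK.
Qed.

(** While k < n some projected coordinate field lies outside the span of the Z_a at [p], and
    Gram-Schmidt adds it. Otherwise [real_decomp] would express all 2n + 1 real coordinate
    directions through the 2k + 1 vectors Z_a, Z_{\bar a}, T. *)
Lemma orthoframe_exists (c : chart R _ M) p k : atlas c -> cdom c p -> (k <= n)%N ->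
  exists U (Z : 'I_k -> vfield M), [/\ open U, U p, U `<=` cdom c & orthoframe U Z].
Proof.
move=> ac cp; elim: k => [_|k IH kn].
  exists (cdom c), (fun a : 'I_0 => fun=> @tzero R _ M); split=> //; first exact: cdom_open.
  by split=> [] [].
have [U [Z [oU Up Uc oZ]]] := IH (ltnW kn).
have vd i : vfield_on U (cdir c i) by apply: vfield_sub (vfield_cdir ac i).
have hE i := T10_proj oU (vd i).
pose E i : vfield M := fun q => proj q (cdir c i q).
have [[i ni]|all] := pselect (exists i, ~ tveq p (E i p)
    (tsum (index_enum _) (fun a => levi (E i) (Z a) p) (fun a => Z a p))).
  have [V [Z' [oV Vp VU hV]]] := orthoframe_extend oU Up oZ (hE i) ni.
  by exists V, Z'; split=> // q /VU /Uc.
have eE i : tveq p (E i p) (tsum (index_enum _) (fun a => levi (E i) (Z a) p) (fun a => Z a p)).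
  by apply: contrapT => ni; apply: all; exists i.
pose C i (j : frame_index k) : R[i] := match j with
  inl (inl a) => levi (E i) (Z a) p | inl (inr a) => (levi (E i) (Z a) p)^*
  | inr _ => th0 p (cdir c i p) end.
pose fr (j : frame_index k) : tvec M := match j with
  inl (inl a) => Z a p | inl (inr a) => tconj (Z a p) | inr _ => T p end.
suff : (#|'I_(n.*2.+1)| <= #|frame_index k|)%N.
  by rewrite card_ord card_frame_index ltnS leq_double leqNgt kn.
apply: (biorthogonal_leq (g := C) (c := fun j i => fr j (crdC c i))) => i i'.
rewrite -(cdir_crdC i i' ac cp) (real_decomp (tangent_cdir ac i cp) (cdir_real i ac cp)) //; last first.
  exact: smooth_at_crdC.
rewrite sum_frame_index /tlin mul1r addrC; congr (_ + _); rewrite -/(E i p).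
have sx := smooth_at_crdC ac i' cp.
have eE1 := eE i _ sx; rewrite eE1; congr (_ + _).
have -> : tconj (E i p) (crdC c i') = (E i p (fun x => (crdC c i' x)^*))^* by [].
rewrite (eE i _ (smooth_atJ sx)) /tsum cj_sum.
by apply: eq_bigr => a _; rewrite cjM.
Qed.

(* The coframe theta^b is obtained from the Levi form by polarization:
   theta^b(v) = L(v', Z_b), where v' is the (1,0)-part of v. *)
Lemma unitary_frame_exists p : exists c U Z th,
  [/\ atlas c, U p, U `<=` cdom c & @unitary_frame R n M U Z th].
Proof.
have [c [ac cp]] := @atlas_cover R _ M p.
have [U [Z [oU Up Uc [hZ oZ]]]] := orthoframe_exists ac cp (leqnn n).
have vZ a := (hZ a).1.
pose E i : vfield M := fun q => proj q (cdir c i q).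
have vd i : vfield_on U (cdir c i) by apply: vfield_sub (vfield_cdir ac i).
have hE i : vfield_on U (E i) by have [] := T10_proj oU (vd i).
pose th b : oneform M := fun q v => \sum_i v (crdC c i) * levi (E i) (Z b) q.
have scr i : smooth_on U (crdC c i) by apply: sub_sm (sm_crdC ac i).
have thE X b q : U q -> vfield_on U X -> th b q (X q) = levi (fun q => proj q (X q)) (Z b) q.
  move=> Uq hX; have tX := hX.1; symmetry.
  apply: (levi_tsum (U := U) (l := index_enum _) (a := fun i q => X q (crdC c i)) (Z := E)) => //.
  - by move=> i; apply: vfield_app.
  - by have [] := T10_proj oU hX.
  move=> x Ux; apply: proj_tsum; [exact: tX | by move=> i; exact: (tangent_cdir ac i (Uc _ Ux)) |].
  by move=> f hf; apply: (tangent_coord ac) => //; [exact: tX | exact: Uc].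
have levi0 X Y q : U q -> vfield_on U X -> vfield_on U Y ->
    (forall x, U x -> tveq x (X x) (@tzero R _ M)) -> levi X Y q = 0.
  move=> Uq hX hY e; rewrite (levi_tveq (U := U) (X' := fun=> @tzero R _ M)) //; last exact: vfield_zero.
  rewrite /levi (dform_zero (@theta_form_on U)) ?mulr0 //; exact: vfield_fconj.
exists c, U, Z, th; split=> //; split=> //.
- move=> a b q Uq; have := oZ a b q Uq; rewrite /levi => <-.
  by rewrite mulrA mulrN imagM opprK mul1r.
- move=> b; split=> [q a u v w Uq tu tv tw e|V X oV VU hX].
    rewrite /th mulr_sumr -big_split; apply: eq_bigr => i _ /=.
    by rewrite e /tlin; [ring | apply: smooth_at_crdC => //; apply: Uc].
  apply: sm_sum => // i; apply: smM => //.
    by apply: vfield_app => //; apply: sub_sm (scr i).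
  by apply: sub_sm (sm_levi oU (hE i) (vZ b)).
- move=> a b q Uq; rewrite thE // -(oZ a b q Uq); apply: (levi_tveq oU Uq) => //.
    by have [] := T10_proj oU (vZ a).
  by move=> x Ux; apply: proj_T10; apply: (hZ a).2.
- move=> a b q Uq; have vc := vfield_fconj oU (vZ a); rewrite thE //; apply: levi0 => //.
    by have [] := T10_proj oU vc.
  by move=> x Ux; apply: proj_T01; apply: (hZ a).2.
- move=> b q Uq; rewrite thE //; last exact: vfield_reeb.
  apply: levi0 => //; first by have [] := T10_proj oU (@vfield_reeb U).
  by move=> x Ux; apply: proj_reeb.
Qed.

End UnitaryFrames.

(** * Functions of space and time *)

Section SpacetimeFunctions.
Variables (R : realType) (m : nat) (M : manifold R m).

Record patch := Patch {
  pchart : chart R m M;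
  pset : set M;
  p_atlas : atlas pchart;
  p_open : open pset;
  p_sub : pset `<=` cdom pchart }.

Variable P : patch.
Local Notation c := (pchart P).
Local Notation V := (pset P).
Implicit Types (r : M * R -> R) (w : M * R -> R[i]) (z : M * R) (y : 'rV[R]_m * R) (i : 'I_m) (X : vfield M).

(** Times are strictly positive: the domain is open and time derivatives are two-sided. *)
Definition stdom : set (M * R) := [set z | V z.1 /\ 0 < z.2].

Definition stimg : set ('rV[R]_m * R) := [set z | cdomain c V z.1 /\ 0 < z.2].

Definition pull r (z : 'rV[R]_m * R) : R := r (cinv c z.1, z.2).

Definition rst r := Cinfty stimg (pull r).

Definition st w := rst (fun z => complex.Re (w z)) /\ rst (fun z => complex.Im (w z)).

Lemma cdomainV_open : open (cdomain c V).
Proof. exact: cdomain_open (p_open P). Qed.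

Lemma stimg_open : open stimg.
Proof.
rewrite openE => -[x t] [/= Dx t0]; exists (cdomain c V, [set s | 0 < s]) => //=.
split; first by apply: open_nbhs_nbhs; split=> //; apply: cdomainV_open.
exact: lt_nbhsr.
Qed.

Lemma stdom_open : open stdom.
Proof.
rewrite openE => -[x t] [/= Vx t0]; exists (V, [set s | 0 < s]) => //=.
by split; [apply: open_nbhs_nbhs; split=> //; exact: p_open | exact: lt_nbhsr].
Qed.

Lemma stimg_cmap z : stdom z -> stimg (cmap c z.1, z.2).
Proof. by move=> [Vz tz]; split=> //; apply: cdomain_cmap => //; apply: p_sub. Qed.

Lemma pull_cmap r z : stdom z -> pull r (cmap c z.1, z.2) = r z.
Proof. by move=> [Vz _]; rewrite /pull /= cmapK; [case: z {Vz} | apply: p_sub]. Qed.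

Lemma stdom_cinv y : stimg y -> stdom (cinv c y.1, y.2).
Proof. by case=> -[]. Qed.

Lemma eq_rst r (s : M * R -> R) : (forall z, stdom z -> r z = s z) -> rst r -> rst s.
Proof.
move=> e h k; apply: eq_Ck (h k); first exact: stimg_open.
by move=> z /stdom_cinv; apply: e.
Qed.

Lemma rst_cst (a : R) : rst (fun=> a).
Proof. by move=> k; apply: Ck_cst. Qed.

Lemma rstD r (s : M * R -> R) : rst r -> rst s -> rst (fun z => r z + s z).
Proof. by move=> h1 h2 k; apply: CkD; [exact: stimg_open | exact: h1 | exact: h2]. Qed.

Lemma rstM r (s : M * R -> R) : rst r -> rst s -> rst (fun z => r z * s z).
Proof. by move=> h1 h2 k; apply: CkM; [exact: stimg_open | exact: h1 | exact: h2]. Qed.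

Lemma rstN r : rst r -> rst (fun z => - r z).
Proof. by move=> h; apply: eq_rst (rstM (rst_cst (-1)) h) => z _; rewrite mulN1r. Qed.

Lemma rst_ln r : (forall z, stdom z -> 0 < r z) -> rst r -> rst (fun z => ln (r z)).
Proof.
move=> pos h k; apply: Ck_ln; [exact: stimg_open | by move=> z /stdom_cinv/pos | exact: h].
Qed.

Lemma rst_space (f : M -> R) : rsmooth_on V f -> rst (fun z => f z.1).
Proof.
move=> h k; apply: (Ck_fst stimg_open (U := cdomain c V) (f := fun x => f (cinv c x))).
  by move=> z [].
exact: h (p_atlas P) k.
Qed.

Lemma rst_time : rst (fun z => z.2).
Proof.
move=> k; apply: (@Ck_linear _ _ k stimg _ (fun z : 'rV[R]_m * R => z.2)) => //.
  by move=> z; apply: cvg_snd.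
exact: stimg_open.
Qed.

Lemma rsm_slice r t : 0 < t -> rst r -> rsmooth_on V (fun q => r (q, t)).
Proof.
move=> t0 h; apply: (chart_rsm (p_atlas P) (p_open P) cdomainV_open (@p_sub P)
  (g := fun x => pull r (x, t))).
- by move=> q Vq; apply: cdomain_cmap => //; apply: p_sub.
- by move=> k; apply: Ck_slice (h k) => //; exact: cdomainV_open.
- by move=> q Vq; rewrite /pull /= cmapK //; apply: p_sub.
Qed.

Definition tdir : 'rV[R]_m * R := (0, 1).
Definition xdir i : 'rV[R]_m * R := (bvec R i, 0).

Definition rdt r z : R := derive1 (fun s : R => r (z.1, s)) z.2.
Definition rdx i r z : R := cpart c i (fun q => r (q, z.2)) z.1.

Lemma rdt_is_derive r z : rst r -> stdom z -> is_derive z.2 1 (fun s : R => r (z.1, s)) (rdt r z).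
Proof.
move=> h Dz; have Iz := stimg_cmap Dz; have Vz : cdom c z.1 by apply: p_sub; case: Dz.
have := is_derive_sliceR (CkS_is_derive tdir (h 1%N) Iz).
rewrite /pull /= cmapK // => d; rewrite /rdt derive1E.
by apply: DeriveDef => //; case: d.
Qed.

Lemma pull_rdt r y : rst r -> stimg y -> pull (rdt r) y = 'D_tdir (pull r) y.
Proof.
move=> h Iz; rewrite /pull /rdt derive1E /=; case: y Iz => x t Iz /=.
by have [_ ->] := is_derive_sliceR (CkS_is_derive tdir (h 1%N) Iz).
Qed.

Lemma pull_rdx i r y : rst r -> stimg y -> pull (rdx i r) y = 'D_(xdir i) (pull r) y.
Proof.
move=> h Iz; rewrite /pull /rdx /cpart /=; case: y Iz => x t Iz /=; have [[ix _] _] := Iz.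
rewrite cinvK //.
by have [_ ->] := is_derive_sliceE (CkS_is_derive (xdir i) (h 1%N) Iz).
Qed.

Lemma rst_rdt r : rst r -> rst (rdt r).
Proof.
move=> h k; apply: eq_Ck (CkS_derive tdir (h k.+1)); first exact: stimg_open.
by move=> z Iz; rewrite pull_rdt.
Qed.

Lemma rst_rdx i r : rst r -> rst (rdx i r).
Proof.
move=> h k; apply: eq_Ck (CkS_derive (xdir i) (h k.+1)); first exact: stimg_open.
by move=> z Iz; rewrite pull_rdx.
Qed.

Lemma rdt_rdx i r z : rst r -> stdom z -> rdt (rdx i r) z = rdx i (rdt r) z.
Proof.
move=> h Dz; have Iz := stimg_cmap Dz.
rewrite -(pull_cmap (rdt (rdx i r)) Dz) -(pull_cmap (rdx i (rdt r)) Dz).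
transitivity ('D_tdir (pull (rdx i r)) (cmap c z.1, z.2)); first exact: (pull_rdt (rst_rdx i h) Iz).
transitivity ('D_(xdir i) (pull (rdt r)) (cmap c z.1, z.2)); last first.
  by symmetry; exact: (pull_rdx i (rst_rdt h) Iz).
have nI := open_nbhs_nbhs (conj stimg_open Iz).
transitivity ('D_tdir ('D_(xdir i) (pull r)) (cmap c z.1, z.2)).
  by apply: near_eq_derive; apply: filterS nI => y Iy; apply: pull_rdx.
rewrite (Ck_schwarz _ _ stimg_open (h 2%N) Iz).
by apply: near_eq_derive; apply: filterS nI => y Iy; rewrite pull_rdt.
Qed.

Lemma eq_st w w' : (forall z, stdom z -> w z = w' z) -> st w -> st w'.
Proof. by move=> e [h1 h2]; split; [apply: eq_rst h1 | apply: eq_rst h2] => z /e ->. Qed.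

Lemma st_cst (a : R[i]) : st (fun=> a). Proof. by split; apply: rst_cst. Qed.

Lemma stD w w' : st w -> st w' -> st (fun z => w z + w' z).
Proof.
move=> [a b] [d e]; split; first by apply: eq_rst (rstD a d) => z _; rewrite ReD.
by apply: eq_rst (rstD b e) => z _; rewrite ImD.
Qed.

Lemma stM w w' : st w -> st w' -> st (fun z => w z * w' z).
Proof.
move=> [a b] [d e]; split.
  by apply: eq_rst (rstD (rstM a d) (rstN (rstM b e))) => z _; rewrite ReM.
by apply: eq_rst (rstD (rstM a e) (rstM b d)) => z _; rewrite ImM.
Qed.

Lemma stN w : st w -> st (fun z => - w z).
Proof. by move=> h; apply: eq_st (stM (st_cst (-1)) h) => z _; rewrite mulN1r. Qed.

Lemma st_sum (I : Type) (l : seq I) (w : I -> M * R -> R[i]) : (forall j, st (w j)) ->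
  st (fun z => \sum_(j <- l) w j z).
Proof.
move=> h; elim: l => [|j l IH]; first by apply: eq_st (st_cst 0) => z _; rewrite big_nil.
by apply: eq_st (stD (h j) IH) => z _; rewrite big_cons.
Qed.

Lemma st_space (f : M -> R[i]) : smooth_on V f -> st (fun z => f z.1).
Proof.
move=> [h1 h2]; split.
  exact: (rst_space (f := fun q => complex.Re (f q))).
exact: (rst_space (f := fun q => complex.Im (f q))).
Qed.

Lemma st_real r : rst r -> st (fun z => (r z)%:C%C).
Proof. by move=> h; split=> //; apply: rst_cst. Qed.

Lemma sm_slice w t : 0 < t -> st w -> smooth_on V (fun q => w (q, t)).
Proof.
move=> t0 [h1 h2]; split; first exact: (rsm_slice (r := fun z => complex.Re (w z))).
exact: (rsm_slice (r := fun z => complex.Im (w z))).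
Qed.

Definition sdt w z : R[i] :=
  (rdt (fun z => complex.Re (w z)) z +i* rdt (fun z => complex.Im (w z)) z)%C.

Definition sapp X w z : R[i] := X z.1 (fun q => w (q, z.2)).

Lemma st_sdt w : st w -> st (sdt w).
Proof. by move=> [h1 h2]; split; apply: rst_rdt. Qed.

Lemma sapp_coord X w z : vfield_on V X -> st w -> stdom z ->
  sapp X w z = \sum_i X z.1 (crdC c i) * sapp (cdir c i) w z.
Proof.
move=> [tX _] hw [Vz tz]; apply: (tangent_coord (p_atlas P) (tX _ Vz)); first exact: p_sub.
by exists V; split=> //; [exact: p_open | exact: sm_slice].
Qed.

Lemma st_sapp X w : vfield_on V X -> st w -> st (sapp X w).
Proof.
move=> hX hw; have [h1 h2] := hw.
apply: (eq_st (w := fun z => \sum_i X z.1 (crdC c i) * sapp (cdir c i) w z)).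
  by move=> z Dz; rewrite [RHS]sapp_coord.
apply: st_sum => i; apply: stM.
  apply: (st_space (f := fun q => X q (crdC c i))).
  apply: vfield_app => //; first exact: p_open.
  by apply: sub_sm (sm_crdC (p_atlas P) i); apply: p_sub.
by split; [exact: rst_rdx h1 | exact: rst_rdx h2].
Qed.

Lemma sdt_local w w' z : (forall z, stdom z -> w z = w' z) -> stdom z -> sdt w z = sdt w' z.
Proof.
move=> e [Vz tz]; rewrite /sdt /rdt !derive1E; congr (_ +i* _)%C; apply: near_eq_derive;
  by apply: filterS (lt_nbhsr tz) => s s0; rewrite e.
Qed.

Lemma rdtE r z d : is_derive z.2 1 (fun s : R => r (z.1, s)) d -> rdt r z = d.
Proof. by move=> [_ <-]; rewrite /rdt derive1E. Qed.

Lemma sdtD w w' z : st w -> st w' -> stdom z -> sdt (fun z => w z + w' z) z = sdt w z + sdt w' z.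
Proof.
move=> [a b] [d e] Dz; have da := rdt_is_derive a Dz; have db := rdt_is_derive b Dz.
have dd := rdt_is_derive d Dz; have de := rdt_is_derive e Dz.
apply: complex_ext; rewrite ?ReD ?ImD /=; apply: rdtE.
  by under eq_fun do rewrite ReD; apply: is_deriveD.
by under eq_fun do rewrite ImD; apply: is_deriveD.
Qed.

Lemma sdtM w w' z : st w -> st w' -> stdom z ->
  sdt (fun z => w z * w' z) z = sdt w z * w' z + w z * sdt w' z.
Proof.
move=> [a b] [d e] Dz; have da := rdt_is_derive a Dz; have db := rdt_is_derive b Dz.
have dd := rdt_is_derive d Dz; have de := rdt_is_derive e Dz.
have ez : z = (z.1, z.2) by case: (z).
apply: complex_ext; rewrite ?ReD ?ImD ?ReM ?ImM /=; apply: rdtE.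
  under eq_fun do rewrite ReM.
  apply: is_derive_eq (is_deriveB (is_deriveM da dd) (is_deriveM db de)) _.
  by rewrite -ez -![_ *: _]/(_ * _); ring.
under eq_fun do rewrite ImM.
apply: is_derive_eq (is_deriveD (is_deriveM da de) (is_deriveM db dd)) _.
by rewrite -ez -![_ *: _]/(_ * _); ring.
Qed.

Lemma sdt_space (f : M -> R[i]) z : sdt (fun z => f z.1) z = 0.
Proof. by apply: complex_ext; rewrite /= /rdt derive1E /=; exact: derive_cst. Qed.

(** In coordinates X has coefficients independent of time, so the claim reduces to symmetry of
    second derivatives in the time and coordinate directions. *)
Lemma sdt_sapp X w z : vfield_on V X -> st w -> stdom z -> sdt (sapp X w) z = sapp X (sdt w) z.
Proof.
move=> hX hw Dz; rewrite (sapp_coord hX (st_sdt hw) Dz).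
rewrite (sdt_local (w' := fun z => \sum_i X z.1 (crdC c i) * sapp (cdir c i) w z)) //; last first.
  by move=> y Dy; apply: sapp_coord.
have sX i : st (fun z => X z.1 (crdC c i)).
  apply: (st_space (f := fun q => X q (crdC c i))); apply: vfield_app => //; first exact: p_open.
  by apply: sub_sm (sm_crdC (p_atlas P) i); apply: p_sub.
have [h1 h2] := hw.
have sc i : st (sapp (cdir c i) w) by split; [exact: rst_rdx h1 | exact: rst_rdx h2].
elim: (index_enum _) => [|i l IH].
  rewrite big_nil; transitivity (sdt (fun=> 0) z); last exact: (sdt_space (fun=> 0)).
  by apply: sdt_local Dz => y _; rewrite big_nil.
pose w1 z := X z.1 (crdC c i); pose w2 := sapp (cdir c i) w.
pose w3 z := \sum_(j <- l) X z.1 (crdC c j) * sapp (cdir c j) w z.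
have s3 : st w3 by apply: st_sum => j; apply: stM.
transitivity (sdt (fun z => w1 z * w2 z + w3 z) z).
  by apply: sdt_local Dz => y _; rewrite big_cons.
have e1 : sdt w1 z = 0 by exact: (sdt_space (fun q => X q (crdC c i)) z).
have e2 : sdt w2 z = sapp (cdir c i) (sdt w) z.
  by apply: complex_ext; [exact: rdt_rdx h1 Dz | exact: rdt_rdx h2 Dz].
rewrite (sdtD (stM (sX i) (sc i)) s3 Dz) (sdtM (sX i) (sc i) Dz) IH big_cons -/w1 -/w2 e1 e2.
by rewrite mul0r add0r.
Qed.

(* Extending by zero outside [stdom] makes Leibniz equality of elements of the ring [sfun] the
   equality of functions on [stdom]. *)
Record sfun := SFun { sval : M * R -> R[i]; svalP : st sval /\ forall z, ~ stdom z -> sval z = 0 }.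

Lemma sfun_ext (f g : sfun) : (forall z, stdom z -> sval f z = sval g z) -> f = g.
Proof.
case: f g => f [hf f0] [g [hg g0]] /= e.
have fg : f = g.
  by apply/funext => z; case: (pselect (stdom z)) => [/e|n] //; rewrite f0 // g0.
by move: hf f0 hg g0; rewrite fg => *; congr SFun; apply: Prop_irrelevance.
Qed.

Lemma mks_subproof w : st w -> st (fun z => if `[< stdom z >] then w z else 0) /\
  forall z, ~ stdom z -> (if `[< stdom z >] then w z else 0) = 0.
Proof.
move=> h; split; last by move=> z; case: asboolP.
by apply: eq_st h => z Dz; case: asboolP.
Qed.

Definition mks w (h : st w) : sfun := SFun (mks_subproof h).

Lemma mksE w (h : st w) z : stdom z -> sval (mks h) z = w z.
Proof. by move=> Dz /=; case: asboolP. Qed.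

Lemma st_sval (f : sfun) : st (sval f). Proof. by case: f => f []. Qed.

HB.instance Definition _ := gen_eqMixin sfun.
HB.instance Definition _ := gen_choiceMixin sfun.

Definition sadd (f g : sfun) : sfun := mks (stD (st_sval f) (st_sval g)).
Definition sopp (f : sfun) : sfun := mks (stN (st_sval f)).
Definition smul (f g : sfun) : sfun := mks (stM (st_sval f) (st_sval g)).
Definition scst (a : R[i]) : sfun := mks (st_cst a).

Lemma saddA : associative sadd.
Proof. by move=> f g h; apply: sfun_ext => z Dz; rewrite !mksE // addrA. Qed.
Lemma saddC : commutative sadd.
Proof. by move=> f g; apply: sfun_ext => z Dz; rewrite !mksE // addrC. Qed.
Lemma sadd0 : left_id (scst 0) sadd.
Proof. by move=> f; apply: sfun_ext => z Dz; rewrite !mksE // add0r. Qed.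
Lemma saddN : left_inverse (scst 0) sopp sadd.
Proof. by move=> f; apply: sfun_ext => z Dz; rewrite !mksE // addNr. Qed.

HB.instance Definition _ := GRing.isZmodule.Build sfun saddA saddC sadd0 saddN.

Lemma smulA : associative smul.
Proof. by move=> f g h; apply: sfun_ext => z Dz; rewrite !mksE // mulrA. Qed.
Lemma smulC : commutative smul.
Proof. by move=> f g; apply: sfun_ext => z Dz; rewrite !mksE // mulrC. Qed.
Lemma smul1 : left_id (scst 1) smul.
Proof. by move=> f; apply: sfun_ext => z Dz; rewrite !mksE // mul1r. Qed.
Lemma smulDl : left_distributive smul sadd.
Proof. by move=> f g h; apply: sfun_ext => z Dz; rewrite !mksE // mulrDl. Qed.

HB.instance Definition _ := GRing.Zmodule_isComPzRing.Build sfun smulA smulC smul1 smulDl.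

Section Evaluation.
Variables (z : M * R) (Dz : stdom z).
Implicit Types f g : sfun.

Lemma svalD f g : sval (f + g) z = sval f z + sval g z. Proof. exact: mksE. Qed.
Lemma svalM f g : sval (f * g) z = sval f z * sval g z. Proof. exact: mksE. Qed.
Lemma svalN f : sval (- f) z = - sval f z. Proof. exact: mksE. Qed.
Lemma svalB f g : sval (f - g) z = sval f z - sval g z. Proof. by rewrite svalD svalN. Qed.
Lemma sval0 : sval 0 z = 0. Proof. exact: mksE. Qed.
Lemma sval1 : sval 1 z = 1. Proof. exact: mksE. Qed.

Lemma sval_sum (I : Type) (l : seq I) (f : I -> sfun) :
  sval (\sum_(j <- l) f j) z = \sum_(j <- l) sval (f j) z.
Proof. exact: (big_morph (fun f => sval f z) svalD sval0). Qed.

Lemma svalMn f k : sval (f *+ k) z = sval f z *+ k.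
Proof. by elim: k => [|k IH]; rewrite ?mulr0n ?sval0 // !mulrS svalD IH. Qed.

Lemma sval_nat k : sval k%:R z = k%:R. Proof. by rewrite svalMn sval1. Qed.

End Evaluation.

Definition svf X (hX : vfield_on V X) (f : sfun) : sfun := mks (st_sapp hX (st_sval f)).
Definition sD (f : sfun) : sfun := mks (st_sdt (st_sval f)).

Lemma svfE X (hX : vfield_on V X) f z : stdom z -> sval (svf hX f) z = X z.1 (fun q => sval f (q, z.2)).
Proof. by move=> Dz; rewrite mksE. Qed.

Lemma smooth_at_sval f z : stdom z -> smooth_at z.1 (fun q => sval f (q, z.2)).
Proof. by move=> [Vz tz]; exists V; split=> //; [exact: p_open | apply: sm_slice => //; apply: st_sval]. Qed.

Lemma vf_slice X w f z : vfield_on V X -> stdom z -> (forall z, stdom z -> sval f z = w z) ->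
  X z.1 (fun q => sval f (q, z.2)) = X z.1 (fun q => w (q, z.2)).
Proof.
move=> [tX _] Dz e; have [Vz tz] := Dz.
apply: (tangent_local (tX _ Vz) (p_open P) Vz (smooth_at_sval f Dz)) => q Vq.
by apply: e.
Qed.

Lemma svfD X (hX : vfield_on V X) f g : svf hX (f + g) = svf hX f + svf hX g.
Proof.
apply: sfun_ext => z Dz; rewrite svalD // !svfE // -(tangentD (proj1 hX _ (proj1 Dz))).
- by apply: (vf_slice (w := fun z => sval f z + sval g z)) => // y Dy; rewrite svalD.
- exact: smooth_at_sval.
- exact: smooth_at_sval.
Qed.

Lemma svfM X (hX : vfield_on V X) f g : svf hX (f * g) = svf hX f * g + f * svf hX g.
Proof.
apply: sfun_ext => z Dz; rewrite svalD // !svalM // !svfE //.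
have := tangent_leibniz (proj1 hX _ (proj1 Dz)) (smooth_at_sval f Dz) (smooth_at_sval g Dz).
rewrite -!surjective_pairing => <-.
by apply: (vf_slice (w := fun z => sval f z * sval g z)) => // y Dy; rewrite svalM.
Qed.

Lemma sDD f g : sD (f + g) = sD f + sD g.
Proof.
apply: sfun_ext => z Dz; rewrite svalD // !mksE // -sdtD //; try exact: st_sval.
by apply: sdt_local Dz => y Dy; rewrite svalD.
Qed.

Lemma sDM f g : sD (f * g) = sD f * g + f * sD g.
Proof.
apply: sfun_ext => z Dz; rewrite svalD // !svalM // !mksE // -sdtM //; try exact: st_sval.
by apply: sdt_local Dz => y Dy; rewrite svalM.
Qed.

Lemma sD_svf X (hX : vfield_on V X) f : sD (svf hX f) = svf hX (sD f).
Proof.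
apply: sfun_ext => z Dz; rewrite svfE // (vf_slice (w := sdt (sval f))) //; last first.
  by move=> y Dy; rewrite mksE.
rewrite -[RHS]/(sapp X (sdt (sval f)) z) -sdt_sapp //; last exact: st_sval.
by rewrite mksE //; apply: sdt_local Dz => y Dy; rewrite mksE.
Qed.

Definition sspace (f : M -> R[i]) (hf : smooth_on V f) : sfun := mks (st_space hf).

Lemma sD_space f (hf : smooth_on V f) : sD (sspace hf) = 0.
Proof.
apply: sfun_ext => z Dz; rewrite sval0 // mksE // -(sdt_space f z).
by apply: sdt_local Dz => y Dy; rewrite mksE.
Qed.

Lemma svf_time X (hX : vfield_on V X) (g : R -> R[i]) f :
  (forall z, stdom z -> sval f z = g z.2) -> svf hX f = 0.
Proof.
move=> e; apply: sfun_ext => z Dz; rewrite sval0 // svfE // (vf_slice (w := fun z => g z.2)) //=.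
exact: (tangent_cst _ (proj1 hX _ (proj1 Dz))).
Qed.

End SpacetimeFunctions.

Arguments sval : simpl never.

(** * A unitary frame of a torsion-free Tanaka-Webster connection as a [crframe] *)

Section TanakaWebsterFrame.
Variables (R : realType) (n : nat) (M : pseudohermitian R n) (nabla : tanaka_webster M).
Hypothesis torsion0 : vanishing_torsion nabla.
Variables (P : patch M) (Z : 'I_n -> vfield M) (th : 'I_n -> oneform M).
Hypothesis uf : unitary_frame (pset P) Z th.
Local Notation V := (pset P).
Local Notation th0 := (@theta R n M).
Implicit Types (i j k : frame_index n) (a b d : 'I_n) (p q : M) (v : tvec M) (X Y : vfield M).

Lemma vf_app_tveq U X X' Y Y' p f : open U -> U p -> vfield_on U X -> vfield_on U X' ->
  vfield_on U Y -> vfield_on U Y' -> (forall q, U q -> tveq q (X q) (X' q)) ->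
  (forall q, U q -> tveq q (Y q) (Y' q)) -> smooth_at p f ->
  X p (fun q => Y q f) = X' p (fun q => Y' q f).
Proof.
move=> oU Up hX hX' hY hY' eX eY [W [oW Wp hf]].
have oWU : open (W `&` U) by apply: openI.
have hf' : smooth_on (W `&` U) f by apply: sub_sm hf => x [].
have sY : smooth_at p (fun q => Y q f).
  by exists (W `&` U); split=> //; apply: (proj2 hY) => // x [].
rewrite eX //; apply: (tangent_local (proj1 hX' p Up) oWU) => // q [Wq Uq].
by apply: eY => //; exists W.
Qed.

Lemma bracket_tveq U X X' Y Y' p : open U -> U p -> vfield_on U X -> vfield_on U X' ->
  vfield_on U Y -> vfield_on U Y' -> (forall q, U q -> tveq q (X q) (X' q)) ->
  (forall q, U q -> tveq q (Y q) (Y' q)) -> tveq p (bracket X Y p) (bracket X' Y' p).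
Proof.
move=> oU Up hX hX' hY hY' eX eY f hf; rewrite /bracket.
rewrite (vf_app_tveq oU Up hX hX' hY hY' eX eY hf).
by rewrite (vf_app_tveq oU Up hY hY' hX hX' eY eX hf).
Qed.

Definition frv i : vfield M := match i with
  inl (inl a) => Z a | inl (inr a) => fconj (Z a) | inr _ => @reeb R n M end.

Definition cofr i : oneform M := match i with
  inl (inl a) => th a | inl (inr a) => form_conj (th a) | inr _ => th0 end.

Lemma vfield_frv i : vfield_on V (frv i).
Proof.
case: i => [[a|a]|[]] /=; first by have [] := uf_T10 uf a.
  by apply: vfield_fconj; [exact: p_open | have [] := uf_T10 uf a].
exact: vfield_reeb.
Qed.

Lemma tangent_frv i p : V p -> tangent p (frv i p).
Proof. exact: (proj1 (vfield_frv i)). Qed.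

Lemma covector_cofr i p : V p -> covector p (cofr i p).
Proof.
move=> Vp; case: i => [[a|a]|[]] /=; first exact: covector_form (uf_form uf a) Vp.
  exact: covector_conj (covector_form (uf_form uf a) Vp).
exact: theta_covector.
Qed.

Lemma frv_isw i p : tveq p (tconj (frv i p)) (frv (isw i) p).
Proof.
case: i => [[a|a]|[]] f hf //=; first by rewrite [fconj _]/fconj tconjK.
exact: (@reeb_real R n M).
Qed.

Lemma cofr_dual i j p : V p -> cofr j p (frv i p) = (i == j)%:R.
Proof.
move=> Vp; have tT a : theta p (Z a p) = 0 by have [_ /(_ p Vp) [[]]] := uf_T10 uf a.
have tt a : tangent p (Z a p) := tangent_frv (iZ a) Vp.
case: i j => [[a|a]|[]] [[b|b]|[]] //=.
- exact: uf_dual uf _ _ _ Vp.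
- by rewrite /form_conj (uf_dualC uf) // conjC0.
- exact: uf_dualC uf _ _ _ Vp.
- by rewrite /form_conj /fconj tconjK (uf_dual uf) // -[inl (inr a) == _]/(a == b); exact: conjC_nat.
- by rewrite /fconj (@theta_real R n M) // tT conjC0.
- exact: uf_dualT uf _ _ Vp.
- rewrite /form_conj (covector_tveq (covector_form (uf_form uf b) Vp) _ _ (@frv_isw (iT n) p)).
  + by rewrite (uf_dualT uf) // conjC0.
  + by apply: tangent_tconj; apply: tangent_reeb.
  + exact: tangent_reeb.
- exact: theta_reeb.
Qed.

Lemma frame_span p v f : V p -> tangent p v -> smooth_at p f ->
  v f = \sum_k cofr k p v * frv k p f.
Proof.
move=> Vp; apply: (dual_system_span (e := fun k => frv k p) (phi := fun k => cofr k p)).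
- by rewrite card_frame_index.
- by move=> k; apply: tangent_frv.
- by move=> k; apply: covector_cofr.
- by move=> k l; apply: cofr_dual.
Qed.

Definition omega p i a b : R[i] := conn_form nabla Z th a b p (frv i p).

(** [nabla_smooth] gives tangency of the covariant derivative only along fields, so a tangent vector
    at [p] is extended by the field with the same constant coefficients in the frame. *)
Lemma covector_omega a b p : V p -> covector p (conn_form nabla Z th a b p).
Proof.
move=> Vp s u v w tu tv tw e; pose nb : covder M := nabla; have hZ := vfield_frv (iZ a); have oV := p_open P.
have tn x : tangent p x -> tangent p (nb p x (Z a)).
  move=> tx.
  have ex : exists X, vfield_on V X /\ tveq p (X p) x.
    exists (fun q => tsum (index_enum _) (fun k => cofr k p x) (fun k => frv k q)); split.
      apply: vfield_tsum => // k; [exact: sm_cst | exact: vfield_frv].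
    by move=> f hf; rewrite /tsum -frame_span.
  have [X [hX eX]] := ex.
  have [tX _] := @nabla_smooth R n M nabla V X (Z a) oV hX hZ.
  have hx : tveq p (nb p x (Z a)) (nb p (X p) (Z a)).
    have eX' : tveq p x (tlin 0 (X p) (X p)).
      by move=> g hg; rewrite /tlin mul0r add0r eX.
    have := @nabla_linear R n M nabla V (Z a) p 0 x (X p) (X p) oV Vp hZ tx
      (proj1 hX p Vp) (proj1 hX p Vp) eX'.
    by move=> h f hf; rewrite [LHS]h // /tlin mul0r add0r.
  split=> [r f g hf hg|f g hf hg]; rewrite !hx //.
  - exact: (tangent_linear (tX p Vp)).
  - by apply: smooth_atD => //; apply: smooth_atM => //; apply: smooth_at_cst.
  - exact: (tangent_leibniz (tX p Vp)).
  - exact: smooth_atM.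
rewrite /conn_form; apply: (covector_form (uf_form uf b) Vp); [exact: tn|exact: tn|exact: tn|].
exact: (@nabla_linear R n M nabla V (Z a) p).
Qed.

(** The derivative terms of [dform] act on constants and vanish. Through this lemma the structure
    equations determine the brackets of frame fields. *)
Lemma form_const_bracket eta (x y : R[i]) X Y p : form_on V eta -> V p -> vfield_on V X ->
  vfield_on V Y -> (forall q, V q -> eta q (X q) = x) -> (forall q, V q -> eta q (Y q) = y) ->
  eta p (bracket X Y p) = - dform eta X Y p.
Proof.
move=> fe Vp hX hY eX eY; have oV := p_open P.
have c (A : vfield M) (h : M -> R[i]) s : vfield_on V A -> (forall q, V q -> h q = s) -> A p h = 0.
  move=> hA e; rewrite -(tangent_cst s (proj1 hA p Vp)).
  by symmetry; apply: (tangent_local (proj1 hA p Vp) oV Vp (smooth_at_cst p s)) => q /e.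
by rewrite /dform (c X _ y hX eY) (c Y _ x hY eX) subrr add0r opprK.
Qed.

(** Integrability handles two fields of the same type, the equation d theta (T, .) = 0 the Reeb
    field, and h = delta the mixed brackets. *)
Lemma theta_bracket i j p : V p ->
  th0 p (bracket (frv i) (frv j) p) = frame_bracket (omega p) 'i i j (iT n).
Proof.
move=> Vp; have oV := p_open P; have fe := @theta_form_on R n M V.
have cst k q : V q -> th0 q (frv k q) = (k == iT n)%:R by move=> Vq; exact: (cofr_dual k (iT n) Vq).
have bd k l : th0 p (bracket (frv k) (frv l) p) = - dform th0 (frv k) (frv l) p.
  exact: (form_const_bracket fe Vp (vfield_frv k) (vfield_frv l) (cst k) (cst l)).
have ZZ a d : th0 p (bracket (Z a) (Z d) p) = 0.
  by have [_ /(_ p Vp) [[]]] := J_integrable oV (uf_T10 uf a) (uf_T10 uf d).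
have T0 k : dform th0 (frv (iT n)) (frv k) p = 0.
  exact: (dtheta_reeb oV Vp (vfield_frv k)).
case: i j => [[a|a]|[]] [[d|d]|[]] //=.
- by have := bd (iZ a) (iW d) => /= ->; rewrite (uf_unitary uf) // mulr_natr.
- have := bd (iZ a) (iT n) => /= ->.
  by rewrite (dformC fe oV Vp (vfield_frv (iT n)) (vfield_frv (iZ a))) (T0 (iZ a)) !oppr0.
- have := bd (iW a) (iZ d) => /= ->.
  by rewrite (dformC fe oV Vp (vfield_frv (iZ d)) (vfield_frv (iW a))) opprK (uf_unitary uf) // mulr_natr.
- rewrite bracket_fconj /fconj (@theta_real R n M) ?ZZ ?conjC0 //.
  exact: (proj1 (vfield_bracket oV (vfield_frv (iZ a)) (vfield_frv (iZ d)))).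
- have := bd (iW a) (iT n) => /= ->.
  by rewrite (dformC fe oV Vp (vfield_frv (iT n)) (vfield_frv (iW a))) (T0 (iW a)) !oppr0.
- by have := bd (iT n) (iZ d) => /= ->; rewrite (T0 (iZ d)) oppr0.
- by have := bd (iT n) (iW d) => /= ->; rewrite (T0 (iW d)) oppr0.
- by have := bd (iT n) (iT n) => /= ->; rewrite (T0 (iT n)) oppr0.
Qed.

(** The first structure equation with A = 0, evaluated on frame fields. The barred components follow
    later by conjugation and skewness of omega. *)
Lemma th_bracket i j b p : V p ->
  th b p (bracket (frv i) (frv j) p) = frame_bracket (omega p) 'i i j (iZ b).
Proof.
move=> Vp; have oV := p_open P; have [A hA] := @nabla_torsion R n M nabla V Z th uf.
have A0 := torsion0 uf hA; have [_ tor] := hA.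
have cst k q : V q -> th b q (frv k q) = (k == iZ b)%:R by move=> Vq; exact: (cofr_dual k (iZ b) Vq).
rewrite (form_const_bracket (uf_form uf b) Vp (vfield_frv i) (vfield_frv j) (cst i) (cst j)).
rewrite (tor b V (frv i) (frv j) p oV (@subset_refl _ V) Vp (vfield_frv i) (vfield_frv j)).
have t0 v : form_conj (tau_form th A b) p v = 0.
  by rewrite /form_conj /tau_form big1 ?conjC0 // => d _; rewrite A0 // mul0r.
rewrite /form_wedge !t0 !mulr0 subrr addr0.
have thE a k : th a p (frv k p) = (k == iZ a)%:R by exact: (cofr_dual k (iZ a) Vp).
under eq_bigr do rewrite !thE -/(omega p _ _ _) -/(omega p j _ _).
have s0 (F : 'I_n -> R[i]) : \sum_a false%:R * F a = 0 by rewrite big1 // => a _; rewrite mul0r.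
have s1 (F : 'I_n -> R[i]) a : \sum_d (iZ a == iZ d)%:R * F d = F a.
  rewrite (bigD1 a) //= eqxx mul1r big1 ?addr0 // => d ad.
  by rewrite -[iZ a == iZ d]/(a == d) eq_sym (negbTE ad) mul0r.
rewrite sumrB; case: i j => [[a|a]|[]] [[d|d]|[]] //=; rewrite ?(s1 _ a) ?(s1 _ d) ?s0 ?subr0 ?sub0r
  ?opprK ?oppr0 ?opprB //.
Qed.

Lemma omega_skew i a b p : V p -> (omega p (isw i) a b)^* = - omega p i b a.
Proof.
move=> Vp; have ti := tangent_frv i Vp.
have := @nabla_skew R n M nabla V Z th b a p _ uf Vp ti.
rewrite /form_conj (covector_tveq (covector_omega a b Vp) _ _ (@frv_isw i p)); last 2 first.
- exact: tangent_tconj.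
- exact: tangent_frv.
by move=> /eqP; rewrite addrC addr_eq0 => /eqP.
Qed.

Lemma cofr_bracket i j k p : V p ->
  cofr k p (bracket (frv i) (frv j) p) = frame_bracket (omega p) 'i i j k.
Proof.
move=> Vp; case: k => [[b|b]|[]]; [exact: th_bracket | | exact: theta_bracket].
rewrite /= /form_conj; have oV := p_open P.
have -> : tconj (bracket (frv i) (frv j) p) = bracket (fconj (frv i)) (fconj (frv j)) p.
  by rewrite bracket_fconj.
have vc k := vfield_fconj oV (vfield_frv k).
rewrite (covector_tveq (covector_form (uf_form uf b) Vp) _ _ (bracket_tveq (U := V)
  (X' := frv (isw i)) (Y' := frv (isw j)) oV Vp (vc i) (vfield_frv _) (vc j) (vfield_frv _) _ _)).
- rewrite th_bracket //.
  have cjB (x y : R[i]) : (x - y)^* = x^* - y^* by exact: rmorphB.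
  have cjN (x : R[i]) : (- x)^* = - x^* by exact: rmorphN.
  have sk k a d := omega_skew k a d Vp.
  case: i j => [[a|a]|[]] [[d|d]|[]] //=; rewrite ?conjC0 // ?cjB ?cjN.
  + exact: (sk (iZ a)).
  + by rewrite (sk (iZ d)) opprK.
  + by rewrite (sk (iW a)) (sk (iW d)); ring.
  + by rewrite (sk (iT n)) opprK.
  + exact: (sk (iT n)).
- exact: (proj1 (vfield_bracket oV (vc i) (vc j))).
- exact: (proj1 (vfield_bracket oV (vfield_frv _) (vfield_frv _))).
- by move=> q _; apply: frv_isw.
- by move=> q _; apply: frv_isw.
Qed.

Lemma sm_omega i a b : smooth_on V (fun q => omega q i a b).
Proof.
have oV := p_open P; have hZ := vfield_frv (iZ a).
exact: (sm_form (uf_form uf b) oV (@nabla_smooth R n M nabla V _ _ oV (vfield_frv i) hZ)).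
Qed.

Definition somega i a b : sfun P := sspace (sm_omega i a b).
Definition sim : sfun P := sspace (sm_cst V 'i).

Lemma sval_frame_bracket i j k z : stdom P z ->
  sval (frame_bracket somega sim i j k) z = frame_bracket (omega z.1) 'i i j k.
Proof.
move=> Dz; have so l a b : sval (somega l a b) z = omega z.1 l a b by exact: mksE.
have si : sval sim z = 'i by exact: mksE.
by case: i j k => [[a|a]|[]] [[d|d]|[]] [[b|b]|[]] //=;
  rewrite ?(svalB Dz) ?(svalN Dz) ?(svalMn Dz) ?so ?si ?(sval0 Dz).
Qed.

Definition crf : crframe n (sfun P).
Proof.
refine (@CRFrame n (sfun P) (fun i => svf (vfield_frv i)) somega sim (@sD _ _ _ P)
  (fun i => svfD _) (fun i => svfM _) (@sDD _ _ _ P) (@sDM _ _ _ P) _ _ _ _ _ _).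
- by move=> i; apply: (svf_time _ (g := fun=> 'i)) => z Dz; rewrite mksE.
- exact: sD_space.
- by move=> i a b; apply: sD_space.
- by move=> i x; apply: sD_svf.
- move=> i j x; apply: sfun_ext => z Dz; rewrite (svalB Dz) (sval_sum Dz) !svfE //.
  have app k l : frv k z.1 (fun q => sval (svf (vfield_frv l) x) (q, z.2)) =
      frv k z.1 (fun q => frv l q (fun q' => sval x (q', z.2))).
    apply: (vf_slice (w := fun y => frv l y.1 (fun q' => sval x (q', y.2))) (vfield_frv k) Dz).
    by move=> y Dy; rewrite svfE.
  rewrite !app -[LHS]/(bracket (frv i) (frv j) z.1 _) (frame_span (proj1 Dz)).
  + by apply: eq_bigr => k _; rewrite (svalM Dz) sval_frame_bracket // svfE // cofr_bracket //; case: Dz.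
  + exact: (proj1 (vfield_bracket (p_open P) (vfield_frv i) (vfield_frv j)) _ (proj1 Dz)).
  + exact: smooth_at_sval.
(* The relation is tested on the coordinate functions of the chart, which belong to the ring and
   determine a tangent vector; the coframe then extracts each coefficient. *)
- move=> y h l; apply: sfun_ext => z Dz; rewrite (sval0 Dz); have Vz := proj1 Dz.
  have ac := p_atlas P; have cz : cdom (pchart P) z.1 by apply: p_sub.
  pose u := tsum (index_enum _) (fun k => sval (y k) z) (fun k => frv k z.1).
  have tu : tangent z.1 u by apply: tangent_tsum => k; apply: tangent_frv.
  have scr (l0 : 'I_(n.*2.+1)) := sub_sm (@p_sub _ _ _ P) (sm_crdC ac l0).
  have u0 (l0 : 'I_(n.*2.+1)) : u (crdC (pchart P) l0) = 0.
    rewrite -[RHS](sval0 Dz) -(h (sspace (scr l0))) (sval_sum Dz); apply: eq_bigr => k _.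
    rewrite (svalM Dz) svfE // (vf_slice (w := fun y => crdC (pchart P) l0 y.1) (vfield_frv k) Dz) //.
    by move=> w Dw; rewrite mksE.
  have uz : tveq z.1 u (@tzero R _ M).
    move=> f hf; rewrite (tangent_coord ac tu cz hf) big1 // => i _.
    by rewrite u0 mul0r.
  have := covector0 (covector_cofr l Vz) tu uz.
  rewrite (covector_tsum (v := fun k => frv k z.1) (covector_cofr l Vz) tu (fun k => tangent_frv k Vz) (fun _ _ => erefl)).
  rewrite (bigD1 l) //= cofr_dual // eqxx mulr1 big1 ?addr0 // => k kl.
  by rewrite cofr_dual // (negbTE kl) mulr0.
Defined.

Arguments frv : simpl never.

Section Evaluation.
Variables (x : sfun P) (z : M * R).
Hypothesis Dz : stdom P z.
Local Notation slice := (fun q => sval x (q, z.2)).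

Lemma sval_fe i : sval (fe crf i x) z = frv i z.1 slice.
Proof. exact: svfE. Qed.

Lemma sval_fe2 i j : sval (fe crf i (fe crf j x)) z = frv i z.1 (fun q => frv j q slice).
Proof.
rewrite svfE //.
apply: (vf_slice (w := fun y => frv j y.1 (fun q' => sval x (q', y.2))) (vfield_frv i) Dz).
by move=> y Dy; rewrite svfE.
Qed.

Lemma sval_fw i a b : sval (fw crf i a b) z = omega z.1 i a b.
Proof. exact: mksE. Qed.

Lemma sval_ric a b : sval (ric crf a b) z = ricci nabla Z th a b z.1.
Proof.
rewrite /ric (sval_sum Dz) /ricci; apply: eq_bigr => d _; rewrite /curvature /dform /Rm.
have Vz := proj1 Dz; have oV := p_open P.
have ew i j a' b' : sval (fe crf i (fw crf j a' b')) z = frv i z.1 (fun q => omega q j a' b').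
  rewrite svfE // (vf_slice (w := fun y => omega y.1 j a' b') (vfield_frv i) Dz) //.
  by move=> y Dy; rewrite mksE.
rewrite !(svalB Dz) !ew !(sval_sum Dz); congr (_ - _ - _ - _).
  have tb := proj1 (vfield_bracket oV (vfield_frv (iZ a)) (vfield_frv (iW b))) _ Vz.
  rewrite (covector_tsum (l := index_enum _) (v := fun k => frv k z.1)
    (a := fun k => cofr k z.1 (bracket (Z a) (fconj (Z b)) z.1)) (covector_omega d d Vz) tb).
  - apply: eq_bigr => k _; rewrite (svalM Dz) sval_fw; congr (_ * _).
    by rewrite [LHS]sval_frame_bracket // -cofr_bracket.
  - by move=> k; apply: tangent_frv.
  - by move=> f hf; apply: frame_span.
by apply: eq_bigr => e _; rewrite (svalB Dz) !(svalM Dz) !sval_fw.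
Qed.

Lemma sval_lap : sval (lap crf x) z = sublaplacian nabla Z th slice z.1.
Proof.
rewrite /lap (sval_sum Dz); apply: eq_bigr => a _; rewrite (svalD Dz) /hessW /cov /grad /=.
have e1 i : sval (svf (vfield_frv i) x) z = _ := sval_fe i.
have e2 i j : sval (svf (vfield_frv i) (svf (vfield_frv j) x)) z = _ := sval_fe2 i j.
rewrite !(svalB Dz) !(sval_sum Dz) !e2; congr (_ - _ + (_ - _)).
  by apply: eq_bigr => b _; rewrite (svalM Dz) e1; congr (_ * _); exact: mksE.
apply: eq_bigr => b _; rewrite (svalM Dz) e1 (svalN Dz) mksE //.
congr (_ * _); have Vz := proj1 Dz; rewrite -(omega_skew (iZ a) a b Vz) /form_conj.
by congr (_^*).
Qed.

Lemma sval_gpair : sval (gpair crf x x) z = subgrad_sq Z slice z.1.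
Proof.
rewrite gpair_diag (svalM Dz) (sval_nat Dz) /grad_sq (sval_sum Dz) /subgrad_sq; congr (_ * _).
apply: eq_bigr => a _; rewrite (svalM Dz).
by congr (_ * _); [exact: (sval_fe (iZ a)) | exact: (sval_fe (iW a))].
Qed.

End Evaluation.

End TanakaWebsterFrame.

(** * The maximum principle *)

Section LocalEstimate.
Variables (R : realType) (n : nat) (M : pseudohermitian R n) (nabla : tanaka_webster M).
Hypothesis torsion0 : vanishing_torsion nabla.
Variables (P : patch M) (Z : 'I_n -> vfield M) (th : 'I_n -> oneform M).
Hypothesis uf : unitary_frame (pset P) Z th.
Local Notation V := (pset P).
Local Notation F := (crf torsion0 uf).
Local Notation e := (fe F).
Implicit Types (i j : frame_index n) (a b : 'I_n) (f x y : sfun P) (z : M * R).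

Lemma st_conj x : st P (fun z => (sval x z)^*).
Proof.
have [h1 h2] := st_sval x; split; first by apply: eq_rst h1 => z _; rewrite ReJ.
by apply: eq_rst (rstN h2) => z _; rewrite ImJ.
Qed.

(** Conjugation of values links the algebra to real functions: on an element fixed by [scj], passing
    from [F] to [swap F] conjugates gradient and Hessian. *)
Definition scj x : sfun P := mks (st_conj x).

Lemma scjE x z : sval (scj x) z = (sval x z)^*.
Proof.
have [Dz|nDz] := pselect (stdom P z); first exact: mksE.
by rewrite !(proj2 (svalP _)) // conjC0.
Qed.

Lemma scjK : involutive scj.
Proof. by move=> x; apply: sfun_ext => z _; rewrite !scjE cjK. Qed.

Lemma scjD x y : scj (x + y) = scj x + scj y.
Proof. by apply: sfun_ext => z Dz; rewrite (svalD Dz) !scjE (svalD Dz) cjD. Qed.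

Lemma scjM x y : scj (x * y) = scj x * scj y.
Proof. by apply: sfun_ext => z Dz; rewrite (svalM Dz) !scjE (svalM Dz) cjM. Qed.

Lemma scjN x : scj (- x) = - scj x.
Proof. by apply: sfun_ext => z Dz; rewrite (svalN Dz) !scjE (svalN Dz); exact: rmorphN. Qed.

Lemma scj_sum (I : Type) (l : seq I) (G : I -> sfun P) :
  scj (\sum_(k <- l) G k) = \sum_(k <- l) scj (G k).
Proof.
apply: (big_morph scj scjD); apply: sfun_ext => z Dz.
by rewrite scjE (sval0 Dz) conjC0.
Qed.

Lemma scj_fe i x : scj (e i x) = e (isw i) (scj x).
Proof.
apply: sfun_ext => z Dz; rewrite scjE !sval_fe // -(frv_isw Z i (smooth_at_sval _ Dz)) /tconj.
by congr ((frv Z i z.1 _)^*); apply/funext => q; rewrite scjE cjK.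
Qed.

Lemma scj_fw i a b : scj (fw F i a b) = - fw F (isw i) b a.
Proof.
apply: sfun_ext => z Dz; rewrite scjE (svalN Dz) !sval_fw //.
by have := omega_skew nabla uf (isw i) a b (proj1 Dz); rewrite iswK => ->.
Qed.

Lemma scj_D x : scj (fD F x) = fD F (scj x).
Proof.
apply: sfun_ext => z Dz; rewrite scjE !mksE //.
have [h1 h2] := st_sval x; have [d1 d2] := (rdt_is_derive h1 Dz, rdt_is_derive h2 Dz).
apply: complex_ext; rewrite ?ReJ ?ImJ /=; symmetry; apply: rdtE.
  by under eq_fun do rewrite scjE ReJ.
by under eq_fun do rewrite scjE ImJ; apply: is_deriveN.
Qed.

Section Real.
Variable f : sfun P.
Hypothesis rf : scj f = f.

Lemma grad_conj a : grad (swap F) f a = scj (grad F f a).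
Proof. by rewrite /grad scj_fe rf. Qed.

Lemma hessZ_conj a b : hessZ (swap F) f a b = scj (hessZ F f a b).
Proof.
rewrite /hessZ /cov scjD scjN scj_sum !scj_fe rf; congr (_ - _).
by apply: eq_bigr => c _; rewrite scjM scj_fe scj_fw rf.
Qed.

Lemma hessW_conj a b : hessW (swap F) f a b = scj (hessW F f a b).
Proof.
rewrite /hessW /cov scjD scjN scj_sum !scj_fe rf; congr (_ - _).
by apply: eq_bigr => c _; rewrite scjM scj_fe scj_fw rf.
Qed.

Lemma real_T : scj (e (iT n) f) = e (iT n) f.
Proof. by rewrite scj_fe rf. Qed.

Lemma real_D : scj (fD F f) = fD F f.
Proof. by rewrite scj_D rf. Qed.

Lemma real_gpair : scj (gpair F f f) = gpair F f f.
Proof.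
rewrite scj_sum; apply: eq_bigr => a _.
by rewrite scjD !scjM !grad_conj !scjK addrC.
Qed.

Lemma real_Im z : complex.Im (sval f z) = 0.
Proof.
have : complex.Im (sval f z) = - complex.Im (sval f z) by rewrite -{1}rf scjE ImJ.
by move=> h; lra.
Qed.

Lemma realE z : sval f z = (complex.Re (sval f z))%:C%C.
Proof. by apply: complex_ext => //=; apply: real_Im. Qed.

End Real.

(** Spatial first derivatives vanish, so the gradient term drops out and the sub-Laplacian reduces
    to the sum of Z_a Z_{\bar a} + Z_{\bar a} Z_a, handled by [vfield_max]. Only earlier times are
    compared, and the derivative in the direction -1 gives the sign of the time derivative. *)
Lemma max_conditions x z (h : R) : scj x = x -> stdom P z -> 0 < h ->
  (forall q, V q -> complex.Re (sval x (q, z.2)) <= complex.Re (sval x z)) ->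
  (forall s : R, 0 < s < h -> complex.Re (sval x (z.1, z.2 - s)) <= complex.Re (sval x z)) ->
  forall f, complex.Re (sval (heat_op F f x) z) <= 0.
Proof.
move=> rx Dz h0 mxs mxt f; have [Vz tz] := Dz; have oV := p_open P.
have ez : (z.1, z.2) = z by case: (z).
pose r q := complex.Re (sval x (q, z.2)).
have hr : rsmooth_on V r by apply: (rsm_slice tz (proj1 (st_sval x))).
have er : (fun q => sval x (q, z.2)) = (fun q => (r q)%:C%C).
  by apply/funext => q; exact: realE.
have mxr q : V q -> r q <= r z.1 by rewrite /r ez; apply: mxs.
have e0 i : sval (e i x) z = 0.
  by rewrite sval_fe // er; apply: (tangent_max (tangent_frv uf i Vz) oV Vz hr mxr).
have lap0 : complex.Re (sval (lap F x) z) <= 0.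
  have -> : sval (lap F x) z =
      \sum_a (sval (e (iZ a) (e (iW a) x)) z + sval (e (iW a) (e (iZ a) x)) z).
    rewrite /lap (sval_sum Dz); apply: eq_bigr => a _; rewrite (svalD Dz) /hessW /cov.
    rewrite !(svalB Dz) !(sval_sum Dz) [X in _ - X + _]big1 ?[X in _ + (_ - X)]big1; last first.
    - by move=> b _; rewrite (svalM Dz) (e0 (iZ b)) mulr0.
    - by move=> b _; rewrite (svalM Dz) (e0 (iW b)) mulr0.
    by rewrite !subr0 addrC.
  have s0 : \sum_a (sval (e (iZ a) (e (iW a) x)) z + sval (e (iW a) (e (iZ a) x)) z) <= 0.
    apply: sumr_le0 => a _; rewrite !sval_fe2 // er.
    exact: (vfield_max oV Vz (vfield_frv uf (iZ a)) hr mxr).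
  by move: s0; rewrite lecE /= => /andP[_].
have gp0 : sval (gpair F f x) z = 0.
  rewrite (sval_sum Dz) big1 // => a _.
  by rewrite (svalD Dz) !(svalM Dz) (e0 (iZ a)) (e0 (iW a)) !mulr0 addr0.
have D0 : 0 <= complex.Re (sval (fD F x) z).
  rewrite mksE //= -oppr_le0 -mulN1r.
  have d := is_deriveZdir (-1) (rdt_is_derive (proj1 (st_sval x)) Dz).
  apply: dir_max_le0 d h0 _ => s hs.
  by rewrite -[s *: _]/(s * (-1 * 1)) mulr1 mulrN1 ez; apply: mxt.
have -> : sval (heat_op F f x) z = sval (lap F x) z - sval (fD F x) z.
  by rewrite /heat_op (svalB Dz) (svalD Dz) (svalM Dz) gp0 mulr0 addr0.
by rewrite ReD raddfN subr_le0 (le_trans lap0).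
Qed.

Section Estimate.
Hypotheses (n_gt0 : (0 < n)%N) (ric_ge0 : nonneg_ricci nabla).
Variables (f : sfun P) (d eps : R).
Hypotheses (rf : scj f = f) (heat : fD F f = lap F f + gpair F f f) (d7 : 7 < d).

Definition shifted_time : sfun P := mks (st_real (rstD (rst_time P) (rst_cst P (- eps)))).

Definition harnack : sfun P := shifted_time * gpair F f f
  + - (scst P d%:C%C * shifted_time) * fD F f
  + scst P (n%:R / 3)%:C%C * (shifted_time * shifted_time) * (e (iT n) f * e (iT n) f).

Lemma scj_real (r : M * R -> R) (h : rst P r) : scj (mks (st_real h)) = mks (st_real h).
Proof.
by apply: sfun_ext => z Dz; rewrite scjE mksE //; apply: complex_ext; rewrite ?ReJ ?ImJ //= oppr0.
Qed.

Lemma scj_cst (r : R) : scj (scst P r%:C%C) = scst P r%:C%C.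
Proof.
by apply: sfun_ext => z Dz; rewrite scjE mksE //; apply: complex_ext; rewrite ?ReJ ?ImJ //= oppr0.
Qed.

Lemma real_harnack : scj harnack = harnack.
Proof.
rewrite /harnack !scjD !scjM scjN !scjM (scj_real _) !scj_cst real_gpair // real_D // real_T //.
Qed.

Lemma fe_cst i c : e i (scst P c) = 0.
Proof. by apply: (svf_time _ (g := fun=> c)) => z Dz; rewrite mksE. Qed.

Lemma fD_cst c : fD F (scst P c) = 0.
Proof.
have -> : scst P c = sspace (sm_cst V c) by apply: sfun_ext => z Dz; rewrite !mksE.
exact: sD_space.
Qed.

Lemma fe_shifted_time i : e i shifted_time = 0.
Proof. by apply: (svf_time _ (g := fun s => (s - eps)%:C%C)) => z Dz; rewrite mksE. Qed.

Lemma fD_shifted_time : fD F shifted_time = 1.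
Proof.
apply: sfun_ext => z Dz; rewrite (sval1 Dz) mksE //.
rewrite (sdt_local (P := P) (w' := fun z => (z.2 - eps)%:C%C)) //; last by move=> y Dy; rewrite mksE.
apply: complex_ext; rewrite /=; apply: rdtE => /=; last exact: is_derive_cst.
by have := is_derive_shift z.2 (1 : R) (- eps); rewrite /shift.
Qed.

(** Taking real parts in [evolution] at the point [z] produces the hypotheses of [max_estimate]. *)
Lemma harnack_max z : stdom P z -> eps < z.2 ->
  complex.Re (sval (heat_op F f harnack) z) <= 0 ->
  complex.Re (sval harnack z) <= n%:R * d ^+ 2.
Proof.
move=> Dz teps; set t := z.2 - eps; have t0 : 0 < t by rewrite subr_gt0.
rewrite /harnack (evolution heat) ?fe_shifted_time ?fe_cst ?fD_cst ?fD_shifted_time //; last 3 first.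
- by move=> i; apply: fe_shifted_time.
- by move=> i; apply: fe_cst.
- by move=> i; apply: fe_cst.
have tE : sval shifted_time z = t%:C%C by rewrite mksE.
have rT := real_T rf.
pose f0 := complex.Re (sval (e (iT n) f) z).
pose x a := complex.Re (sval (e (iZ a) f) z); pose y a := complex.Im (sval (e (iZ a) f) z).
pose p a := complex.Re (sval (e (iZ a) (e (iT n) f)) z).
pose q a := complex.Im (sval (e (iZ a) (e (iT n) f)) z).
pose mu a := complex.Re (sval (hessW F f a a) z).
have Re2 (u : R[i]) : complex.Re (2 * u) = 2 * complex.Re u.
  by case: u => u1 u2; rewrite ReM /=; ring.
have Re4 (u : R[i]) : complex.Re (4 * u) = 4 * complex.Re u.
  by case: u => u1 u2; rewrite ReM /=; ring.
have Re_sum (I : Type) (l : seq I) (G : I -> R[i]) :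
    complex.Re (\sum_(k <- l) G k) = \sum_(k <- l) complex.Re (G k).
  by apply: (big_morph (@complex.Re R)) => //; exact: ReD.
have gE (g : sfun P) : scj g = g -> complex.Re (sval (gpair F g g) z) =
    2 * \sum_a (complex.Re (sval (e (iZ a) g) z) ^+ 2 + complex.Im (sval (e (iZ a) g) z) ^+ 2).
  move=> rg; rewrite gpair_diag (svalM Dz) (sval_nat Dz) Re2 /grad_sq (sval_sum Dz) Re_sum.
  congr (_ * _); apply: eq_bigr => a _; rewrite (svalM Dz) (grad_conj rg) scjE ReM ReJ ImJ /grad.
  by ring.
have kE := gE f rf; have k0E := gE _ rT.
have LE : complex.Re (sval (lap F f) z) = 2 * \sum_a mu a.
  rewrite (sval_sum Dz) Re_sum mulr_sumr; apply: eq_bigr => a _.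
  by rewrite (svalD Dz) ReD hessW_conj // scjE ReJ /mu; ring.
have DE : complex.Re (sval (fD F f) z) =
    complex.Re (sval (lap F f) z) + complex.Re (sval (gpair F f f) z).
  by rewrite heat (svalD Dz) ReD.
have hsE : \sum_a (mu a ^+ 2 + f0 ^+ 2 / 4) <= complex.Re (sval (hess_sq F f) z).
  rewrite (sval_sum Dz) Re_sum; apply: ler_sum => a _; rewrite (sval_sum Dz) Re_sum.
  have sq (u : sfun P) : complex.Re (sval (u * scj u) z) =
      complex.Re (sval u z) ^+ 2 + complex.Im (sval u z) ^+ 2.
    by rewrite (svalM Dz) scjE ReM ReJ ImJ; ring.
  (* Of the squared norm of the Hessian only the diagonal entries f_{a \bar a} are kept; all other
     terms are nonnegative. *)
  rewrite (bigD1 a) //= hessZ_conj // hessW_conj // (svalD Dz) ReD !sq.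
  have im2 : complex.Im (sval (hessW F f a a) z) ^+ 2 = f0 ^+ 2 / 4.
    (* For real [f] the relation f_{a \bar a} - f_{\bar a a} = i T f says that twice the imaginary
       part of f_{a \bar a} is T f. *)
    have := hessW_swap F f a a; rewrite hessW_conj // eqxx mulr1n.
    move: (hessW F f a a) => u hu; have : complex.Im (sval u z) = - complex.Im (sval u z) + f0.
      rewrite {1}hu (svalD Dz) (svalM Dz) scjE ImD ImJ ImM.
      have -> : sval (im F) z = 'i by exact: mksE.
      by rewrite (real_Im rT) /= mulr0 add0r mul1r.
    move=> h; have -> : complex.Im (sval u z) = f0 / 2 by lra.
    by field.
  rewrite im2 -/(mu a); set rest := \sum_(_ | _) _.
  have r0 : 0 <= rest.
    apply: sumr_ge0 => b _; rewrite hessZ_conj // hessW_conj // (svalD Dz) ReD !sq.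
    by rewrite !addr_ge0 ?sqr_ge0.
  have := sqr_ge0 (complex.Re (sval (hessZ F f a a) z)).
  by have := sqr_ge0 (complex.Im (sval (hessZ F f a a) z)); lra.
have ricE : 0 <= complex.Re (sval (ric_form F f) z).
  (* [ric_form] pairs R_{a \bar b} with f_{\bar a} f_b, so the Ricci form is evaluated on the vector
     with components f_{\bar a}. *)
  have := ric_ge0 (fun a => sval (grad (swap F) f a) z) uf (proj1 Dz).
  have -> : \sum_a \sum_b ricci nabla Z th a b z.1 * sval (grad (swap F) f a) z *
      (sval (grad (swap F) f b) z)^* = sval (ric_form F f) z.
    rewrite (sval_sum Dz); apply: eq_bigr => a _; rewrite (sval_sum Dz); apply: eq_bigr => b _.
    by rewrite !(svalM Dz) sval_ric // (grad_conj rf b) scjE cjK.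
  by rewrite lecE /= => /andP[].
have torE : complex.Re (sval (torsion_term F f) z) = \sum_a (2 * (y a * p a - x a * q a)).
  rewrite (svalM Dz) (sval_sum Dz) mulr_sumr Re_sum; apply: eq_bigr => a _.
  have -> : sval (im F) z = 'i by exact: mksE.
  rewrite (svalB Dz) !(svalM Dz) (grad_conj rf) (grad_conj rT) !scjE /grad.
  rewrite !(ReM, ImM, ReD, ImD, ReJ, ImJ) !raddfN /= !(ReM, ImM, ReJ, ImJ) -/(x a) -/(y a) -/(p a) -/(q a).
  by ring.
have ReR (r : R) (u : R[i]) : complex.Re (r%:C%C * u) = r * complex.Re u.
  by case: u => u1 u2; rewrite ReM /=; ring.
have c0 : sval (scst P d%:C%C) z = d%:C%C by exact: mksE.
have ck : sval (scst P (n%:R / 3)%:C%C) z = (n%:R / 3)%:C%C by exact: mksE.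
have f0E : sval (e (iT n) f) z = f0%:C%C by exact: (realE rT).
set k := complex.Re (sval (gpair F f f) z) in kE DE.
set g := complex.Re (sval (fD F f) z) in DE.
set L := complex.Re (sval (lap F f) z) in LE DE.
have HE : complex.Re (sval harnack z) = t * k - d * t * g + n%:R / 3 * (t * t) * (f0 * f0).
  rewrite !(svalD Dz) !(svalM Dz) (svalN Dz) !(svalM Dz) tE c0 ck f0E -!rmorphM -rmorphN !ReD !ReR.
  by rewrite -/k -/g /=; ring.
rewrite -/harnack HE => h.
apply: (max_estimate (x := x) (y := y) (p := p) (q := q) n_gt0 d7 t0 kE LE DE hsE ricE).
apply: le_trans h; rewrite le_eqVlt; apply/orP; left; apply/eqP.
rewrite -torE -k0E !(svalD Dz, svalN Dz) !(svalM Dz) !(svalD Dz) !(svalM Dz) !(sval_nat Dz) tE c0 ck f0E.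
rewrite (sval1 Dz) -!mulrA -[1 + 1]/(2 : R[i]) !(ReD, raddfN) /= !(ReR, Re2, Re4, ReD) -/k -/g.
ring.
Qed.

End Estimate.

End LocalEstimate.

(** * From the heat equation for u to the equation for its logarithm *)

Section LogHeat.
Variables (n : nat) (A : comPzRingType) (F : crframe n A) (u f : A).
Hypothesis hf : forall i, fe F i u = u * fe F i f.

Lemma hessW_log (G : crframe n A) (hG : forall i, fe G i u = u * fe G i f) a b :
  hessW G u a b = u * (hessW G f a b + fe G (iW b) f * grad G f a).
Proof.
rewrite /hessW /cov /grad !hG feM hG.
under eq_bigr do rewrite hG mulrCA.
by rewrite -mulr_sumr; ring.
Qed.

(** The ring has no exponential; of u = e^f only the first-order relation e_i u = u e_i f is
    retained, and it suffices. *)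
Lemma lap_log : lap F u = u * (lap F f + gpair F f f).
Proof.
have hs i : fe (swap F) i u = u * fe (swap F) i f by exact: hf.
rewrite /lap /gpair -big_split mulr_sumr; apply: eq_bigr => a _ /=.
by rewrite (hessW_log hf) (hessW_log hs) /grad /=; ring.
Qed.

End LogHeat.

Section HeatSolution.
Variables (R : realType) (n : nat) (M : pseudohermitian R n) (nabla : tanaka_webster M).
Hypothesis torsion0 : vanishing_torsion nabla.
Variable v : M -> R -> R.
Hypotheses (sv : smooth_spacetime v) (v_gt0 : forall x (t : R), 0 <= t -> 0 < v x t).

Lemma rst_v (P : patch M) : rst P (fun z => v z.1 z.2).
Proof.
move=> k; apply: sub_Ck (sv (p_atlas P) k) => z [[iz _] _].
by split.
Qed.

Lemma rst_lnv (P : patch M) : rst P (fun z => ln (v z.1 z.2)).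
Proof. by apply: rst_ln (rst_v P) => z [_ /ltW]; apply: v_gt0. Qed.

Definition lnv (P : patch M) : sfun P := mks (st_real (rst_lnv P)).

Lemma rdt_lnv (P : patch M) z : stdom P z ->
  rdt (fun z => v z.1 z.2) z = v z.1 z.2 * rdt (fun z => ln (v z.1 z.2)) z.
Proof.
move=> Dz; have vz : 0 < v z.1 z.2 by apply: v_gt0; case: Dz => _ /ltW.
have d := rdt_is_derive (rst_v P) Dz.
have dl := is_derive1_ln vz; have dv := is_derive_comp1 d dl.
by rewrite (rdtE (r := fun z => ln (v z.1 z.2)) dv) mulrA mulfV ?mul1r // gt_eqF.
Qed.

Section Frame.
Variables (P : patch M) (Z : 'I_n -> vfield M) (th : 'I_n -> oneform M).
Hypothesis uf : unitary_frame (pset P) Z th.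
Hypothesis heat : forall x (t : R), pset P x -> 0 < t ->
  sublaplacian nabla Z th (cfun (fun y => v y t)) x = (derive1 (v x) t)%:C%C.
Local Notation V := (pset P).
Local Notation F := (crf torsion0 uf).

(** Elements of [sfun] are cut off outside the patch and so differ from the solution globally; the
    sub-Laplacian sees only germs. *)
Lemma sublaplacian_local (g h : M -> R[i]) p : V p -> smooth_on V g ->
  (forall q, V q -> g q = h q) -> sublaplacian nabla Z th g p = sublaplacian nabla Z th h p.
Proof.
move=> Vp hg e; have oV := p_open P.
have e1 i q : V q -> frv Z i q g = frv Z i q h.
  by move=> Vq; apply: (tangent_local (tangent_frv uf i Vq) oV Vq (smooth_at_on oV Vq hg)).
have e2 i j : frv Z i p (fun q => frv Z j q g) = frv Z i p (fun q => frv Z j q h).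
  apply: (tangent_local (tangent_frv uf i Vp) oV Vp _ (e1 j)).
  exact: (smooth_at_on oV Vp (vfield_app oV (vfield_frv uf j) hg)).
apply: eq_bigr => a _; rewrite /hess_abar /hess_bara; congr (_ - _ + (_ - _)).
- exact: (e2 (iW a) (iZ a)).
- by apply: eq_bigr => c _; congr (_ * _); exact: (e1 (iZ c)).
- exact: (e2 (iZ a) (iW a)).
- by apply: eq_bigr => c _; congr (_ * _); exact: (e1 (iW c)).
Qed.

Lemma lnv_heat : fD F (lnv P) = lap F (lnv P) + gpair F (lnv P) (lnv P).
Proof.
pose u : sfun P := mks (st_real (rst_v P)).
have uf_fe i : fe F i u = u * fe F i (lnv P).
  apply: sfun_ext => z Dz; have [Vz tz] := Dz; rewrite (svalM Dz) !sval_fe //.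
  rewrite (vf_slice (w := fun z => (v z.1 z.2)%:C%C) (vfield_frv uf i) Dz); last by move=> y; apply: mksE.
  rewrite (vf_slice (w := fun z => (ln (v z.1 z.2))%:C%C) (vfield_frv uf i) Dz); last by move=> y; apply: mksE.
  rewrite mksE //; apply: (tangent_ln (p_atlas P) (tangent_frv uf i Vz) (p_open P) Vz (p_sub Vz)).
    exact: (rsm_slice tz (rst_v P)).
  by move=> q _; apply/v_gt0/ltW.
have sdr (r : M * R -> R) z : sdt (fun z => (r z)%:C%C) z = (rdt r z)%:C%C.
  by apply: complex_ext => //=; apply: rdtE; exact: is_derive_cst.
apply: sfun_ext => z Dz; have [Vz tz] := Dz; have vz := v_gt0 z.1 (ltW tz).
have vz0 : (v z.1 z.2)%:C%C != 0 :> R[i] by rewrite fmorph_eq0 gt_eqF.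
(* Multiplying both sides by v > 0 turns the claim into the heat equation for [v], through [lap_log]
   and [rdt_lnv]. *)
apply: (mulfI vz0); have uz : sval u z = (v z.1 z.2)%:C%C by exact: mksE.
rewrite -[in RHS]uz -(svalM Dz) -(lap_log uf_fe) sval_lap //.
rewrite (sublaplacian_local (h := cfun (fun y => v y z.2)) Vz); last 2 first.
- exact: (sm_slice tz (st_sval u)).
- by move=> q Vq; rewrite mksE.
rewrite heat // -[derive1 _ _]/(rdt (fun z => v z.1 z.2) z) (rdt_lnv Dz) rmorphM; congr (_ * _).
rewrite mksE // (sdt_local (w' := fun z => (ln (v z.1 z.2))%:C%C) _ Dz); last by move=> y; apply: mksE.
exact: sdr.
Qed.

End Frame.

End HeatSolution.

(** * Independence of the subgradient norm from the unitary frame *)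

Section FrameIndependence.
Variables (R : realType) (n : nat) (M : pseudohermitian R n).
Variables (P : patch M) (Z : 'I_n -> vfield M) (th : 'I_n -> oneform M).
Hypothesis uf : unitary_frame (pset P) Z th.
Variables (U : set M) (Z' : 'I_n -> vfield M) (th' : 'I_n -> oneform M).
Hypothesis uf' : unitary_frame U Z' th'.
Local Notation V := (pset P).
Implicit Types (p q : M) (a b c : 'I_n).

(** Projecting the expansion of Z'_a in the full frame onto T_{1,0} removes the barred and Reeb
    components. *)
Lemma frame_change p a : V p -> U p ->
  tveq p (Z' a p) (tsum (index_enum _) (fun c => th c p (Z' a p)) (fun c => Z c p)).
Proof.
move=> Vp Up; have [hZ' tZ'] := uf_T10 uf' a; have tv := proj1 hZ' p Up.
have span : tveq p (Z' a p) (tsum (index_enum _) (fun k => cofr th k p (Z' a p)) (fun k => frv Z k p)).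
  by move=> f hf; exact: (frame_span uf).
have ps := proj_tsum tv (fun k => tangent_frv uf k Vp) span.
move=> f hf; rewrite -(proj_T10 (tZ' p Up) hf) (ps f hf) /tsum sum_frame_index /=.
have [T1 T2] : (forall c, proj p (frv Z (iZ c) p) f = Z c p f) /\
    (forall c, proj p (frv Z (iW c) p) f = 0).
  split=> c; have [_ hc] := uf_T10 uf c; first exact: (proj_T10 (hc p Vp) hf).
  exact: (proj_T01 (hc p Vp) hf).
under eq_bigr do rewrite T1.
rewrite [X in _ + X + _]big1 ?addr0; last by move=> c _; rewrite T2 mulr0.
by have -> : proj p (@reeb R n M p) f = 0 := proj_reeb hf; rewrite mulr0 addr0.
Qed.

(** Orthonormality of both frames for the Levi form makes the rows of the change-of-frame matrix
    orthonormal; it is square, so its columns are orthonormal too. *)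
Lemma frame_change_unitary p c d : V p -> U p ->
  \sum_a th c p (Z' a p) * (th d p (Z' a p))^* = (c == d)%:R.
Proof.
move=> Vp Up; pose W := V `&` U; have oW : open W by apply: openI; [exact: p_open | exact: uf_open uf'].
have WV : W `<=` V by move=> q []. have WU : W `<=` U by move=> q [].
have hZ b : vfield_on W (Z b) by apply: vfield_sub WV _; have [] := uf_T10 uf b.
have hZ' b : vfield_on W (Z' b) by apply: vfield_sub WU _; have [] := uf_T10 uf' b.
have sth b a : smooth_on W (fun q => th b q (Z' a q)).
  exact: (sm_form (form_on_sub WV (uf_form uf b)) oW (hZ' a)).
have lev (Y : 'I_n -> vfield M) (A : set M) t a b : unitary_frame A Y t -> A p ->
    levi (Y a) (Y b) p = (a == b)%:R.
  by move=> uY Ap; rewrite /levi (uf_unitary uY) // mulrA mulNr imagM opprK mul1r.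
have Wp : W p by [].
have exp a X : vfield_on W X ->
    levi (Z' a) X p = \sum_c0 th c0 p (Z' a p) * levi (Z c0) X p.
  move=> hX; apply: (levi_tsum (U := W) (l := index_enum _) (a := fun c0 q => th c0 q (Z' a q))) => //.
  by move=> q [Vq Uq]; exact: frame_change.
have row a b : \sum_c0 th c0 p (Z' a p) * (th c0 p (Z' b p))^* = (a == b)%:R.
  rewrite -(lev Z' U th' a b uf' Up) exp //; apply: eq_bigr => c0 _; congr (_ * _).
  rewrite (leviC oW Wp (hZ' b) (hZ c0)) exp // (bigD1 c0) //= (lev Z V th) // eqxx mulr1.
  by rewrite big1 ?addr0 // => d0 dc; rewrite (lev Z V th) // (negbTE dc) mulr0.
have := biorthogonal_sym (g := fun a c0 => th c0 p (Z' a p)) (c := fun c0 b => (th c0 p (Z' b p))^*)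
  erefl row d c.
by rewrite eq_sym => <-; apply: eq_bigr => a _; rewrite mulrC.
Qed.

Lemma subgrad_sq_frame p g : V p -> U p -> smooth_at p g -> subgrad_sq Z' g p = subgrad_sq Z g p.
Proof.
move=> Vp Up hg; congr (2 * _).
have eZ a : Z' a p g = \sum_c th c p (Z' a p) * Z c p g by exact: frame_change.
have eW a : fconj (Z' a) p g = \sum_c (th c p (Z' a p))^* * fconj (Z c) p g.
  rewrite /fconj /tconj (frame_change a Vp Up (smooth_atJ hg)) /tsum cj_sum.
  by apply: eq_bigr => c _; rewrite cjM.
under eq_bigr do rewrite eZ eW mulr_suml.
rewrite exchange_big; apply: eq_bigr => c _ /=.
under eq_bigr do rewrite mulr_sumr.
rewrite exchange_big /= (bigD1 c) //= [X in _ + X]big1 ?addr0.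
  under eq_bigr do rewrite mulrACA.
  by rewrite -mulr_suml frame_change_unitary // eqxx mul1r.
move=> d dc; under eq_bigr do rewrite mulrACA.
by rewrite -mulr_suml frame_change_unitary // eq_sym (negbTE dc) mul0r.
Qed.

End FrameIndependence.

(** * The maximum over M x [eps, T] *)

Section GlobalEstimate.
Variables (R : realType) (n : nat) (M : pseudohermitian R n) (nabla : tanaka_webster M).
Hypotheses (torsion0 : vanishing_torsion nabla) (ric_ge0 : nonneg_ricci nabla).
Hypotheses (n_gt0 : (0 < n)%N) (M_compact : compact [set: M]).
Variable v : M -> R -> R.
Hypotheses (sv : smooth_spacetime v) (v_gt0 : forall x (t : R), 0 <= t -> 0 < v x t).
Hypothesis heat : forall x (t : R), 0 <= t -> forall (U : set M) Z th, unitary_frame U Z th -> U x ->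
  sublaplacian nabla Z th (cfun (fun y => v y t)) x - (derive1 (v x) t)%:C%C = 0.
Local Notation lnslice t := (cfun (fun y => ln (v y t))).

(** The value of [harnack] written with functions on M and a frame as a parameter, so that different
    patches can be compared. *)
Definition harnack_fun (d eps : R) (Z : 'I_n -> vfield M) (z : M * R) : R :=
  (z.2 - eps) * complex.Re (subgrad_sq Z (lnslice z.2) z.1)
  - d * (z.2 - eps) * derive1 (fun s => ln (v z.1 s)) z.2
  + n%:R / 3 * ((z.2 - eps) * (z.2 - eps)) * (complex.Re (@reeb R n M z.1 (lnslice z.2))) ^+ 2.

Section Frame.
Variables (P : patch M) (Z : 'I_n -> vfield M) (th : 'I_n -> oneform M).
Hypothesis uf : unitary_frame (pset P) Z th.
Local Notation V := (pset P).
Local Notation F := (crf torsion0 uf).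
Local Notation f := (lnv sv v_gt0 P).

Lemma real_lnv : scj f = f.
Proof. exact: scj_real. Qed.

Lemma frame_lnv i z : stdom P z -> frv Z i z.1 (fun q => sval f (q, z.2)) = frv Z i z.1 (lnslice z.2).
Proof.
move=> Dz; apply: (vf_slice (w := fun z => (ln (v z.1 z.2))%:C%C) (vfield_frv uf i) Dz) => y Dy.
exact: mksE.
Qed.

Lemma harnackE d eps z : stdom P z ->
  complex.Re (sval (harnack torsion0 uf f d eps) z) = harnack_fun d eps Z z.
Proof.
move=> Dz; rewrite /harnack !(svalD Dz) !(svalM Dz) (svalN Dz) !(svalM Dz).
have -> : sval (shifted_time P eps) z = (z.2 - eps)%:C%C by exact: mksE.
have -> : sval (scst P d%:C%C) z = d%:C%C by exact: mksE.
have -> : sval (scst P (n%:R / 3)%:C%C) z = (n%:R / 3)%:C%C by exact: mksE.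
have -> : sval (fD F f) z = (derive1 (fun s => ln (v z.1 s)) z.2)%:C%C.
  rewrite mksE // (sdt_local (w' := fun z => (ln (v z.1 z.2))%:C%C) _ Dz); last by move=> y; apply: mksE.
  by apply: complex_ext => //=; apply: rdtE; exact: is_derive_cst.
have -> : sval (gpair F f f) z = subgrad_sq Z (lnslice z.2) z.1.
  rewrite sval_gpair // /subgrad_sq; congr (_ * _); apply: eq_bigr => a _.
  by congr (_ * _); [exact: (frame_lnv (iZ a) Dz) | exact: (frame_lnv (iW a) Dz)].
have rT := realE (real_T torsion0 uf real_lnv) z.
rewrite rT; have -> : sval (fe F (iT n) f) z = @reeb R n M z.1 (lnslice z.2).
  by rewrite sval_fe //; exact: (frame_lnv (iT n) Dz).
rewrite /harnack_fun; move: (subgrad_sq _ _ _) (complex.Re (reeb _ _)) (derive1 _ _) => [k k'] r g.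
by rewrite -!rmorphM -rmorphN -rmorphM !ReD ReM /=; ring.
Qed.

Lemma harnack_fun_cont d eps z : stdom P z ->
  harnack_fun d eps Z y @[y --> z] --> harnack_fun d eps Z z.
Proof.
move=> Dz; have oD := @stdom_open _ _ _ P.
pose r z := complex.Re (sval (harnack torsion0 uf f d eps) z).
have hr : rst P r by have [] := st_sval (harnack torsion0 uf f d eps).
have cr := Ck_cont (hr 0%N) (stimg_cmap Dz).
have cc : cmap (pchart P) y.1 @[y --> z] --> cmap (pchart P) z.1.
  have := cmap_cont (p_sub (proj1 Dz)); apply: cvg_comp; exact: cvg_fst.
have cz : {for z, continuous (fun y : M * R => (cmap (pchart P) y.1, y.2))}.
  exact: (cvg_pair cc (@cvg_snd _ _ _ _ _)).
have : pull P r (cmap (pchart P) y.1, y.2) @[y --> z] --> pull P r (cmap (pchart P) z.1, z.2).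
  exact: continuous_comp cz cr.
rewrite (pull_cmap r Dz) /r (harnackE _ _ Dz).
apply: cvg_trans; apply: near_eq_cvg; apply: filterS (open_nbhs_nbhs (conj oD Dz)) => y Dy /=.
by rewrite (pull_cmap r Dy) /r harnackE.
Qed.

(** The comparison involves the patch and the times from [eps] to [z.2] only, so it also covers a
    maximum at the final time; times z.2 - s with 0 < s < z.2 - eps supply the backward difference
    quotients. *)
Lemma harnack_fun_max d eps z : 7 < d -> 0 < eps -> stdom P z -> eps < z.2 ->
  (forall q s, eps <= s -> s <= z.2 -> V q -> harnack_fun d eps Z (q, s) <= harnack_fun d eps Z z) ->
  harnack_fun d eps Z z <= n%:R * d ^+ 2.
Proof.
move=> d7 e0 Dz ez mx; have [Vz tz] := Dz.
have hx q t : V q -> eps <= t -> stdom P (q, t) by move=> Vq et; split=> //=; apply: lt_le_trans et.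
have rf := real_lnv.
have ht x t : V x -> 0 < t -> sublaplacian nabla Z th (cfun (fun y => v y t)) x = (derive1 (v x) t)%:C%C.
  move=> Vx /ltW t0; apply/eqP; rewrite -subr_eq0; apply/eqP.
  by rewrite (heat t0 uf Vx).
have he := lnv_heat torsion0 sv v_gt0 uf ht.
rewrite -harnackE //; apply: harnack_max => //.
have h0 : 0 < z.2 - eps by rewrite subr_gt0.
apply: (@max_conditions _ _ _ _ torsion0 _ _ _ uf _ _ _ (real_harnack torsion0 uf d eps rf) Dz h0).
- move=> q Vq; rewrite (harnackE _ _ Dz) (harnackE _ _ (hx _ _ Vq (ltW ez))).
  by apply: mx => //; exact: ltW.
- move=> s /andP[s0 sh]; have es : eps <= z.2 - s by rewrite lerBrDr -lerBrDl ltW.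
  rewrite (harnackE _ _ Dz) (harnackE _ _ (hx _ _ Vz es)).
  by apply: mx => //; rewrite gerBl ltW.
Qed.

End Frame.

Lemma smooth_at_lnslice p t : 0 < t -> smooth_at p (lnslice t).
Proof.
move=> t0; have [c [U [Z [th [ac Up Uc uf]]]]] := @unitary_frame_exists R n M p.
pose P := Patch ac (uf_open uf) Uc.
exists U; split=> //; first exact: uf_open uf.
exact: (sm_slice (P := P) t0 (st_real (rst_lnv sv v_gt0 P))).
Qed.

Lemma harnack_fun_frame (P : patch M) Z th U Z' th' d eps z : unitary_frame (pset P) Z th ->
  unitary_frame U Z' th' -> pset P z.1 -> U z.1 -> 0 < z.2 ->
  harnack_fun d eps Z' z = harnack_fun d eps Z z.
Proof.
move=> uf uf' Pz Uz tz; rewrite /harnack_fun (subgrad_sq_frame uf uf') //.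
exact: smooth_at_lnslice.
Qed.

(** A patch with a frame is chosen at every point, with no continuity in the point. Frame
    independence identifies [G] near each point with the expression in one fixed frame, so it is
    continuous and attains its maximum on the compact set [K]. *)
Lemma harnack_bound d eps T x (U : set M) Z th : 7 < d -> 0 < eps -> eps < T ->
  unitary_frame U Z th -> U x -> harnack_fun d eps Z (x, T) <= n%:R * d ^+ 2.
Proof.
move=> d7 e0 eT uf Ux.
pose good p (A : patch M * ('I_n -> vfield M) * ('I_n -> oneform M)) :=
  pset A.1.1 p /\ unitary_frame (pset A.1.1) A.1.2 A.2.
have ex p : exists A, good p A.
  have [c [W [Y [et [ac Wp Wc ufW]]]]] := @unitary_frame_exists R n M p.
  by exists (Patch ac (uf_open ufW) Wc, Y, et).
have [A hA] := boolp.choice ex.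
pose G (z : M * R) := harnack_fun d eps (A z.1).1.2 z.
have GE (P : patch M) Y et z : unitary_frame (pset P) Y et -> pset P z.1 -> 0 < z.2 ->
    G z = harnack_fun d eps Y z.
  move=> ufY Pz tz; have [h1 h2] := hA z.1; symmetry.
  exact: (harnack_fun_frame d eps h2 ufY).
pose K : set (M * R) := [set: M] `*` `[eps, T].
have cK : compact K by apply: compact_setX => //; exact: segment_compact.
have Kt z : K z -> eps <= z.2 /\ z.2 <= T by move=> [_]; rewrite /= in_itv /= => /andP[].
have Kx q s : eps <= s -> s <= T -> K (q, s) by move=> h1 h2; split=> //=; rewrite in_itv /= h1 h2.
have cG : {within K, continuous G}.
  apply: continuous_in_subspaceT => z /set_mem /Kt [ez zT]; have tz := lt_le_trans e0 ez.
  have [h1 h2] := hA z.1; have Dz : stdom (A z.1).1.1 z by [].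
  have oD := @stdom_open _ _ _ (A z.1).1.1.
  have := harnack_fun_cont (d := d) (eps := eps) h2 Dz; rewrite /continuous_at -[X in _ --> X](GE _ _ _ _ h2 h1 tz).
  apply: cvg_trans; apply: near_eq_cvg; apply: filterS (open_nbhs_nbhs (conj oD Dz)) => y [Vy ty].
  by rewrite (GE _ _ _ _ h2).
have K0 : K !=set0 by exists (x, T); apply: Kx => //; exact: ltW.
have [z /set_mem Kz mx] := compact_EVT_max K0 cK cG.
have [ez zT] := Kt z Kz; have tz := lt_le_trans e0 ez.
have [h1 h2] := hA x; have GxT : G (x, T) = harnack_fun d eps Z (x, T).
  symmetry; apply: (harnack_fun_frame d eps h2 uf) => //=; exact: lt_trans eT.
rewrite -GxT; apply: (@le_trans _ _ (G z)).
  by apply: mx; apply: mem_set; apply: Kx => //; exact: ltW.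
have [g1 g2] := hA z.1.
move: ez; rewrite le_eqVlt => /orP[/eqP ez|ez].
  (* At the initial time the factor t - eps makes the function vanish. *)
  by rewrite /G /harnack_fun -ez subrr !(mul0r, mulr0) subrr add0r mulr_ge0 ?ler0n ?sqr_ge0.
apply: (harnack_fun_max g2) => // q s es sz Vq.
have s0 := lt_le_trans e0 es.
rewrite -(GE _ _ _ _ g2) // -[X in _ <= X]/(G z); apply: mx; apply: mem_set; apply: Kx => //.
exact: le_trans zT.
Qed.

End GlobalEstimate.

(** The first entry of the maximum exceeds n (n + 1) d^2, which is at least 2 n d^2 because n + 1 >=
    2. *)
Lemma C1_gt (R : realType) (n : nat) (d d0 : R) : (0 < n)%N -> 0 < d0 -> d0 < d ->
  n%:R * d ^+ 2 < C1 n d d0.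
Proof.
move=> n_gt0 d00 d0d; have n1 : (1 : R) <= n%:R by rewrite ler1n.
have s3 : 0 < 8 * Num.sqrt (3 : R) * (n%:R + 1) ^+ 2 * d ^+ 2 / (d - d0).
  by rewrite divr_gt0 ?subr_gt0 // !mulr_gt0 ?sqrtr_gt0 ?exprn_gt0 //; lra.
have h : 2 * (n%:R * d ^+ 2) <= n%:R * (n%:R + 1) * d ^+ 2.
  have -> : 2 * (n%:R * d ^+ 2) = n%:R * 2 * d ^+ 2 by ring.
  by rewrite ler_wpM2r ?sqr_ge0 // ler_wpM2l; lra.
rewrite /C1; set A := Num.max _ _.
have : n%:R * (n%:R + 1) * d ^+ 2 + 8 * Num.sqrt 3 * (n%:R + 1) ^+ 2 * d ^+ 2 / (d - d0) <= A.
  by rewrite /A le_max lexx.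
by move=> hA; lra.
Qed.

Lemma Im_subgrad_sq (R : realType) (n m : nat) (M : manifold R m) (Z : 'I_n -> vfield M) (r : M -> R) p :
  complex.Im (subgrad_sq Z (cfun r) p) = 0.
Proof.
have Im_sum (I : Type) (l : seq I) (G : I -> R[i]) :
    complex.Im (\sum_(k <- l) G k) = \sum_(k <- l) complex.Im (G k).
  by apply: (big_morph (@complex.Im R)) => //; exact: ImD.
rewrite /subgrad_sq mulr_sumr Im_sum big1 // => a _.
have -> : fconj (Z a) p (cfun r) = (Z a p (cfun r))^*.
  rewrite /fconj /tconj; congr ((Z a p _)^*); apply/funext => q.
  by apply: complex_ext; rewrite ?ReJ ?ImJ //= oppr0.
by case: (Z a p _) => x y; rewrite !ImM ReM ImJ ReJ /=; ring.
Qed.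

Unset Implicit Arguments.

Theorem corollary1p1 (R : realType) (n : nat) (n_gt0 : (0 < n)%N) :
  exists delta0 : R, 1 < delta0 /\
  forall (M : pseudohermitian R n) (nabla : tanaka_webster M),
    compact [set: M] -> nonneg_ricci nabla -> vanishing_torsion nabla ->
  forall u : M -> R -> R,
    (forall x t, 0 <= t -> 0 < u x t) -> heat_solution nabla u ->
  let f := fun (x : M) (t : R) => ln (u x t) in
  forall delta : R, delta0 < delta ->
  forall (x : M) (t : R), 0 < t ->
  forall (U : set M) (Z : 'I_n -> vfield M) (th : 'I_n -> oneform M),
    unitary_frame U Z th -> U x ->
    subgrad_sq Z (cfun (fun y => f y t)) x - (delta * derive1 (f x) t)%:C%C
      < (C1 n delta delta0 / t)%:C%C.

Proof.
(* The constant of [final_estimate]: beyond it (delta - 1) G dominates 6 G / n for every n >= 1. *)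
exists 7; split; first by lra.
move=> M nabla Mc ric tor u u_gt0 [v [sv uv heat]] f d d7 x t t0 U Z th uf Ux.
have v_gt0 y (s : R) : 0 <= s -> 0 < v y s by move=> s0; rewrite -uv //; apply: u_gt0.
have fE : cfun (fun y => f y t) = cfun (fun y => ln (v y t)).
  by apply/funext => y; rewrite /cfun /f uv // ltW.
(* The functions [u] and [v] agree only for nonnegative times, which form a neighbourhood of the
   given t > 0; hence the derivatives coincide. *)
have dE : derive1 (f x) t = derive1 (fun s => ln (v x s)) t.
  rewrite !derive1E; apply: near_eq_derive; apply: filterS (lt_nbhsr t0) => s s0.
  by rewrite /f uv // ltW.
rewrite fE dE; set S := subgrad_sq Z _ x; set g := derive1 _ t.
(* The order on [R[i]] compares numbers with equal imaginary parts, so the squared gradient must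
   first be recognized as real. *)
have -> : S = (complex.Re S)%:C%C by apply: complex_ext => //; apply: Im_subgrad_sq.
set k := complex.Re S; rewrite -rmorphB ltcR.
have bound eps : 0 < eps -> eps < t -> (t - eps) * (k - d * g) <= n%:R * d ^+ 2.
  move=> e0 et.
  have := harnack_bound tor ric n_gt0 Mc sv v_gt0 heat d7 e0 et uf Ux.
  apply: le_trans; rewrite /harnack_fun /= -/S -/k -/g; set q := complex.Re _.
  have te : 0 <= t - eps by rewrite subr_ge0 ltW.
  (* The term in (T f)^2 has served the maximum principle and is dropped from the bound, being
     nonnegative. *)
  have : 0 <= n%:R / 3 * ((t - eps) * (t - eps)) * q ^+ 2.
    by rewrite mulr_ge0 ?sqr_ge0 // mulr_ge0 ?divr_ge0 ?ler0n ?mulr_ge0.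
  move: (n%:R / 3 * _ * _) => c c0; rewrite mulrBr; lra.
have C1N : n%:R * d ^+ 2 < C1 n d 7 by apply: C1_gt => //; lra.
have N0 : 0 <= n%:R * d ^+ 2 by rewrite mulr_ge0 ?sqr_ge0.
set N := n%:R * d ^+ 2 in bound C1N N0; set C := C1 n d 7 in C1N *.
have Cp : 0 < C by apply: le_lt_trans C1N.
rewrite ltNge; apply/negP => Ck.
(* At this [eps] the bound [N / (t - eps)] is smaller than [C / t]. *)
pose eps := t * (C - N) / (2 * C).
have e0 : 0 < eps by rewrite divr_gt0 // mulr_gt0 // subr_gt0.
have et : t - eps = t * (C + N) / (2 * C) by rewrite /eps; field; rewrite gt_eqF.
have tp : 0 < t - eps by rewrite et divr_gt0 // mulr_gt0 // ltr_wpDr.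
have := bound eps e0; rewrite -subr_gt0 => /(_ tp).
apply/negP; rewrite -ltNge; apply: lt_le_trans (_ : (t - eps) * (C / t) <= _); last by rewrite ler_pM2l.
have -> : (t - eps) * (C / t) = (C + N) / 2 by rewrite et; field; rewrite !gt_eqF.
by lra.
Qed.
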